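(* $S_{D_{2d}}$ is an arithmetically Cohen-Macaulay surface of degree $\deg(S_{D_{2d}})=2d$, regularity $3$, codimension $\frac12(3d+\gcd(d,2)-2)$ and Cohen-Macaulay type $\frac12(d-\gcd(d,2))$. In particular, $S_{D_{2d}}$ is Gorenstein if and only if $d=3$ or $d=4$.
   Context: Let $k$ be an algebraically closed field of characteristic zero and $R=k[x_0,x_1,x_2]$ with its standard grading. Fix integers $d\ge 3$ and $0<a<\frac d2$ with $\gcd(a,d)=1$, a primitive $2d$-th root of unity $\varepsilon\in k$, and set $e=\varepsilon^2$. The dihedral group $D_{2d}=\langle \tau,\eta \mid \tau^d=\eta^2=(\eta\tau)^2=1\rangle$ of order $2d$ acts linearly on $R$ with $\tau$ acting as $\mathrm{diag}(1,e^a,e^{d-a})$ and $\eta$ acting as the permutation matrix fixing $x_0$ and interchanging $x_1$ and $x_2$. Let $\Gamma=\langle \mathrm{diag}(1,e,e^{d-1})\rangle\subset\mathrm{GL}(3,k)$, which is the image of $\langle\tau\rangle$, with ring of invariants $R^\Gamma$. Let $\mathcal{B}_{2d}$ be the set consisting of the monomials $x_0^{2d-2i}x_1^ix_2^i$, $0\le i\le d$, and all binomials $x_0^{c_0}x_1^{c_1}x_2^{c_2}+x_0^{c_0}x_1^{c_2}x_2^{c_1}$ with $c_0+c_1+c_2=2d$, $c_1\neq c_2$ and $x_0^{c_0}x_1^{c_1}x_2^{c_2}\in R^{\Gamma}$. Put $\mu_{2d}=|\mathcal{B}_{2d}|$. The elements of $\mathcal{B}_{2d}$ define a morphism $\varphi:\mathbb{P}^2\to\mathbb{P}^{\mu_{2d}-1}$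 with image $S_{D_{2d}}=\varphi(\mathbb{P}^2)$, called the $GT$-surface with group $D_{2d}$. Let $S$ be the homogeneous coordinate ring of $\mathbb{P}^{\mu_{2d}-1}$ and $I(S_{D_{2d}})\subset S$ the homogeneous ideal of $S_{D_{2d}}$. The properties ''arithmetically Cohen-Macaulay'', ''Gorenstein'' and the Cohen-Macaulay type refer to the homogeneous coordinate ring $S/I(S_{D_{2d}})$; the regularity of $S_{D_{2d}}$ is the Castelnuovo-Mumford regularity of the projective variety, i.e. of the ideal $I(S_{D_{2d}})$; codimension is taken in $\mathbb{P}^{\mu_{2d}-1}$. *)

(* Defs.v *)
From HB Require Import structures.
From mathcomp Require Import all_boot all_order all_algebra.
From mathcomp Require Export mpoly.
Set Implicit Arguments.
Unset Strict Implicit.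
Unset Printing Implicit Defensive.
Import GRing.Theory.
Local Open Scope ring_scope.

(* Projective varieties.  A subset of P^(n-1) is given by the set of its      *)
(* homogeneous coordinate vectors ('I_n -> k), closed under nonzero scaling.  *)
(* Ideals of S = k[w_0, ..., w_(n-1)] are Prop-valued predicates on S, and    *)
(* S/I is handled through I: ideals of S/I are the ideals of S containing I.  *)

Section ProjectiveAlgebra.
Variables (k : fieldType) (n : nat).
Local Notation S := {mpoly k[n]}.
Implicit Types (I : S -> Prop) (X : ('I_n -> k) -> Prop).

(* I(X): the polynomials all of whose homogeneous components vanish on X,     *)
(* i.e. the ideal generated by the forms vanishing on X.                      *)
Definition homog_ideal X : S -> Prop :=
  fun f => forall t y, X y -> (pihomog mdeg t f).@[y] = 0.

(* P 0 < P 1 < ... < P r is a strict chain of primes of S containing I.       *)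
Definition prime_chain I (r : nat) (P : nat -> {pred S}) : Prop :=
  [/\ forall i, (i <= r)%N ->
        [/\ idealr_closed (P i), prime_idealr_closed (P i)
          & forall f, I f -> f \in P i]
    & forall i, (i < r)%N ->
        {subset P i <= P i.+1} /\ exists2 f, f \in P i.+1 & f \notin P i].

Definition krull_dim I (r : nat) : Prop :=
  (exists P, prime_chain I r P) /\
  (forall s P, prime_chain I s P -> (s <= r)%N).

(* The ideal I + (fs). *)
Definition ideal_adjoin I (fs : seq S) : S -> Prop :=
  fun h => exists2 g, I g &
    exists c : 'I_(size fs) -> S, h = g + \sum_(j < size fs) c j * fs`_j.

(* fs is an S/I-regular sequence of elements of the irrelevant ideal.         *)
Definition regular_seq I (fs : seq S) : Prop :=
  [/\ forall f, f \in fs -> f@_0%MM = 0,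
      forall i h, (i < size fs)%N ->
        ideal_adjoin I (take i fs) (fs`_i * h) -> ideal_adjoin I (take i fs) h
    & ~ ideal_adjoin I fs 1].

(* Depth of S/I with respect to the irrelevant ideal.                         *)
Definition has_depth I (r : nat) : Prop :=
  (exists2 fs, regular_seq I fs & size fs = r) /\
  (forall fs, regular_seq I fs -> (size fs <= r)%N).

Definition cohen_macaulay I : Prop :=
  exists2 r, krull_dim I r & has_depth I r.

Definition arithmetically_CM X : Prop := cohen_macaulay (homog_ideal X).

Definition proj_dim X (r : nat) : Prop := krull_dim (homog_ideal X) r.+1.

(* Codimension in P^(n-1). *)
Definition proj_codim X (c : nat) : Prop :=
  exists2 r, proj_dim X r & (r + c)%N = n.-1.

(* dim_k (S/I)_t = h: some h forms of degree t are a basis of S_t modulo I_t. *)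
Definition hilbert_function I (t h : nat) : Prop :=
  exists e : 'I_h -> S,
    [/\ forall i, e i \is t.-homog,
        forall c : 'I_h -> k, I (\sum_i c i *: e i) -> forall i, c i = 0
      & forall f, f \is t.-homog ->
          exists c : 'I_h -> k, I (f - \sum_i c i *: e i)].

Definition hilbert_polynomial I (P : {poly rat}) : Prop :=
  exists N, forall t, (N <= t)%N ->
    exists2 h, hilbert_function I t h & P.[t%:R] = h%:R.

Definition proj_degree X (D : nat) : Prop :=
  exists r P, [/\ proj_dim X r, hilbert_polynomial (homog_ideal X) P,
    size P = r.+1 & r`!%:R * lead_coef P = D%:R].

(* Graded free modules F_i = \bigoplus_j S(- fshift i j), as row vectors,     *)
(* with differentials v |-> v *m fdiff i : F_(i+1) -> F_i.                   *)
Record graded_free_seq := GradedFreeSeq {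
  frank : nat -> nat;
  fshift : forall i, 'I_(frank i) -> nat;
  fdiff : forall i, 'M[S]_(frank i.+1, frank i)
}.

(* F is a minimal graded free resolution of S/I, with F_0 = S; thus           *)
(* F_1 <- F_2 <- ... is a minimal graded free resolution of I.                *)
Definition minimal_resolution I (F : graded_free_seq) : Prop :=
  [/\ frank F 0 = 1%N /\ (forall l : 'I_(frank F 0), fshift l = 0%N),
      forall f, I f <-> exists v : 'rV[S]_(frank F 1),
        forall l : 'I_(frank F 0), (v *m fdiff F 0) 0 l = f,
      forall i (v : 'rV[S]_(frank F i.+1)), v *m fdiff F i = 0 <->
        exists w : 'rV[S]_(frank F i.+2), v = w *m fdiff F i.+1,
      forall i (j : 'I_(frank F i.+1)) (l : 'I_(frank F i)),
        fdiff F i j l = 0 \/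
        exists2 t, (t + fshift l)%N = fshift j & fdiff F i j l \is t.-homog
    & forall i (j : 'I_(frank F i.+1)) (l : 'I_(frank F i)),
        (fdiff F i j l)@_0%MM = 0].

(* reg(I) = max (b_(i,j) - i), the b_(i,j) being the shifts of the i-th       *)
(* module F_(i+1) of the minimal resolution of the ideal I (not of S/I).      *)
Definition regularity X (r : nat) : Prop :=
  exists2 F, minimal_resolution (homog_ideal X) F &
    (forall i (j : 'I_(frank F i.+1)), (fshift j <= r + i)%N) /\
    (exists i (j : 'I_(frank F i.+1)), fshift j = (r + i)%N).

(* Rank of the last nonzero module of the minimal resolution of S/I(X), which *)
(* is the Cohen-Macaulay type when X is arithmetically Cohen-Macaulay.        *)
Definition CM_type X (r : nat) : Prop :=
  arithmetically_CM X /\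
  exists2 F, minimal_resolution (homog_ideal X) F &
    exists p, [/\ frank F p = r, (0 < r)%N
                & forall i, (p < i)%N -> frank F i = 0%N].

(* Hom_S(F, S): column vectors, v |-> fdiff i *m v : F_i^* -> F_(i+1)^*.     *)
Definition dual_cocycle (F : graded_free_seq) i (v : 'cV[S]_(frank F i)) :=
  fdiff F i *m v = 0.

Definition dual_coboundary (F : graded_free_seq) i :
    'cV[S]_(frank F i) -> Prop :=
  match i with
  | 0 => fun v => v = 0
  | i'.+1 => fun v => exists u : 'cV[S]_(frank F i'), v = fdiff F i' *m u
  end.

(* A = S/I(X) is Gorenstein: A is Cohen-Macaulay and its canonical module     *)
(* Ext^c_S(A, S) (up to twist; c the codimension) is isomorphic to a twist    *)
(* of A, i.e. generated by one homogeneous class z, of degree m, whose        *)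
(* annihilator is I(X).                                                       *)
Definition arithmetically_Gorenstein X : Prop :=
  arithmetically_CM X /\
  exists F c, [/\ minimal_resolution (homog_ideal X) F, proj_codim X c &
    exists (z : 'cV[S]_(frank F c)) (m : int),
      [/\ dual_cocycle z,
          forall j, z j 0 = 0 \/
            exists2 t : nat, t%:Z = m + (fshift j)%:Z & z j 0 \is t.-homog,
          forall v : 'cV[S]_(frank F c), dual_cocycle v ->
            exists s : S, dual_coboundary (v - s *: z)
        & forall s : S, dual_coboundary (s *: z) <-> homog_ideal X s]].

End ProjectiveAlgebra.

Section GTSurface.
Variable k : fieldType.
Local Notation R := {mpoly k[3]}.

Definition lin_act (g : 'M[k]_3) (f : R) : R :=
  f \mPo [tuple \sum_j g i j *: 'X_j | i < 3].

(* The cyclic group generated by diag(1, e, e^(d-1)); as e is a root of       *)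
(* unity, it consists of the nonnegative powers of the generator.             *)
Definition Gamma (d : nat) (e : k) (g : 'M[k]_3) : Prop :=
  exists m, g = diag_mx (\row_(i < 3) [:: 1; e; e ^+ d.-1]`_i) ^+ m.

Definition Gamma_invariant (d : nat) (e : k) (f : R) : Prop :=
  forall g, Gamma d e g -> lin_act g f = f.

Definition monom3 (c0 c1 c2 : nat) : R :=
  'X_(inord 0) ^+ c0 * 'X_(inord 1) ^+ c1 * 'X_(inord 2) ^+ c2.

(* The set B_(2d). *)
Definition GT_generator (d : nat) (e : k) (f : R) : Prop :=
  (exists2 i, (i <= d)%N & f = monom3 (2 * d - 2 * i) i i) \/
  (exists c0 c1 c2, [/\ (c0 + c1 + c2 = 2 * d)%N, c1 != c2,
     Gamma_invariant d e (monom3 c0 c1 c2)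
     & f = monom3 c0 c1 c2 + monom3 c0 c2 c1]).

(* Homogeneous coordinate vectors of the points of phi(P^2), for the map      *)
(* phi = (B_0 : ... : B_(mu-1)).                                              *)
Definition proj_image (mu : nat) (B : mu.-tuple R) (y : 'I_mu -> k) : Prop :=
  exists (p : 'I_3 -> k) (c : k),
    [/\ exists i, p i != 0, c != 0 & forall i, y i = c * (tnth B i).@[p]].

End GTSurface.

(* Main.v *)
Require Import Defs.
From Stdlib Require Import ClassicalEpsilon FunctionalExtensionality PropExtensionality.
From HB Require Import structures.
From mathcomp Require Import all_boot all_order all_algebra zify ring.
Set Implicit Arguments.
Unset Strict Implicit.
Unset Printing Implicit Defensive.
Import GRing.Theory.
Local Open Scope ring_scope.

(** Write x = x_0, u = x_1 x_2 and v = x_1^d + x_2^d.  The generators of the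
surface are polynomials in x, u, v (the only one that is not a monomial is
x_1^(2d) + x_2^(2d) = v^2 - 2 u^d), and since k is algebraically closed the
map p |-> (x(p), u(p), v(p)) from k^3 to k^3 is onto.  Hence the ideal of the
surface is the kernel of the map [toric_map] from S to k[x, u, v] ([GT_idealP]),
and the coordinate ring A is, after a linear change of the last variable, the
semigroup ring spanned by the monomials x^a u^b v^g with 2d dividing
a + 2 b + d g: the 2d-th Veronese subring of k[x, u, v] with weights 1, 2, d.

The division of exponents by (2d, d, 2) shows that A is free over
P = k[x^(2d), u^d, v^2], with the basis of the 2d monomials of [basis_exp].
One of them has degree 0, the next c = d + floor(d/2) have degree 1 and the
remaining 2d - 1 - c have degree 2, where c is the codimension: the number of
generators is c + 3, namely the c basis elements of degree 1, called y_1, ...,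
y_c, and the three parameters.  The parameters form a regular sequence of
length 3 ([toric_regular_seq]) and killing x, u, v successively gives a chain
of primes ([toric_prime_chain]).  Any m + 1 polynomials in m variables are
algebraically dependent, and the terms of lowest order of such a relation
rule out a longer chain of primes as well as a longer regular sequence
([no_relation]), so that dimension and depth are both 3.  The degree is read
off the number d t^2 + (floor(d/2) + 2) t + 1 of monomials of degree t
([hilbert_lattice], [card_lattice]).

For the resolution, A is the quotient of the free module S^(2d) by the images
of the commuting matrices T_l = y_l - Y_l, where Y_l is the matrix over P of
the multiplication by y_l.  The T_l form a regular sequence on S^(2d)
([koszul_mx_regular]), because S^(2d) modulo the images of the first j of them
embeds in a polynomial ring where the next one acts as the nonzero polynomial
y - g, with g the image of y ([partial_eval_kernel]).  So their Koszul complex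
is a graded free resolution of A, of length c.  It is not minimal, but it can
be compared with minimal resolutions: these exist
([minimal_resolution_exists]), have length at most c, and their shifts in step
i are at most 2 + i.  Modulo the variables the comparison identifies the last
module with the common kernel of the matrices T_l, the socle of A modulo the
parameters ([top_rank_shift]).  Every basis element of degree less than 2
divides another one, with a quotient of degree 1 ([level_partner]), so the
socle is spanned by the basis elements of degree 2 ([socleP]).  This gives
the type 2d - 1 - c, the last shift c + 2, and the regularity 3 of the ideal.

The canonical module is the cokernel of the last dual differential.  If one
class generates it, its minimal number of generators, the type, is at most 1
([gorenstein_rank_le1]).  Conversely, if the type is 1, it is generated by
the class of 1, whose annihilator is computed on the Koszul complex: s kills
it if and only if the scalar matrix s is a combination of the T_l, if and
only if s is in the ideal ([annihilatorP]).  Finally 2d - 1 - c = 1 means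
d = 3 or d = 4. *)

(** * Graded matrices over a polynomial ring *)

Section GradedMatrices.
Variables (k : fieldType) (n : nat).
Local Notation S := {mpoly k[n]}.

(** The matrix of a degree 0 map from the sum of the S(- s i) to the sum of
    the S(- t j), acting on row vectors. *)
Definition homog_mx (p q : nat) (s : 'I_p -> nat) (t : 'I_q -> nat)
    (M : 'M[S]_(p, q)) : Prop :=
  forall i j, M i j = 0 \/
    exists2 e, (e + t j)%N = s i & M i j \is e.-homog.

(** The component of degree a - b, which is 0 for b > a in spite of the
    truncated subtraction. *)
Definition graded_part (a b : nat) (f : S) : S :=
  if (b <= a)%N then pihomog mdeg (a - b) f else 0.

(** The projection onto maps of degree 0: it turns any matrix solving a
    homogeneous linear system into a homogeneous solution. *)
Definition homog_part (p q : nat) (s : 'I_p -> nat) (t : 'I_q -> nat)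
    (M : 'M[S]_(p, q)) : 'M[S]_(p, q) :=
  \matrix_(i, j) graded_part (s i) (t j) (M i j).

Lemma graded_partD a b : {morph graded_part a b : f g / f + g}.
Proof. by move=> f g; rewrite /graded_part; case: ifP => _; rewrite ?addr0 ?raddfD. Qed.

Lemma graded_part_sum a b I (r : seq I) (F : I -> S) :
  graded_part a b (\sum_(i <- r) F i) = \sum_(i <- r) graded_part a b (F i).
Proof.
apply: (big_morph (graded_part a b) (@graded_partD a b)).
by rewrite /graded_part; case: ifP; rewrite ?raddf0.
Qed.

Lemma pihomog_mulr d e (f g : S) : g \is e.-homog ->
  pihomog mdeg d (f * g) =
  (if (e <= d)%N then pihomog mdeg (d - e) f else 0) * g.
Proof.
move=> hg; elim/mpolyind: f => [|c m f _ _ IH].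
  by rewrite mul0r !raddf0; case: ifP; rewrite mul0r.
rewrite mulrDl raddfD /= IH -scalerAl linearZ /=.
have hmg : 'X_[m] * g \is (mdeg m + e).-homog by apply: dhomogM; rewrite ?dhomogX.
case: (leqP e d) => [le_ed|lt_de].
  rewrite raddfD /= linearZ /= mulrDl -scalerAl pihomogX; congr (_ *: _ + _).
  case: eqP => [Em|nEm].
    by rewrite pihomog_dE // (_ : d = (mdeg m + e)%N) // Em subnK.
  by rewrite mul0r (pihomog_ne0 _ hmg) //; apply/eqP => E; case: nEm; rewrite -E addnK.
rewrite (pihomog_ne0 _ hmg) ?scaler0 ?mul0r ?addr0 //.
by apply/eqP => E; move: lt_de; rewrite -E ltnNge leq_addl.
Qed.

Lemma graded_part_mulr a b c (f g : S) :
  g = 0 \/ (exists2 e, (e + c)%N = b & g \is e.-homog) ->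
  graded_part a c (f * g) = graded_part a b f * g.
Proof.
case=> [->|[e Eb hg]].
  by rewrite !mulr0 /graded_part; case: ifP; rewrite ?raddf0.
rewrite /graded_part -Eb; case: (leqP c a) => [le_ca|lt_ac]; last first.
  by rewrite ifF ?mul0r //; lia.
rewrite (pihomog_mulr _ _ hg).
have -> : (e <= a - c)%N = (e + c <= a)%N by lia.
by case: ifP => // _; congr (pihomog _ _ _ * _); lia.
Qed.

Lemma graded_partP a b (f : S) :
  graded_part a b f = 0 \/ exists2 e, (e + b)%N = a & graded_part a b f \is e.-homog.
Proof.
rewrite /graded_part; case: leqP => [le_ba|_]; last by left.
by right; exists (a - b)%N; [rewrite subnK | exact: pihomogP].
Qed.

Lemma graded_part_id a b (f : S) :
  f = 0 \/ (exists2 e, (e + b)%N = a & f \is e.-homog) -> graded_part a b f = f.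
Proof.
rewrite /graded_part; case=> [->|[e <- hf]]; first by case: ifP; rewrite ?raddf0.
by rewrite leq_addl addnK pihomog_dE.
Qed.

Lemma homog_part_homog p q s t (M : 'M_(p, q)) : homog_mx s t (homog_part s t M).
Proof. by move=> i j; rewrite mxE; apply: graded_partP. Qed.

Lemma homog_part_id p q s t (M : 'M_(p, q)) : homog_mx s t M -> homog_part s t M = M.
Proof. by move=> hM; apply/matrixP => i j; rewrite mxE graded_part_id. Qed.

(** Taking the part of degree 0 commutes with the multiplication by a
    homogeneous matrix.  All lifts of graded maps below are made homogeneous
    by this identity. *)
Lemma homog_part_mulmx p q r s t u (M : 'M_(p, q)) (N : 'M_(q, r)) :
  homog_mx t u N -> homog_part s u (M *m N) = homog_part s t M *m N.
Proof.
move=> hN; apply/matrixP => i j; rewrite !mxE graded_part_sum.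
by apply: eq_bigr => l _; rewrite mxE; apply: graded_part_mulr.
Qed.

Lemma homog_mx_mul p q r s t u (M : 'M_(p, q)) (N : 'M_(q, r)) :
  homog_mx s t M -> homog_mx t u N -> homog_mx s u (M *m N).
Proof.
by move=> hM hN; rewrite -(homog_part_id hM) -(homog_part_mulmx _ _ hN); exact: homog_part_homog.
Qed.

Lemma homog_mxD p q s t (M N : 'M_(p, q)) :
  homog_mx s t M -> homog_mx s t N -> homog_mx s t (M + N).
Proof.
move=> hM hN; rewrite -(homog_part_id hM) -(homog_part_id hN) => i j.
by rewrite !mxE -graded_partD; apply: graded_partP.
Qed.

Lemma homog_mxN p q s t (M : 'M_(p, q)) : homog_mx s t M -> homog_mx s t (- M).
Proof.
move=> hM i j; rewrite mxE; case: (hM i j) => [->|[e E he]].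
  by left; rewrite oppr0.
by right; exists e => //; rewrite dhomogN.
Qed.

Lemma homog_mx0 p q s t : homog_mx s t (0 : 'M[S]_(p, q)).
Proof. by move=> i j; left; rewrite mxE. Qed.

Lemma homog_mx1 p s : homog_mx s s (1%:M : 'M[S]_p).
Proof.
move=> i j; rewrite mxE; case: eqP => [->|_]; last by left.
by right; exists 0%N => //; rewrite dhomog1.
Qed.

(** The reduction modulo the irrelevant ideal. *)
Definition const_coef : S -> k := mcoeff 0%MM.
HB.instance Definition _ := GRing.RMorphism.copy const_coef const_coef.

Local Notation "M ^0" := (map_mx const_coef M) (at level 2, format "M ^0").

Lemma const_coef_homog e (f : S) : f \is e.-homog -> (0 < e)%N -> const_coef f = 0.
Proof.
by move=> hf e0; rewrite /const_coef (dhomog_nemf_coeff hf) //= mdeg0 eq_sym -lt0n.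
Qed.

Lemma homog0_const (f : S) : f \is 0.-homog -> f = (const_coef f)%:MP.
Proof.
move=> hf; apply/mpolyP => m; rewrite mcoeffC.
case: eqP => [->|/eqP nm]; first by rewrite mulr1.
by rewrite mulr0 (dhomog_nemf_coeff hf) // mdeg_eq0.
Qed.

Lemma pihomog0_const (f : S) : pihomog mdeg 0 f = (const_coef f)%:MP.
Proof.
rewrite (homog0_const (pihomogP _ _ _)); congr _%:MP.
elim/mpolyind: f => [|c m f _ _ IH]; first by rewrite !raddf0.
rewrite !raddfD /= IH; congr (_ + _).
rewrite linearZ /= pihomogX; case: eqP => // nm.
rewrite scaler0 rmorph0 /const_coef mcoeffZ mcoeffX; case: eqP => [Em|]; last by rewrite mulr0.
by case: nm; rewrite Em /= mdeg0.
Qed.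

Lemma row'_mul q r (G : 'M[S]_(q.+1, r)) (i : 'I_q.+1) (u : 'rV[S]_q.+1) :
  u *m G = u 0 i *: row i G + col' i u *m row' i G.
Proof.
apply/rowP => j; rewrite !mxE (bigD1_ord i) //=; congr (_ + _).
by apply: eq_bigr => l _; rewrite !mxE.
Qed.

(** The relation [w] has a unit at [i], hence expresses row [i] by the
    others. *)
Lemma drop_row q r (G : 'M[S]_(q.+1, r)) (i : 'I_q.+1) (w : 'rV[S]_q.+1) c :
  c != 0 -> w 0 i = c%:MP -> w *m G = 0 ->
  forall v : 'rV_r, (exists u : 'rV_q.+1, v = u *m G) <->
    (exists u : 'rV_q, v = u *m row' i G).
Proof.
move=> c0 wi wG v; split=> [[u ->]|[u ->]]; last first.
  exists (\row_j oapp (u 0) 0 (unlift i j)); rewrite (row'_mul G i) mxE unlift_none /=.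
  rewrite scale0r add0r; congr (_ *m _); apply/rowP => j.
  by rewrite !mxE liftK.
exists (col' i (u - (u 0 i * (c^-1)%:MP) *: w)).
have : (u - (u 0 i * (c^-1)%:MP) *: w) *m G = u *m G.
  by rewrite mulmxBl -scalemxAl wG scaler0 subr0.
rewrite (row'_mul G i) !mxE wi -mulrA -mpolyCM mulVf // mulr1 subrr scale0r add0r.
by move->.
Qed.

(** Nakayama: a syzygy with a nonzero constant term has, after passing to
    its part of the right degree, a unit entry, and the corresponding
    generator is superfluous.  Induction on the number of generators. *)
Lemma minimal_generators r (t : 'I_r -> nat) q (s : 'I_q -> nat)
    (G : 'M[S]_(q, r)) : homog_mx s t G ->
  exists q' (s' : 'I_q' -> nat) (G' : 'M[S]_(q', r)),
    [/\ homog_mx s' t G',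
        forall v : 'rV_r, (exists u : 'rV_q, v = u *m G) <->
          (exists u : 'rV_q', v = u *m G')
      & forall w : 'rV_q', w *m G' = 0 -> w ^0 = 0].
Proof.
elim: q s G => [|q IH] s G hG.
  by exists 0%N, s, G; split=> // w _; rewrite [_^0]thinmx0.
have [hmin|nmin] := classic (forall w : 'rV_q.+1, w *m G = 0 -> w^0 = 0).
  by exists q.+1, s, G.
have [w nw] := not_all_ex_not _ _ nmin.
have [wG w0] := imply_to_and _ _ nw.
have [i wi0] : exists i, const_coef (w 0 i) != 0.
  apply: NNPP => nex; apply: w0; apply/rowP => i; rewrite !mxE.
  by apply/eqP; apply: contraT => wi; case: nex; exists i.
pose w' := homog_part (fun _ : 'I_1 => s i) s w.
have w'G : w' *m G = 0.
  by rewrite -(homog_part_mulmx _ _ hG) wG homog_part_id //; apply: homog_mx0.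
have w'i : w' 0 i = (const_coef (w 0 i))%:MP.
  by rewrite mxE /graded_part leqnn subnn pihomog0_const.
have hG' : homog_mx (s \o lift i) t (row' i G).
  by move=> a b; rewrite mxE; apply: hG.
have [q' [s' [G' [hG1 hG2 hG3]]]] := IH _ _ hG'.
exists q', s', G'; split=> // v; rewrite -hG2; exact: drop_row w'i w'G v.
Qed.
End GradedMatrices.

(** * Comparison of graded complexes *)

Local Notation "M ^0" := (map_mx (@const_coef _ _) M) (at level 2, format "M ^0").
Section Comparison.
Variables (k : fieldType) (n : nat).
Local Notation S := {mpoly k[n]}.

(** One half of a homotopy equivalence between the quotients of free modules
    by [Z] and [Z']: [psi] inverts [phi] on [Z] up to an endomorphism [E]
    whose image lies in [Z].  The symmetric half carries the homogeneity of
    [psi] and its compatibility with [Z']. *)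
Definition half_comparison (r r' : nat) (s : 'I_r -> nat) (s' : 'I_r' -> nat)
    (Z : 'rV[S]_r -> Prop) (Z' : 'rV[S]_r' -> Prop)
    (phi : 'M[S]_(r, r')) (psi : 'M[S]_(r', r)) (E : 'M[S]_r) : Prop :=
  [/\ homog_mx s s' phi, homog_mx s s E,
      forall v, Z v -> Z' (v *m phi),
      forall v, Z (v *m E)
    & forall v, Z v -> v = v *m phi *m psi + v *m E].

Definition generates (q r : nat) (d : 'M[S]_(q, r)) (Z : 'rV[S]_r -> Prop) :=
  forall v, Z v <-> exists w : 'rV_q, v = w *m d.

Definition syzygy (q r : nat) (d : 'M[S]_(q, r)) (v : 'rV[S]_q) := v *m d = 0.

(** Freeness of the source: a graded map into the image of [d] lifts
    through [d], and the part of degree 0 of any lift is again a lift. *)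
Lemma lift_rows p q r (t : 'I_p -> nat) (sg : 'I_q -> nat) (s : 'I_r -> nat)
    (d : 'M[S]_(q, r)) (Z : 'rV[S]_r -> Prop) (A : 'M_(p, r)) :
  homog_mx sg s d -> generates d Z -> homog_mx t s A ->
  (forall i, Z (row i A)) -> exists2 B : 'M_(p, q), homog_mx t sg B & A = B *m d.
Proof.
move=> hd gd hA ZA.
have /fin_all_exists [w wE] : forall i, exists w : 'rV_q, row i A = w *m d.
  by move=> i; apply/gd.
exists (homog_part t sg (\matrix_i w i)); first exact: homog_part_homog.
rewrite -(homog_part_mulmx _ _ hd) -[LHS](homog_part_id hA); congr homog_part.
by apply/row_matrixP => i; rewrite row_mul rowK.
Qed.

(** The next error term is the usual one for chain maps with homotopy [h].
    It lands in the syzygies because [phi *m psi + E] is the identity on the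
    rows of [d], and on syzygies the term with [d *m h] disappears. *)
Lemma half_comparison_step r r' s s' Z Z' (phi : 'M[S]_(r, r')) psi E
    q q' sg sg' (d : 'M[S]_(q, r)) (d' : 'M[S]_(q', r'))
    (phi1 : 'M_(q, q')) (psi1 : 'M_(q', q)) (h : 'M_(r, q)) :
  half_comparison s s' Z Z' phi psi E -> homog_mx sg s d -> generates d Z ->
  homog_mx sg sg' phi1 -> homog_mx sg' sg psi1 -> homog_mx s sg h ->
  d *m phi = phi1 *m d' -> d' *m psi = psi1 *m d -> E = h *m d ->
  half_comparison sg sg' (syzygy d) (syzygy d') phi1 psi1
    (1%:M - phi1 *m psi1 - d *m h).
Proof.
move=> [_ _ _ _ ZE] hd gd hphi hpsi hh dphi dpsi Eh; split=> //.
- apply: homog_mxD; last exact/homog_mxN/(homog_mx_mul hd hh).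
  by apply: homog_mxD; [apply: homog_mx1 | exact/homog_mxN/(homog_mx_mul hphi hpsi)].
- by move=> v zv; rewrite /syzygy -mulmxA -dphi mulmxA zv mul0mx.
- move=> v; rewrite /syzygy -mulmxA; suff -> : (1%:M - phi1 *m psi1 - d *m h) *m d = 0.
    by rewrite mulmx0.
  rewrite !mulmxBl mul1mx -!mulmxA -dpsi -Eh [phi1 *m _]mulmxA -dphi.
  apply/row_matrixP => i; rewrite !linearB /= row0 !row_mul -mulmxA.
  have /ZE : Z (row i d) by apply/gd; exists (delta_mx 0 i); rewrite rowE.
  move=> Ei; apply/eqP; rewrite subr_eq add0r subr_eq addrC.
  by rewrite {1}Ei mulmxA.
- move=> v zv; rewrite !mulmxBr mulmx1 !mulmxA zv mul0mx subr0.
  by rewrite addrC subrK.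
Qed.

(** Comparison theorem for resolutions, one step at a time: maps and
    homotopies are lifted simultaneously in both directions, so that no
    complex has to be given in advance beyond the current step. *)
Lemma comparison_step r r' s s' Z Z' (phi : 'M[S]_(r, r')) psi E E'
    q q' sg sg' (d : 'M[S]_(q, r)) (d' : 'M[S]_(q', r')) :
  half_comparison s s' Z Z' phi psi E -> half_comparison s' s Z' Z psi phi E' ->
  homog_mx sg s d -> generates d Z -> homog_mx sg' s' d' -> generates d' Z' ->
  exists phi1 psi1 h h',
    [/\ d *m phi = phi1 *m d', d' *m psi = psi1 *m d, E = h *m d & E' = h' *m d']
    /\ [/\ half_comparison sg sg' (syzygy d) (syzygy d') phi1 psi1
             (1%:M - phi1 *m psi1 - d *m h),
           half_comparison sg' sg (syzygy d') (syzygy d) psi1 phi1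
             (1%:M - psi1 *m phi1 - d' *m h')
         & homog_mx sg sg' phi1].
Proof.
move=> hc hc' hd gd hd' gd'.
have rowZ p0 q0 (d0 : 'M[S]_(p0, q0)) Z0 i : generates d0 Z0 -> Z0 (row i d0).
  by move=> g; apply/g; exists (delta_mx 0 i); rewrite rowE.
have [hphi hE Zphi ZE _] := hc; have [hpsi hE' Zpsi ZE' _] := hc'.
have [||phi1 hphi1 dphi] := @lift_rows _ _ _ sg _ _ _ _ (d *m phi) hd' gd'.
- exact: homog_mx_mul hd hphi.
- by move=> i; rewrite row_mul; apply: Zphi; apply: rowZ gd.
have [||psi1 hpsi1 dpsi] := @lift_rows _ _ _ sg' _ _ _ _ (d' *m psi) hd gd.
- exact: homog_mx_mul hd' hpsi.
- by move=> i; rewrite row_mul; apply: Zpsi; apply: rowZ gd'.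
have [|h hh Eh] := lift_rows hd gd hE; first by move=> i; rewrite rowE.
have [|h' hh' Eh'] := lift_rows hd' gd' hE'; first by move=> i; rewrite rowE.
exists phi1, psi1, h, h'; split=> //; split=> //.
  exact: half_comparison_step hc hd gd hphi1 hpsi1 hh dphi dpsi Eh.
exact: half_comparison_step hc' hd' gd' hpsi1 hphi1 hh' dpsi dphi Eh'.
Qed.

(** The submodule to be generated at step [i]; at step 0 it is the submodule
    [Z] being resolved. *)
Definition cycles (F : graded_free_seq k n) (Z : 'rV[S]_(frank F 0) -> Prop) i :
    'rV[S]_(frank F i) -> Prop :=
  match i with 0 => Z | i'.+1 => syzygy (fdiff F i') end.

Arguments cycles {F} Z i v.

Definition resolves (F : graded_free_seq k n) (Z : 'rV[S]_(frank F 0) -> Prop) :=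
  forall i, homog_mx (@fshift _ _ F i.+1) (@fshift _ _ F i) (fdiff F i) /\
    generates (fdiff F i) (cycles Z i).

(** The last condition says that the comparison is the identity modulo the
    irrelevant ideal once [E] is added.  If the first complex is minimal, [E]
    vanishes there and [phi] is split injective. *)
Definition mutual_comparison r r' s s' (Z : 'rV[S]_r -> Prop) (Z' : 'rV[S]_r' -> Prop) :=
  exists phi psi E E', [/\ half_comparison s s' Z Z' phi psi E,
    half_comparison s' s Z' Z psi phi E' & (phi *m psi + E)^0 = 1%:M].

Lemma const_coef_step r q q' (d : 'M[S]_(q, r)) (phi : 'M_(q, q')) (psi : 'M_(q', q))
    (h : 'M_(r, q)) :
  d^0 = 0 -> (phi *m psi + (1%:M - phi *m psi - d *m h))^0 = 1%:M.
Proof.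
move=> d0; have -> : phi *m psi + (1%:M - phi *m psi - d *m h) = 1%:M - d *m h.
  by rewrite addrA addrCA subrr addr0.
by rewrite map_mxB map_mx1 map_mxM d0 mul0mx subr0.
Qed.

Lemma mutual_comparison_cycles (F K : graded_free_seq k n) Z Z' :
  resolves Z -> resolves Z' -> (forall i, (fdiff F i)^0 = 0) ->
  mutual_comparison (@fshift _ _ F 0) (@fshift _ _ K 0) Z Z' ->
  forall i, mutual_comparison (@fshift _ _ F i) (@fshift _ _ K i) (cycles Z i) (cycles Z' i).
Proof.
move=> rF rK minF c0; elim=> [//|i [phi [psi [E [E' [hc hc' _]]]]]].
have [hd gd] := rF i; have [hd' gd'] := rK i.
have [phi1 [psi1 [h [h' [_ [c1 c1' _]]]]]] := comparison_step hc hc' hd gd hd' gd'.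
exists phi1, psi1, (1%:M - phi1 *m psi1 - fdiff F i *m h),
  (1%:M - psi1 *m phi1 - fdiff K i *m h').
by split=> //; apply: const_coef_step.
Qed.

End Comparison.
Arguments cycles {k n F} Z i v.

(** * Existence of minimal free resolutions *)

Section MinimalResolution.
Variables (k : fieldType) (n : nat).
Local Notation S := {mpoly k[n]}.

Definition row_submodule r (Z : 'rV[S]_r -> Prop) :=
  forall a v w, Z v -> Z w -> Z (a *: v + w).

Lemma submodule_mulmx p r (Z : 'rV[S]_r -> Prop) (A : 'M_(p, r)) :
  row_submodule Z -> Z 0 -> (forall i, Z (row i A)) -> forall w : 'rV_p, Z (w *m A).
Proof.
move=> subZ Z0 ZA w; rewrite mulmx_sum_row.
by elim/big_rec: _ => // i v _ Zv; apply: subZ.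
Qed.

Lemma syzygy_submodule q r (d : 'M[S]_(q, r)) : row_submodule (syzygy d).
Proof.
by move=> a v w zv zw; rewrite /syzygy mulmxDl -scalemxAl zv zw scaler0 addr0.
Qed.

Definition col_shift p q (s : 'I_p -> nat) (t : 'I_q -> nat) (i : 'I_(p + q)) :=
  match split i with inl a => s a | inr b => t b end.

Lemma homog_mx_col p q r s t u (A : 'M[S]_(p, r)) (B : 'M_(q, r)) :
  homog_mx s u A -> homog_mx t u B -> homog_mx (col_shift s t) u (col_mx A B).
Proof. by move=> hA hB i j; rewrite mxE /col_shift; case: split. Qed.

Lemma homog_mx_row p q r s t u (A : 'M[S]_(r, p)) (B : 'M_(r, q)) :
  homog_mx u s A -> homog_mx u t B -> homog_mx u (col_shift s t) (row_mx A B).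
Proof. by move=> hA hB i j; rewrite mxE /col_shift; case: split. Qed.

Variables (K : graded_free_seq k n) (ZK : 'rV[S]_(frank K 0) -> Prop).
Hypothesis resK : resolves ZK.

(** The invariant of the construction of a minimal resolution: the current
    kernel [Z] has no constant terms and is equivalent to the kernel at the
    same step of the given resolution [K]. *)
Definition stage_inv i r (s : 'I_r -> nat) (Z : 'rV[S]_r -> Prop) :=
  [/\ row_submodule Z, Z 0, forall v, Z v -> v^0 = 0
    & mutual_comparison s (@fshift _ _ K i) Z (cycles ZK i)].

Record stage i := Stage {
  st_rank : nat;
  st_shift : 'I_st_rank -> nat;
  st_ker : 'rV[S]_st_rank -> Prop;
  st_inv : stage_inv i st_shift st_ker }.

Record cover r := Cover {
  cov_rank : nat;
  cov_shift : 'I_cov_rank -> nat;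
  cov_map : 'M[S]_(cov_rank, r) }.

Definition good_cover i (X : stage i) (C : cover (st_rank X)) :=
  [/\ homog_mx (@cov_shift _ C) (@st_shift _ X) (cov_map C),
      generates (cov_map C) (@st_ker _ X)
    & stage_inv i.+1 (@cov_shift _ C) (syzygy (cov_map C))].

(** The kernel [Z] is generated by the images under [psi] of the generators
    of the kernel in [K], together with the rows of [E].  So it is finitely
    generated without an appeal to the Noetherian property, and minimal
    generators can be extracted. *)
Lemma good_cover_exists i (X : stage i) : exists C, good_cover (X := X) C.
Proof.
case: X => r s Z inv; have [subZ Z0 minZ cmp] := inv.
have [phi [psi [E [E' [hc hc' _]]]]] := cmp.
have [hphi hE Zphi ZE Zid] := hc; have [hpsi hE' Zpsi ZE' _] := hc'.
have [hd gd] := resK i.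
have hG := homog_mx_col (homog_mx_mul hd hpsi) hE.
have gG : generates (col_mx (fdiff K i *m psi) E) Z.
  move=> v; split=> [Zv|[w ->]].
    have /gd [w Ew] := Zphi v Zv.
    exists (row_mx w v); rewrite mul_row_col mulmxA -Ew; exact: Zid.
  apply: submodule_mulmx => // j; rewrite rowE; set x := delta_mx _ _.
  rewrite -[x]hsubmxK mul_row_col -[_ *m _]scale1r.
  apply: subZ; last exact: ZE.
  by rewrite mulmxA; apply: Zpsi; apply/gd; eexists.
have [q [sg [d [hd1 sp1 min1]]]] := minimal_generators hG.
have g1 : generates d Z by move=> v; rewrite gG sp1.
exists (@Cover r q sg d); split=> //; split=> /=.
- exact: syzygy_submodule.
- by rewrite /syzygy mul0mx.
- exact: min1.
have [phi1 [psi1 [h [h' [_ [c1 c1' _]]]]]] := comparison_step hc hc' hd1 g1 hd gd.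
exists phi1, psi1, (1%:M - phi1 *m psi1 - d *m h),
  (1%:M - psi1 *m phi1 - fdiff K i *m h').
split=> //; apply: const_coef_step; apply/row_matrixP => j; rewrite -map_row row0.
by apply: minZ; apply/g1; exists (delta_mx 0 j); rewrite rowE.
Qed.

Definition pick_cover i (X : stage i) : cover (st_rank X) :=
  sval (constructive_indefinite_description _ (good_cover_exists X)).

Lemma pick_coverP i (X : stage i) : good_cover (pick_cover X).
Proof. exact: (svalP (constructive_indefinite_description _ _)). Qed.

Definition next_stage i (X : stage i) : stage i.+1 :=
  Stage (let: And3 _ _ inv := pick_coverP X in inv).

(** The iteration of covers; each one depends on the previous kernel, so the
    sequence needs a choice function. *)
Fixpoint stages (X0 : stage 0) i : stage i :=
  match i with 0 => X0 | i'.+1 => next_stage (stages X0 i') end.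

Definition cover_seq (X0 : stage 0) : graded_free_seq k n :=
  @GradedFreeSeq k n (fun i => st_rank (stages X0 i))
    (fun i => @st_shift i (stages X0 i)) (fun i => cov_map (pick_cover (stages X0 i))).

Lemma cover_seq_resolves (X0 : stage 0) :
  resolves (F := cover_seq X0) (@st_ker _ X0).
Proof.
move=> i; have [hd gd _] := pick_coverP (stages X0 i).
by split=> //; case: i hd gd.
Qed.

Lemma cover_seq_minimal (X0 : stage 0) i : (fdiff (cover_seq X0) i)^0 = 0.
Proof.
have [_ gd _] := pick_coverP (stages X0 i).
have [_ _ minZ _] := st_inv (stages X0 i).
apply/row_matrixP => j; rewrite -map_row row0.
by apply: minZ; apply/gd; exists (delta_mx 0 j); rewrite rowE.
Qed.

End MinimalResolution.

Section IdealResolution.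
Variables (k : fieldType) (n : nat) (I : {mpoly k[n]} -> Prop).
Local Notation S := {mpoly k[n]}.
Hypotheses (I0 : I 0) (ID : forall a f g, I f -> I g -> I (a * f + g)).
Hypothesis I_const : forall f, I f -> const_coef f = 0.

(** The ideal as a submodule of the free module of rank [r], used for r = 1;
    the rank of the first module of a resolution is only provably 1. *)
Definition ideal_row r (v : 'rV[S]_r) := forall l, I (v 0 l).

Lemma ideal_rowE r (v : 'rV[S]_r) : r = 1%N -> forall l, ideal_row v <-> I (v 0 l).
Proof. by move=> r1; subst r => l; split=> [|h l'];
  [exact | by have -> : l' = l by rewrite [l]ord1 [l']ord1]. Qed.

Lemma minimal_resolution_resolves F : minimal_resolution I F ->
  resolves (F := F) (@ideal_row _) /\ (forall i, (fdiff F i)^0 = 0).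
Proof.
case=> [[r0 s0] gI ex hd min]; split=> [i|i]; last first.
  by apply/matrixP => j l; rewrite !mxE; apply: min.
split; first exact: hd.
case: i => [|i] v; last exact: ex.
have l0 : 'I_(frank F 0) by rewrite r0; apply: ord0.
have l0E l : l = l0 by move: l0 l; rewrite r0 => a b; rewrite [a]ord1 [b]ord1.
rewrite /= (ideal_rowE v r0 l0) gI; split=> -[w Ew]; exists w.
  by apply/rowP => l; rewrite (l0E l) (Ew l0).
by move=> l; rewrite Ew (l0E l).
Qed.

(** Minimalization: from any graded free resolution [K] whose first step is
    comparable with [I], covers by minimal generators are built step by
    step, each kernel being controlled by the comparison with [K]. *)
Lemma minimal_resolution_exists (K : graded_free_seq k n) (ZK : 'rV_(frank K 0) -> Prop) :
  resolves ZK ->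
  mutual_comparison (fun _ : 'I_1 => 0%N) (@fshift _ _ K 0) (@ideal_row 1) ZK ->
  exists F, minimal_resolution I F.
Proof.
move=> rK cmp.
have inv : stage_inv ZK 0 (fun _ : 'I_1 => 0%N) (@ideal_row 1).
  split=> //.
  - by move=> a v w Zv Zw l; rewrite !mxE; apply: ID.
  - by move=> l; rewrite mxE.
  - by move=> v Zv; apply/rowP => l; rewrite !mxE; apply: I_const.
pose X0 := Stage inv; exists (cover_seq rK X0).
have rF := cover_seq_resolves rK X0; have mF := cover_seq_minimal rK X0.
split.
- by split.
- move=> f; have [_ /(_ (\row_l f)) gF] := rF 0%N; split=> [If|[w Ew]].
    have [|w Ew] := (proj1 gF); first by move=> l; rewrite mxE.
    by exists w => l; rewrite -Ew mxE.
  have /gF /(_ ord0) : exists w, \row_l f = w *m fdiff (cover_seq rK X0) 0.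
    by exists w; apply/rowP => l; rewrite mxE Ew.
  by rewrite mxE.
- by move=> i v; have [_ /(_ v)] := rF i.+1.
- by move=> i; have [] := rF i.
- move=> i j l; have /matrixP/(_ j l) := mF i; by rewrite !mxE.
Qed.

End IdealResolution.

(** * The Koszul complex of commuting matrices *)

Lemma mx_no_row_eq (S : Type) m n (A B : 'M[S]_(m, n)) : m = 0%N -> A = B.
Proof. by move=> m0; apply/matrixP => i; exfalso; move: i; rewrite m0 => - []. Qed.

Section Koszul.
Variables (S : comNzRingType) (N : nat) (T : nat -> 'M[S]_N).

(** The Koszul complex of j + 1 matrices is the mapping cone of the last one
    acting on the Koszul complex of the first j, hence these ranks.  Positive
    homological degrees are handled apart from degree 0 so that the module
    of degree 0 is convertible to S^N for all j. *)
Fixpoint koszul_rankS (j i : nat) : nat :=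
  if j is j'.+1 then
    (koszul_rankS j' i + match i with 0 => N | i'.+1 => koszul_rankS j' i' end)%N
  else 0%N.
Definition koszul_rank (j i : nat) : nat := if i is i'.+1 then koszul_rankS j i' else N.

Fixpoint koszul_scaleS (M : 'M[S]_N) (j i : nat) : 'M[S]_(koszul_rankS j i) :=
  match j with
  | 0 => 0
  | j'.+1 => block_mx (koszul_scaleS M j' i) 0 0
      (match i return 'M_(koszul_rank j' i) with 0 => M | i'.+1 => koszul_scaleS M j' i' end)
  end.
(** The diagonal action of an endomorphism of S^N on the complex. *)
Definition koszul_scale (M : 'M[S]_N) (j i : nat) : 'M[S]_(koszul_rank j i) :=
  match i with 0 => M | i'.+1 => koszul_scaleS M j i' end.

Fixpoint koszul_diff (j : nat) : forall i, 'M[S]_(koszul_rank j i.+1, koszul_rank j i) :=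
  match j return forall i, 'M[S]_(koszul_rank j i.+1, koszul_rank j i) with
  | 0 => fun i => 0
  | j'.+1 => fun i => match i return 'M[S]_(koszul_rank j'.+1 i.+1, koszul_rank j'.+1 i) with
     | 0 => col_mx (koszul_diff j' 0) (T j')
     | i'.+1 => block_mx (koszul_diff j' i'.+1) 0 (koszul_scale (T j') j' i'.+1)
       (- koszul_diff j' i')
     end
  end.

Lemma koszul_scaleE M j i : koszul_scale M j.+1 i.+1 =
    block_mx (koszul_scale M j i.+1) 0 0 (koszul_scale M j i).
Proof. by []. Qed.

Lemma koszul_diffE0 j : koszul_diff j.+1 0 = col_mx (koszul_diff j 0) (T j).
Proof. by []. Qed.

Lemma koszul_diffES j i : koszul_diff j.+1 i.+1 =
  block_mx (koszul_diff j i.+1) 0 (koszul_scale (T j) j i.+1) (- koszul_diff j i).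
Proof. by []. Qed.

Hypothesis Tcomm : forall i j, T i *m T j = T j *m T i.

Lemma koszul_scaleM A B j i : koszul_scale A j i *m koszul_scale B j i =
    koszul_scale (A *m B) j i.
Proof.
elim: j i => [|j IH] i.
  by case: i => [//|i]; exact: mx_no_row_eq.
case: i => [//|i].
by rewrite !koszul_scaleE mulmx_block !mul0mx !mulmx0 !addr0 !add0r IH (IH i.+1).
Qed.

(** The matrices commute, so each of them acts by chain maps; this is what
    makes the mapping cone a complex. *)
Lemma koszul_diff_scale l j i :
    koszul_scale (T l) j i.+1 *m koszul_diff j i = koszul_diff j i *m koszul_scale (T l) j i.
Proof.
elim: j i => [|j IH] i; first exact: mx_no_row_eq.
case: i => [|i].
  by rewrite koszul_scaleE koszul_diffE0 mul_block_col !mul0mx addr0 add0r IH mul_col_mx /=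
    Tcomm.
rewrite !koszul_scaleE koszul_diffES !mulmx_block !mul0mx !mulmx0 !addr0 !add0r.
by rewrite mulmxN mulNmx (IH i) -(IH i.+1) (koszul_scaleM _ _ j i.+1)
  (koszul_scaleM _ _ j i.+1) Tcomm.
Qed.

Lemma koszul_diffK j i : koszul_diff j i.+1 *m koszul_diff j i = 0.
Proof.
elim: j i => [|j IH] i; first exact: mx_no_row_eq.
case: i => [|i].
  rewrite koszul_diffES koszul_diffE0 mul_block_col IH mul0mx addr0
    (koszul_diff_scale j j 0) mulNmx /= subrr.
  by rewrite col_mx0.
rewrite !koszul_diffES !mulmx_block IH !mul0mx !mulmx0 !addr0 !add0r koszul_diff_scale mulNmx
  subrr.
by rewrite mulmxN mulNmx IH oppr0 oppr0 block_mx0.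
Qed.

(** The sum of the images of T_0, ..., T_(j-1). *)
Definition koszul_image j (v : 'rV[S]_N) := exists w, v = w *m koszul_diff j 0.

Lemma koszul_imageS j v : koszul_image j.+1 v <-> exists u, koszul_image j (v - u *m T j).
Proof.
split=> [[w ->]|[u [w Ew]]].
  exists (rsubmx w), (lsubmx w).
  by rewrite -{1}[w]hsubmxK koszul_diffE0 mul_row_col addrK.
by exists (row_mx w u); rewrite koszul_diffE0 mul_row_col -Ew subrK.
Qed.

Variable c : nat.
Hypothesis Treg : forall j v, (j < c)%N -> koszul_image j (v *m T j) -> koszul_image j v.

(** The long exact sequence of the mapping cone: a cycle of the cone has a
    second component that is a boundary, by induction in positive degrees
    and by regularity of T_j in degree 0; after subtracting a boundary, the
    first component is a cycle of the smaller complex. *)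
Lemma koszul_exact j i (v : 'rV_(koszul_rank j i.+1)) : (j <= c)%N ->
  v *m koszul_diff j i = 0 -> exists w, v = w *m koszul_diff j i.+1.
Proof.
elim: j i v => [|j IH] i v lt_jc.
  by move=> _; exists 0; rewrite [v]thinmx0 mulmx0.
have {}IH i' (v' : 'rV_(koszul_rank j i'.+1)) := IH i' v' (ltnW lt_jc).
(* A pair whose second component is a boundary is itself a boundary. *)
have lift (a : 'rV_(koszul_rank j i.+1)) (b : 'rV_(koszul_rank j i))
  (w : 'rV_(koszul_rank j i.+1)) :
    a *m koszul_diff j i + b *m koszul_scale (T j) j i = 0 -> b = - w *m koszul_diff j i ->
    exists x, row_mx a b = x *m koszul_diff j.+1 i.+1.
  move=> Eab Eb; have [|w' Ew'] := IH i (a - w *m koszul_scale (T j) j i.+1).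
    by rewrite mulmxBl -mulmxA koszul_diff_scale mulmxA -[RHS]Eab Eb !mulNmx.
  exists (row_mx w' w); rewrite koszul_diffES mul_row_block mulmx0 add0r -Ew' subrK.
  by rewrite Eb mulmxN mulNmx.
rewrite -[v]hsubmxK; move: (lsubmx v) (rsubmx v) => a b {v}.
case: i a b lift => [|i] a b lift.
  rewrite koszul_diffE0 mul_row_col => Eab.
  have [|w Ew] := Treg (j := j) (v := b) lt_jc.
    by exists (- a); apply/eqP; rewrite mulNmx -addr_eq0 addrC Eab.
  by apply: (lift _ _ (- w)) => //; rewrite opprK.
rewrite koszul_diffES mul_row_block mulmx0 add0r -[0 in RHS]row_mx0 => /eq_row_mx [Eab].
rewrite mulmxN => /eqP; rewrite oppr_eq0 => /eqP /IH [w Ew].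
by apply: (lift _ _ (- w)) => //; rewrite opprK.
Qed.

Lemma koszul_rank_gt j i : (j < i)%N -> koszul_rank j i = 0%N.
Proof.
elim: j i => [|j IH] i; case: i => [//|i] // lt_ji.
by rewrite /= -/(koszul_rank j i.+1) -/(koszul_rank j i) !IH // ltnW.
Qed.

End Koszul.

(** * The last Koszul module and the grading *)

Section KoszulTop.
Variables (S : comNzRingType) (N : nat) (T : nat -> 'M[S]_N).

(** The isomorphism of S^N with the last module of the complex, whose rank is
    N only up to summands of rank 0. *)
Fixpoint koszul_top (j : nat) : 'M[S]_(N, koszul_rank N j j) :=
  match j return 'M[S]_(N, koszul_rank N j j) with
  | 0 => 1%:M
  | j'.+1 => row_mx 0 (koszul_top j')
  end.

Fixpoint koszul_top_inv (j : nat) : 'M[S]_(koszul_rank N j j, N) :=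
  match j return 'M[S]_(koszul_rank N j j, N) with
  | 0 => 1%:M
  | j'.+1 => col_mx 0 (koszul_top_inv j')
  end.

Lemma koszul_topK j : koszul_top j *m koszul_top_inv j = 1%:M.
Proof.
elim: j => [|j IH] /=; first by rewrite mulmx1.
by rewrite mul_row_col mul0mx add0r.
Qed.

Lemma koszul_top_invK j : koszul_top_inv j *m koszul_top j = 1%:M.
Proof.
elim: j => [|j IH]; first by rewrite /= mulmx1.
have r0 : koszul_rank N j j.+1 = 0%N by apply: koszul_rank_gt.
rewrite [LHS]mul_col_row !mul0mx mulmx0 IH.
by rewrite [RHS]scalar_mx_block; congr block_mx; apply: mx_no_row_eq.
Qed.

Lemma koszul_top_scale M j : koszul_top j *m koszul_scale M j j = M *m koszul_top j.
Proof.
elim: j => [|j IH]; first by rewrite /= mul1mx mulmx1.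
rewrite koszul_scaleE [LHS]mul_row_block [RHS]mul_mx_row IH.
by rewrite !mul0mx !mulmx0 !add0r.
Qed.

Lemma koszul_top_diff0 : koszul_top 1 *m koszul_diff T 1 0 = T 0%N.
Proof. by rewrite koszul_diffE0 [LHS]mul_row_col mul0mx add0r mul1mx. Qed.

Lemma koszul_top_diffS j : koszul_top j.+2 *m koszul_diff T j.+2 j.+1 =
  row_mx (T j.+1 *m koszul_top j.+1) (- (koszul_top j.+1 *m koszul_diff T j.+1 j)).
Proof.
rewrite koszul_diffES [LHS]mul_row_block !mul0mx !add0r mulmxN.
by congr (row_mx _ _); exact: (koszul_top_scale (T j.+1) j.+1).
Qed.

(** Up to sign, the last differential of the Koszul complex is the row of
    all T_l; here T_l is extracted from it. *)
Lemma koszul_top_diff_factor j l : (l <= j)%N ->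
  exists C, koszul_top j.+1 *m koszul_diff T j.+1 j *m C = T l.
Proof.
elim: j => [|j IH] le_lj.
  by exists 1%:M; rewrite koszul_top_diff0 mulmx1; case: l le_lj.
rewrite koszul_top_diffS; case: (ltngtP l j.+1) le_lj => // [lt_lj _|-> _].
  have [C EC] := IH lt_lj; exists (col_mx 0 (- C)).
  by rewrite [LHS]mul_row_col mulmx0 add0r mulNmx mulmxN opprK.
exists (col_mx (koszul_top_inv j.+1) 0).
rewrite [LHS]mul_row_col mulmx0 addr0 -mulmxA.
exact: etrans (congr1 (mulmx _) (koszul_topK j.+1)) (mulmx1 _).
Qed.

Lemma koszul_top_diff_expand j : exists D : nat -> 'M_(N, koszul_rank N j.+1 j),
  koszul_top j.+1 *m koszul_diff T j.+1 j = \sum_(l < j.+1) T l *m D l.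
Proof.
elim: j => [|j [D ED]].
  by exists (fun _ => 1%:M); rewrite koszul_top_diff0 big_ord1 mulmx1.
pose X : 'M[S]_(koszul_rank N j.+1 j, koszul_rank N j.+2 j.+1) := row_mx 0 (- 1%:M).
exists (fun l => if l == j.+1 then row_mx (koszul_top j.+1) 0 else D l *m X).
rewrite koszul_top_diffS ED; move: (koszul_top j.+1) => Y; rewrite [RHS]big_ord_recr /= eqxx.
rewrite [T j.+1 *m row_mx _ _]mul_mx_row mulmx0.
have -> : \sum_(i < j.+1) T i *m (if i == j.+1 :> nat then row_mx Y 0
    else D i *m X) = \sum_(i < j.+1) T i *m D i *m X.
  by apply: eq_bigr => l _; rewrite (ltn_eqF (ltn_ord l)) mulmxA.
rewrite -mulmx_suml [_ *m X]mul_mx_row mulmx0 mulmxN mulmx1 [RHS]add_row_mx.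
by rewrite add0r addr0.
Qed.

(** Multiplication by [s] on the cokernel of the dual of the last
    differential vanishes if and only if it does on the quotient of S^N by
    the images of the transposes of the T_l. *)
Lemma scalar_factor_top j (s : S) :
  (exists W, koszul_diff T j.+1 j *m W = s%:M :> 'M_(koszul_rank N j.+1 j.+1)) <->
  (exists W : nat -> 'M_N, s%:M = \sum_(l < j.+1) T l *m W l).
Proof.
split=> [[W EW]|[W EW]].
  have [D ED] := koszul_top_diff_expand j.
  exists (fun l => D l *m W *m koszul_top_inv j.+1).
  under eq_bigr => l _ do rewrite !mulmxA.
  rewrite -!mulmx_suml -ED -(mulmxA (koszul_top j.+1)) EW mul_mx_scalar -scalemxAl.
  by rewrite (koszul_topK j.+1) scalemx1.
have /fin_all_exists [C EC] : forall l : 'I_j.+1, exists C,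
  koszul_top j.+1 *m koszul_diff T j.+1 j *m C = T l by move=> l;
    apply: koszul_top_diff_factor; case: l.
exists (\sum_(l < j.+1) C l *m W l *m koszul_top j.+1).
have E : koszul_top j.+1 *m koszul_diff T j.+1 j *m
  (\sum_(l < j.+1) C l *m W l *m koszul_top j.+1) =
    s *: koszul_top j.+1.
  rewrite mulmx_sumr; under eq_bigr => l _ do rewrite !mulmxA EC.
  by rewrite -mulmx_suml -EW mul_scalar_mx.
rewrite -[LHS]mul1mx -(koszul_top_invK j.+1) -mulmxA (mulmxA (koszul_top _)) E -scalemxAr.
by rewrite (koszul_top_invK j.+1) scalemx1.
Qed.

End KoszulTop.

Section KoszulGraded.
Variables (k : fieldType) (n N : nat).
Local Notation S := {mpoly k[n]}.
Variables (T : nat -> 'M[S]_N) (deg : 'I_N -> nat).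
Hypothesis hT : forall l, homog_mx (fun i => (deg i).+1) deg (T l).

Fixpoint koszul_shiftS (j i : nat) : 'I_(koszul_rankS N j i) -> nat :=
  match j return 'I_(koszul_rankS N j i) -> nat with
  | 0 => fun _ => 0%N
  | j'.+1 => col_shift (@koszul_shiftS j' i)
      (match i return 'I_(koszul_rank N j' i) -> nat with
       | 0 => fun x => (deg x).+1
       | i'.+1 => fun x => (@koszul_shiftS j' i' x).+1 end)
  end.
Definition koszul_shift (j i : nat) : 'I_(koszul_rank N j i) -> nat :=
  match i return 'I_(koszul_rank N j i) -> nat with 0 => deg | i'.+1 => @koszul_shiftS j i' end.
Arguments koszul_shift : clear implicits.

Lemma koszul_shiftE j i : koszul_shift j.+1 i.+1 =1 col_shift (koszul_shift j i.+1)
    (fun x => (koszul_shift j i x).+1).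
Proof. by case: i => [|i] x. Qed.

Lemma homog_mx_eq p q (s s' : 'I_p -> nat) (t t' : 'I_q -> nat) (M : 'M[S]_(p, q)) :
  s =1 s' -> t =1 t' -> homog_mx s t M -> homog_mx s' t' M.
Proof. by move=> es et h i j; rewrite -es -et; exact: h. Qed.

Lemma homog_mx_succ p q (s : 'I_p -> nat) (t : 'I_q -> nat) (M : 'M[S]_(p, q)) :
  homog_mx s t M -> homog_mx (fun x => (s x).+1) (fun x => (t x).+1) M.
Proof.
move=> h i j; case: (h i j) => [->|[e E he]]; [by left|right].
by exists e; rewrite // addnS E.
Qed.

Lemma homog_mx_block p q r u s1 s2 t1 t2 (A : 'M[S]_(p, q)) (B : 'M_(p, r)) (C : 'M_(u, q))
    (D : 'M_(u, r)) :
  homog_mx s1 t1 A -> homog_mx s1 t2 B -> homog_mx s2 t1 C -> homog_mx s2 t2 D ->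
  homog_mx (col_shift s1 s2) (col_shift t1 t2) (block_mx A B C D).
Proof. by move=> *; apply: homog_mx_col; apply: homog_mx_row. Qed.

(** Each T_l has degree 1, which accounts for the shift by 1 in the cone. *)
Lemma homog_mx_koszul_scale l j i :
    homog_mx (fun x => (koszul_shift j i x).+1) (koszul_shift j i) (koszul_scale (T l) j i).
Proof.
elim: j i => [|j IH] i; case: i => [|i]; try exact: hT; first by case.
rewrite koszul_scaleE; apply: (homog_mx_eq (s := col_shift (fun x => (koszul_shift j i.+1 x).+1)
  (fun x => (koszul_shift j i x).+2)) _ (fun x => esym (koszul_shiftE x))).
  by move=> x; rewrite koszul_shiftE /col_shift; case: split.
apply: homog_mx_block; [exact: IH | exact: homog_mx0 | exact: homog_mx0 |
  exact/homog_mx_succ/IH].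
Qed.

Lemma homog_mx_koszul_diff j i :
    homog_mx (koszul_shift j i.+1) (koszul_shift j i) (koszul_diff T j i).
Proof.
elim: j i => [|j IH] i; first by case: i => [|i] [].
case: i => [|i].
  apply: (homog_mx_eq (fun x => esym (koszul_shiftE x)) (fun=> erefl)).
  by rewrite koszul_diffE0; apply: homog_mx_col; [exact: IH | exact: hT].
apply: (homog_mx_eq (fun x => esym (koszul_shiftE x)) (fun x => esym (koszul_shiftE x))).
rewrite koszul_diffES; apply: homog_mx_block;
  [exact: IH | exact: homog_mx0 | exact: (@homog_mx_koszul_scale j j i.+1) |].
exact/homog_mx_succ/homog_mxN/IH.
Qed.

Lemma koszul_shift_le m j i : (forall b, deg b <= m)%N ->
    forall x, (koszul_shift j i x <= m + i)%N.
Proof.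
move=> hm; elim: j i => [|j IH] i; case: i => [|i] x; try by rewrite addn0; exact: hm.
  by case: x.
rewrite koszul_shiftE /col_shift; case: split => y; first exact: IH.
by rewrite addnS ltnS; exact: IH.
Qed.

Lemma homog_mx_koszul_top_inv j :
    homog_mx (koszul_shift j j) (fun b => (deg b + j)%N) (koszul_top_inv S N j).
Proof.
elim: j => [|j IH]; first by apply: (homog_mx_eq (s := deg) (t := deg)) => [x|x|];
    rewrite ?addn0 //; exact: homog_mx1.
apply: (homog_mx_eq (fun x => esym (koszul_shiftE x)) (fun=> erefl)).
apply: homog_mx_col; first exact: homog_mx0.
by apply: (homog_mx_eq _ _ (homog_mx_succ IH)) => x; rewrite ?addnS.
Qed.

End KoszulGraded.

(** * The last module of the minimal resolution *)

Section Transfer.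
Variables (k : fieldType) (n : nat).
Local Notation S := {mpoly k[n]}.

(** The rank and the shifts of the first module of a resolution of S/I are
    known only propositionally; this transports a comparison along them. *)
Lemma mutual_comparison_rank1 r (s : 'I_r -> nat) (I : S -> Prop) r' s'
    (Z' : 'rV[S]_r' -> Prop) : r = 1%N -> (forall l, s l = 0%N) ->
  mutual_comparison (fun _ : 'I_1 => 0%N) s' (@ideal_row _ _ I 1) Z' ->
  mutual_comparison s s' (@ideal_row _ _ I r) Z'.
Proof.
move=> r1; subst r => s0 [phi [psi [E [E' [[h1 h2 h3 h4 h5] [g1 g2 g3 g4 g5] c]]]]].
have es : (fun _ => 0%N) =1 s by move=> l; rewrite s0.
exists phi, psi, E, E'; split=> //; split=> //.
- exact: (homog_mx_eq es (fun=> erefl) h1).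
- exact: (homog_mx_eq es es h2).
- exact: (homog_mx_eq (fun=> erefl) es g1).
Qed.

(** A graded map has nonzero constant entries only between equal shifts. *)
Lemma const_coef_shift r r' (s : 'I_r -> nat) (s' : 'I_r' -> nat)
    (phi : 'M[S]_(r, r')) j l :
  homog_mx s s' phi -> const_coef (phi j l) != 0 -> s j = s' l.
Proof.
move=> h; case: (h j l) => [->|[e <- he]]; first by rewrite raddf0 eqxx.
by case: e he => [//|e] he; rewrite (const_coef_homog he) ?eqxx.
Qed.

Lemma row_nonzero r r' (A : 'M[k]_(r, r')) (B : 'M_(r', r)) j :
  A *m B = 1%:M -> exists l, A j l != 0.
Proof.
move=> AB; apply/existsP; rewrite -negb_forall; apply/negP => /forallP A0.
have /eqP := congr1 (fun M : 'M_r => M j j) AB; rewrite !mxE eqxx big1 => [|l _].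
  by rewrite eq_sym oner_eq0.
by rewrite (eqP (A0 l)) mul0r.
Qed.

(** The vanishing of multiplication by [s] on the top dual cohomology
    transfers along a homotopy equivalence which is exact at the top. *)
Lemma scalar_transfer r r' q q' (d : 'M[S]_(r, q)) (d' : 'M[S]_(r', q'))
    (phi : 'M_(r, r')) (psi : 'M_(r', r)) (psi0 : 'M_(q', q)) (h' : 'M_(q', r')) s :
  d' *m psi0 = psi *m d -> 1%:M - psi *m phi - d' *m h' = 0 ->
  (exists U, d *m U = s%:M) -> exists U, d' *m U = s%:M.
Proof.
move=> dpsi /eqP; rewrite subr_eq0 => /eqP E [U EU].
exists (psi0 *m U *m phi + s *: h').
rewrite mulmxDr -scalemxAr -E !mulmxA dpsi -(mulmxA psi) EU.
by rewrite mul_mx_scalar -scalemxAl -scalerDr addrC subrK scalemx1.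
Qed.

End Transfer.

Section TopBetti.
Variables (k : fieldType) (n : nat).
Local Notation S := {mpoly k[n]}.
Variables (I : S -> Prop) (N c : nat) (T : nat -> 'M[S]_N) (deg : 'I_N -> nat).
Hypotheses (Tcomm : forall i j, T i *m T j = T j *m T i)
  (Treg : forall j v, (j < c.+1)%N -> koszul_image T j (v *m T j) -> koszul_image T j v)
  (hT : forall l, homog_mx (fun i => (deg i).+1) deg (T l))
  (deg2 : forall b, (deg b <= 2)%N)
  (socle : forall v : 'rV[k]_N, (forall l, (l < c.+1)%N -> v *m (T l)^0 = 0) <->
     (forall b, (deg b < 2)%N -> v 0 b = 0))
  (annihilator : forall s, I s <->
     exists W : nat -> 'M_N, s%:M = \sum_(l < c.+1) T l *m W l).

Definition koszul : graded_free_seq k n :=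
  @GradedFreeSeq k n (koszul_rank N c.+1) (@koszul_shift N deg c.+1) (koszul_diff T c.+1).

Lemma koszul_resolves : resolves (F := koszul) (koszul_image T c.+1).
Proof.
move=> i; split; first exact: homog_mx_koszul_diff.
case: i => [|i] v; first by [].
split=> [|[w ->]]; first exact: (koszul_exact Tcomm Treg).
by rewrite /cycles /syzygy -mulmxA koszul_diffK // mulmx0.
Qed.

Hypothesis level0 :
  mutual_comparison (fun _ : 'I_1 => 0%N) deg (@ideal_row _ _ I 1) (koszul_image T c.+1).

Variable F : graded_free_seq k n.
Hypothesis minF : minimal_resolution I F.

Let resF : resolves (F := F) (@ideal_row _ _ I _).
Proof. by have [] := minimal_resolution_resolves minF. Qed.

Let const_coef_diff i : (fdiff F i)^0 = 0.
Proof. by have [] := minimal_resolution_resolves minF. Qed.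

Let cmpF i : mutual_comparison (@fshift _ _ F i) (@fshift _ _ koszul i)
  (cycles (F := F) (@ideal_row _ _ I _) i) (cycles (F := koszul) (koszul_image T c.+1) i).
Proof.
apply: mutual_comparison_cycles => //; first exact: koszul_resolves.
by have [[r0 s0] _ _ _ _] := minF; apply: mutual_comparison_rank1.
Qed.

Lemma cycles_const_coef i v : cycles (F := F) (@ideal_row _ _ I _) i v -> v^0 = 0.
Proof. by move/(proj2 (resF i)) => [w ->]; rewrite map_mxM const_coef_diff mulmx0. Qed.

(** Minimality makes all cycles vanish modulo the irrelevant ideal, so the
    minimal resolution becomes a direct summand of [koszul] there. *)
Lemma comparison_const_coef i r (phi : 'M[S]_(frank F i, r)) psi E :
    (forall v, cycles (F := F) (@ideal_row _ _ I _) i (v *m E)) ->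
  (phi *m psi + E)^0 = 1%:M -> phi^0 *m psi^0 = 1%:M.
Proof.
move=> ZE <-; rewrite map_mxD map_mxM; have -> : E^0 = 0; last by rewrite addr0.
by apply/row_matrixP => j; rewrite -map_row row0 rowE; apply: cycles_const_coef.
Qed.

(** A summand of the Koszul module of step [i] has its shifts among those of
    that module. *)
Lemma resolution_shift_le i (j : 'I_(frank F i)) : (fshift j <= 2 + i)%N.
Proof.
have [phi [psi [E [E' [[hphi _ _ ZE _] _ cE]]]]] := cmpF i.
have [l] := row_nonzero j (comparison_const_coef ZE cE); rewrite mxE =>
  /(const_coef_shift hphi) ->.
exact: koszul_shift_le.
Qed.

Lemma resolution_rank_gt i : (c.+1 < i)%N -> frank F i = 0%N.
Proof.
move=> lt_ci; have [phi [psi [E [E' [[hphi _ _ ZE _] _ cE]]]]] := cmpF i.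
have := mulmx1_min (comparison_const_coef ZE cE);
  rewrite [X in (_ <= X)%N -> _](koszul_rank_gt _ lt_ci).
by rewrite leqn0 => /eqP.
Qed.

(** Both complexes stop at step c + 1, so there are no syzygies left to
    absorb the errors and the homotopies become exact identities. *)
Lemma top_comparison : exists (phi : 'M_(frank F c.+1, koszul_rank N c.+1 c.+1)) psi phi0 psi0
    h h',
  [/\ homog_mx (@fshift _ _ F c.+1) (@koszul_shift N deg c.+1 c.+1) phi,
      fdiff F c *m phi0 = phi *m koszul_diff T c.+1 c,
      koszul_diff T c.+1 c *m psi0 = psi *m fdiff F c,
      1%:M - phi *m psi - fdiff F c *m h = 0
    & 1%:M - psi *m phi - koszul_diff T c.+1 c *m h' = 0].
Proof.
have [phi0 [psi0 [E [E' [hc hc' _]]]]] := cmpF c.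
have [hd gd] := resF c; have [hd' gd'] := koszul_resolves c.
have [phi [psi [h [h' [[e1 e2 _ _] [c1 c1' hphi]]]]]] :=
  comparison_step hc hc' hd gd hd' gd'.
exists phi, psi, phi0, psi0, h, h'; split=> //.
  have [_ _ _ ZE _] := c1; apply/row_matrixP => j; rewrite row0 rowE.
  have /(proj2 (resF c.+1)) [w ->] := ZE (delta_mx 0 j).
  have r0 := resolution_rank_gt (ltnSn c.+1).
  by rewrite (mx_no_row_eq (fdiff F c.+1) 0 r0) mulmx0.
have [_ _ _ ZE _] := c1'; apply/row_matrixP => j; rewrite row0 rowE.
have /(proj2 (koszul_resolves c.+1)) [w ->] := ZE (delta_mx 0 j).
by rewrite (mx_no_row_eq (fdiff koszul c.+1) 0 (koszul_rank_gt _ (ltnSn c.+1))) mulmx0.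
Qed.

Lemma top_scalar s :
  (exists U, fdiff F c *m U = s%:M :> 'M_(frank F c.+1)) <-> I s.
Proof.
have [phi [psi [phi0 [psi0 [h [h' [_ e1 e2 e3 e4]]]]]]] := top_comparison.
rewrite annihilator -scalar_factor_top; split.
  exact: (scalar_transfer (d := fdiff F c) (d' := koszul_diff T c.+1 c) e2 e4).
exact: (scalar_transfer (d' := fdiff F c) (d := koszul_diff T c.+1 c) e1 e3).
Qed.

(** Modulo the irrelevant ideal, [Phi] and [Psi] compare the last module with
    k^N.  Minimality forces [Phi] into the common kernel of the T_l, the
    socle, where the composite the other way is the identity.  So the last
    module has the dimension of the socle, which is spanned by the basis
    vectors of degree 2; their degree gives the shift. *)
Lemma top_rank_shift : frank F c.+1 = #|[set b | deg b == 2%N]| /\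
  forall j : 'I_(frank F c.+1), fshift j = (2 + c.+1)%N.
Proof.
have [phi [psi [phi0 [psi0 [h [h' [hphi e1 e2 e3 e4]]]]]]] := top_comparison.
pose Phi := (phi *m koszul_top_inv S N c.+1)^0; pose Psi := (koszul_top S N c.+1 *m psi)^0.
have PhiPsi : Phi *m Psi = 1%:M.
  rewrite -map_mxM mulmxA -(mulmxA phi) (koszul_top_invK S N c.+1) mulmx1.
  have -> : phi *m psi = 1%:M - fdiff F c *m h.
    by move/eqP: e3; rewrite subr_eq0 => /eqP <-; rewrite opprB addrC subrK.
  by rewrite map_mxB map_mx1 map_mxM const_coef_diff mul0mx subr0.
have phi_kd : (phi *m koszul_diff T c.+1 c)^0 = 0 by rewrite -e1 map_mxM const_coef_diff mul0mx.
have PhiS b j : (deg b < 2)%N -> Phi j b = 0.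
  have -> : Phi j b = row j Phi 0 b by rewrite [RHS]mxE.
  apply: (proj1 (socle (row j Phi))) => l lt_lc.
  have [C <-] := koszul_top_diff_factor T (lt_lc : (l <= c)%N).
  rewrite -row_mul -map_mxM !mulmxA -(mulmxA phi) (koszul_top_invK S N c.+1) mulmx1.
  by rewrite map_mxM phi_kd mul0mx row0.
have PsiPhi (v : 'rV[k]_N) : (forall b, (deg b < 2)%N -> v 0 b = 0) ->
    v *m Psi *m Phi = v.
  move/(proj2 (socle v)) => vT; have [D ED] := koszul_top_diff_expand T c.
  rewrite -mulmxA -map_mxM.
  have -> : koszul_top S N c.+1 *m psi *m (phi *m koszul_top_inv S N c.+1) =
     1%:M - \sum_(l < c.+1) T l *m (D l *m h' *m koszul_top_inv S N c.+1).
    have -> : koszul_top S N c.+1 *m psi *m (phi *m koszul_top_inv S N c.+1) =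
      koszul_top S N c.+1 *m (psi *m phi) *m koszul_top_inv S N c.+1 by rewrite !mulmxA.
    have -> : psi *m phi = 1%:M - koszul_diff T c.+1 c *m h'.
      by move/eqP: e4; rewrite subr_eq0 => /eqP <-; rewrite opprB addrC subrK.
    rewrite mulmxBr mulmxBl mulmx1 (koszul_topK S N c.+1) mulmxA ED.
    by rewrite !mulmx_suml; congr (_ - _); apply: eq_bigr => l _; rewrite !mulmxA.
  rewrite map_mxB map_mx1 mulmxBr mulmx1 map_mx_sum mulmx_sumr big1 ?subr0 // => l _.
  by rewrite map_mxM mulmxA vT ?mul0mx.
split; last first.
  move=> j; have [b nz] := row_nonzero j PhiPsi.
  have db : deg b = 2%N.
    apply/eqP; rewrite eqn_leq deg2 leqNgt; apply: contra nz => lt2.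
    by rewrite PhiS.
    rewrite mxE in nz; rewrite -db.
  exact: (const_coef_shift (homog_mx_mul hphi (@homog_mx_koszul_top_inv k n N deg c.+1)) nz).
(* E is the inclusion of the span of the basis vectors of degree 2. *)
clearbody Phi Psi; set A := [set b | _].
pose E : 'M[k]_(#|A|, N) := \matrix_(a, b) (b == enum_val a)%:R.
have EEt : E *m E^T = 1%:M.
  apply/matrixP => a a'; rewrite !mxE (bigD1 (enum_val a)) //= !mxE eqxx mul1r.
  rewrite big1 ?addr0 => [|b /negPf nb]; last by rewrite !mxE nb mul0r.
  by rewrite (inj_eq enum_val_inj).
have PhiE : Phi *m E^T *m E = Phi.
  apply/matrixP => j b; rewrite !mxE.
  have [bA|bA] := boolP (b \in A).
    rewrite (bigD1 (enum_rank_in bA b)) //= big1 ?addr0.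
      rewrite !mxE enum_rankK_in // eqxx mulr1 (bigD1 b) //= !mxE enum_rankK_in // eqxx mulr1.
      by rewrite big1 ?addr0 // => b' /negPf nb; rewrite !mxE enum_rankK_in // nb mulr0.
    move=> a na; rewrite [E a b]mxE; case: eqP => [Eb|_]; last by rewrite mulr0.
    by case/eqP: na; rewrite -[LHS](enum_valK_in bA) -Eb.
  rewrite [RHS]PhiS; last first.
    by move: bA; rewrite inE; have := deg2 b; case: (deg b) => [|[|[]]].
  rewrite big1 // => a _; rewrite [E a b]mxE; case: eqP => [Eb|_]; last by rewrite mulr0.
  by rewrite Eb enum_valP in bA.
have EPhi : E *m Psi *m Phi = E.
  apply/row_matrixP => a; rewrite !row_mul; apply: PsiPhi => b lt2.
  rewrite !mxE; case: eqP => // Eb; have := enum_valP a.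
  by rewrite -Eb inE => /eqP db; rewrite db in lt2.
apply/eqP; rewrite eqn_leq; apply/andP; split.
  apply: (@mulmx1_min k _ _ (Phi *m E^T) (E *m Psi)).
  by rewrite !mulmxA PhiE.
apply: (@mulmx1_min k _ _ (E *m Psi) (Phi *m E^T)).
by rewrite !mulmxA EPhi.
Qed.

Lemma top_cocycle (v : 'cV_(frank F c.+1)) : dual_cocycle v.
Proof. by apply: mx_no_row_eq; apply: resolution_rank_gt. Qed.

(** Each basis vector of the dual of the last module is, modulo the
    irrelevant ideal, a multiple of the single generator [z], since
    coboundaries vanish there. *)
Lemma gorenstein_rank_le1 (z : 'cV_(frank F c.+1)) :
  (forall v : 'cV_(frank F c.+1), dual_cocycle v ->
     exists s : S, dual_coboundary (v - s *: z)) -> (frank F c.+1 <= 1)%N.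
Proof.
move=> gen; have /fin_all_exists [s sP] : forall j, exists s : S,
    dual_coboundary (delta_mx j 0 - s *: z) by move=> j; apply/gen/top_cocycle.
apply: (@mulmx1_min k _ _ z^0 (\row_j const_coef (s j))).
apply/matrixP => i j; have [u Eu] := sP j.
have : const_coef ((delta_mx j 0 - s j *: z) i 0) = (fdiff F c *m u)^0 i 0.
  by rewrite Eu [RHS]mxE.
rewrite map_mxM const_coef_diff mul0mx [RHS]mxE !mxE big_ord1 !mxE rmorphB rmorphM /= rmorph_nat.
by move/eqP; rewrite subr_eq0 andbT => /eqP; rewrite mulrC [const_coef _ * _]mulrC.
Qed.

(** The unit vector generates, and its annihilator consists of the scalars
    factoring through the last differential. *)
Lemma gorenstein_class : frank F c.+1 = 1%N ->
  exists (z : 'cV_(frank F c.+1)) (m : int),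
      [/\ dual_cocycle z,
          forall j, z j 0 = 0 \/
            exists2 t : nat, t%:Z = m + (fshift j)%:Z & z j 0 \is t.-homog,
          forall v : 'cV_(frank F c.+1), dual_cocycle v ->
            exists s : S, dual_coboundary (v - s *: z)
        & forall s : S, dual_coboundary (s *: z) <-> I s].
Proof.
move=> r1; have [_ shF] := top_rank_shift.
have j0 : 'I_(frank F c.+1) by rewrite r1; apply: ord0.
have jE j : j = j0 by move: j j0; rewrite r1 => a b; rewrite [a]ord1 [b]ord1.
(* The twist makes the generator, in degree c + 3, of degree 0. *)
exists (const_mx 1), (- (2 + c.+1)%N%:Z); split.
- exact: top_cocycle.
- by move=> j; right; exists 0%N; rewrite ?shF ?addNr // mxE dhomog1.
- move=> v _; exists (v j0 0); exists 0; rewrite mulmx0; apply/colP => j.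
  by rewrite !mxE mulr1 (jE j) subrr.
move=> s; rewrite -top_scalar; split=> [[u Eu]|[U EU]].
  exists (u *m const_mx 1); rewrite mulmxA -Eu; apply/matrixP => i j.
  by rewrite !mxE big_ord1 !mxE !mulr1 (jE i) (jE j) eqxx.
by exists (U *m const_mx 1); rewrite mulmxA EU mul_scalar_mx.
Qed.

End TopBetti.

(** * Bounds on dimension and depth *)

Section Dependence.
Variables (k : fieldType) (n : nat).
Local Notation S := {mpoly k[n]}.

(** The common argument for chains of primes and regular sequences.  [P t]
    stands for the t-th ideal, in which f_t is a nonzerodivisor and which
    is enlarged to contain f_t.  In a polynomial relation among the f_i, the
    terms with the least power of f_0 survive modulo the next ideal, after
    that power has been cancelled; repeating this with f_1, f_2, ... leaves
    a single nonzero constant in the last ideal. *)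
Lemma no_relation s N (P : nat -> S -> Prop) (f : 'I_s -> S)
    (c : {ffun 'I_s -> 'I_N} -> k) :
  (forall t a g h, P t g -> P t h -> P t (a * g + h)) ->
  (forall t, P t 0) ->
  (forall (i : 'I_s) h, P i (f i * h) -> P i h) ->
  (forall (i : 'I_s) h, P i h -> P i.+1 h) ->
  (forall i : 'I_s, P i.+1 (f i)) ->
  ~ P s 1 ->
  P 0%N (\sum_al c al *: \prod_i f i ^+ al i) -> forall al, c al = 0.
Proof.
move=> PD P0 Preg Pmono Pf Ps1 Pc al0; apply/eqP; apply: contraT => cal0.
have PZ t x g : P t g -> P t (x *: g).
  by move=> Pg; rewrite -mul_mpolyC -[_ * _]addr0; apply: PD.
have Psum t (J : finType) (Q : pred J) (F : J -> S) :
    (forall j, Q j -> P t (F j)) -> P t (\sum_(j | Q j) F j).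
  move=> PF; elim/big_rec: _ => // j x Qj Px.
  by rewrite -[F j]mul1r; apply: PD => //; apply: PF.
suff main t : (t <= s)%N -> exists A : {set {ffun 'I_s -> 'I_N}},
    [/\ exists al, al \in A, forall al, al \in A -> c al != 0,
        forall al be (i : 'I_s), al \in A -> be \in A -> (i < t)%N -> al i = be i
      & P t (\sum_(al in A) c al *: \prod_(i < s | (t <= i)%N) f i ^+ al i)].
  have [A [[al alA] cA eqA PA]] := main s (leqnn s).
  exfalso; apply: Ps1; move: PA; rewrite (bigD1 al) //= [X in _ + X]big1 => [|be].
    rewrite addr0 big_pred0 => [|i]; last by rewrite leqNgt ltn_ord.
    by move=> /(PZ _ (c al)^-1); rewrite scalerA mulVf ?scale1r ?cA.
  case/andP=> beA /eqP[]; apply/ffunP => i; exact: eqA.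
elim: t => [|t IH] lt_ts.
  exists [set al | c al != 0]; split=> //.
  - by exists al0; rewrite inE.
  - by move=> al; rewrite inE.
  move: Pc; rewrite (bigID (fun al => c al != 0)) /= addrC big1 ?add0r => [|al].
    by congr (P _ _); apply: eq_bigl => al; rewrite inE.
  by rewrite negbK => /eqP ->; rewrite scale0r.
have [A [[al alA] cA eqA PA]] := IH (ltnW lt_ts).
pose i0 := Ordinal lt_ts.
(* [am] has the least exponent at i0; that power of f i0 is cancelled. *)
case: (arg_minnP (fun al : {ffun 'I_s -> 'I_N} => al i0 : nat) alA) => am amA minA.
pose m (al : {ffun 'I_s -> 'I_N}) := \prod_(i < s | (t < i)%N) f i ^+ al i.
pose br := \sum_(al in A) c al *: (f i0 ^+ (al i0 - am i0) * m al).
have Pbr : P t br.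
  have : P t (f i0 ^+ am i0 * br).
    move: PA; congr (P _ _); rewrite mulr_sumr; apply: eq_bigr => be beA.
    rewrite (bigD1 i0) //= -scalerAr mulrA -exprD subnKC ?minA //.
    congr (_ *: (_ * _)); apply: eq_bigl => i.
    by rewrite ltn_neqAle andbC eq_sym.
  elim: (am i0 : nat) => [|e IHe]; first by rewrite expr0 mul1r.
  by rewrite exprS -mulrA => /(Preg i0).
have {}Pbr := Pmono i0 _ Pbr.
exists [set al in A | al i0 == am i0]; split.
- by exists am; rewrite !inE eqxx andbT.
- by move=> be; rewrite inE => /andP[/cA].
- move=> be ga i; rewrite !inE => /andP[beA /eqP be0] /andP[gaA /eqP ga0].
  rewrite ltnS leq_eqVlt => /predU1P[Ei|]; last exact: eqA.
  by have -> : i = i0 by [apply: val_inj]; rewrite be0 ga0.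
have -> : \sum_(be in [set al in A | al i0 == am i0])
     c be *: \prod_(i < s | (t < i)%N) f i ^+ be i =
  -1 * (\sum_(be in A | be i0 != am i0) c be *: (f i0 ^+ (be i0 - am i0) * m be)) + br.
  rewrite /br [X in _ = _ + X](bigID (fun be : {ffun 'I_s -> 'I_N} => be i0 == am i0)) /=.
  rewrite mulN1r [RHS]addrC addrK; apply: eq_big => [be|be]; first by rewrite inE.
  by rewrite inE => /andP[_ /eqP ->]; rewrite subnn expr0 mul1r.
apply: (PD t.+1) => //; apply: Psum => be /andP[beA ne]; apply: PZ.
have lt0 : (0 < be i0 - am i0)%N.
  by rewrite subn_gt0 ltn_neqAle minA // andbT eq_sym; apply: contra ne => /eqP ?;
    apply/eqP/val_inj.
have -> : f i0 ^+ (be i0 - am i0) * m be = f i0 ^+ (be i0 - am i0).-1 * m be * f i0 + 0.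
  by rewrite addr0 -{1}(prednK lt0) exprSr mulrAC.
by apply: PD => //; apply: (Pf i0).
Qed.

Lemma msize_mul_le e1 e2 (p q : S) :
  (msize p <= e1.+1)%N -> (msize q <= e2.+1)%N -> (msize (p * q) <= (e1 + e2).+1)%N.
Proof.
have [->|p0] := eqVneq p 0; first by rewrite mul0r msize0.
have [->|q0] := eqVneq q 0; first by rewrite mulr0 msize0.
by rewrite msizeM //; move: (msize p) (msize q) => x y; lia.
Qed.

Lemma msize_monomial_le s N D (f : 'I_s -> S) (al : {ffun 'I_s -> 'I_N}) :
  (forall i, msize (f i) <= D.+1)%N -> (msize (\prod_i f i ^+ al i) <= (s * (D * N)).+1)%N.
Proof.
move=> fD; have fX i e : (msize (f i ^+ e) <= (D * e).+1)%N.
  elim: e => [|e IH]; first by rewrite expr0 msize1.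
  by rewrite exprS mulnS; apply: msize_mul_le.
have main (r : seq 'I_s) : (msize (\prod_(i <- r) f i ^+ al i) <= (size r * (D * N)).+1)%N.
  elim: r => [|i r IH]; first by rewrite big_nil msize1.
  rewrite big_cons /= mulSn; apply: msize_mul_le => //.
  by apply: leq_trans (fX i (al i)) _; rewrite ltnS leq_mul2l ltnW ?orbT.
by have := main (index_enum 'I_s); rewrite /index_enum -enumT size_enum_ord.
Qed.

(** There are N^s monomials in the f_i with exponents less than N, while the
    polynomials they can reach lie in a space whose dimension grows like N^n;
    for s > n and N large the monomials are linearly dependent. *)
Lemma dependence s (f : 'I_s -> S) : (n < s)%N ->
  exists N (c : {ffun 'I_s -> 'I_N} -> k), (exists al, c al != 0) /\
    \sum_al c al *: \prod_i f i ^+ al i = 0.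
Proof.
move=> lt_ns; pose D := (\max_i msize (f i))%N.
have fD i : (msize (f i) <= D.+1)%N by apply: leqW; exact: leq_bigmax.
(* With this N the (D' N)^n monomials that can occur are fewer than N^(n+1). *)
pose D' := (s * D).+1; pose N := (D' ^ n).+1; pose M := (s * (D * N)).+1.
pose U : finType := {ffun 'I_s -> 'I_N}; pose V : finType := {ffun 'I_n -> 'I_M}.
have lt_VU : (#|V| < #|U|)%N.
  rewrite !card_ffun !card_ord.
  apply: leq_ltn_trans (_ : (D' * N) ^ n < _)%N.
    have le_MN : (M <= D' * N)%N by rewrite /M /D' mulSn mulnA -add1n leq_add2r.
    by case: (posnP n) => [->|n0]; rewrite ?expn0 ?leq_exp2r.
  rewrite expnMn; apply: (@leq_trans (N ^ n.+1)); last by rewrite leq_pexp2l.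
  by rewrite expnS ltn_mul2r expn_gt0 /= ltnSn.
pose mon (al : U) := \prod_i f i ^+ al i.
pose mn (v : V) : 'X_{1..n} := [multinom (v i : nat) | i < n].
pose A := \matrix_(u < #|U|, v < #|V|) (mon (enum_val u))@_(mn (enum_val v)).
have : kermx A != 0.
  rewrite kermx_eq0 /row_free; apply/negP => /eqP E.
  by have := rank_leq_col A; rewrite E leqNgt lt_VU.
case/rowV0Pn => x /sub_kermxP xA x0.
exists N, (fun al => x 0 (enum_rank al)); split.
  apply/existsP; rewrite -negb_forall; apply: contra x0 => /forallP x0.
  by apply/eqP/rowP => u; rewrite mxE -(enum_valK u) (eqP (x0 _)).
apply/mpolyP => m; rewrite mcoeff0 raddf_sum /=.
have [mM|] := boolP [forall i, (m i < M)%N].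
  pose v : V := [ffun i => Ordinal (forallP mM i)].
  have mE : m = mn v by apply/mnmP => i; rewrite mnmE ffunE.
  have := congr1 (fun B : 'rV_#|V| => B 0 (enum_rank v)) xA; rewrite !mxE => E; rewrite -[RHS]E.
  rewrite [RHS](reindex (@enum_rank U)) /=; last exact/onW_bij/enum_rank_bij.
  by apply: eq_bigr => al _; rewrite !mxE !enum_rankK -mE mcoeffZ.
rewrite negb_forall => /existsP[i]; rewrite -leqNgt => leM.
rewrite big1 // => al _; rewrite mcoeffZ memN_msupp_eq0 ?mulr0 //.
apply: msize_mdeg_ge; apply: leq_trans (msize_monomial_le al fD) _.
by apply: leq_trans leM _; rewrite mdegE (bigD1 i) //= leq_addr.
Qed.
End Dependence.

Section IdealAdjoin.
Variables (k : fieldType) (n : nat) (I : {mpoly k[n]} -> Prop).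
Hypotheses (I0 : I 0) (ID : forall a f g, I f -> I g -> I (a * f + g)).

Lemma ideal_adjoin_lin fs a g h :
  ideal_adjoin I fs g -> ideal_adjoin I fs h -> ideal_adjoin I fs (a * g + h).
Proof.
move=> [g1 Ig1 [x ->]] [h1 Ih1 [y ->]]; exists (a * g1 + h1); first exact: ID.
exists (fun j => a * x j + y j); rewrite mulrDr mulr_sumr addrACA; congr (_ + _).
by rewrite -big_split; apply: eq_bigr => j _; rewrite mulrDl mulrA.
Qed.

Lemma ideal_adjoin_sub fs g : I g -> ideal_adjoin I fs g.
Proof.
move=> Ig; exists g => //; exists (fun _ => 0).
by rewrite big1 ?addr0 // => j _; rewrite mul0r.
Qed.

Lemma ideal_adjoin_mem fs j : (j < size fs)%N -> ideal_adjoin I fs fs`_j.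
Proof.
move=> lt_j; exists 0 => //; exists (fun i : 'I_(size fs) => (i == Ordinal lt_j)%:R).
rewrite add0r (bigD1 (Ordinal lt_j)) //= eqxx mul1r big1 ?addr0 // => i /negPf ->.
by rewrite mul0r.
Qed.

(** I + (fs) is the least ideal containing [I] and [fs]. *)
Lemma ideal_adjoin_ideal (J : {mpoly k[n]} -> Prop) fs h :
  (forall a f g, J f -> J g -> J (a * f + g)) -> J 0 ->
  (forall g, I g -> J g) -> (forall j, (j < size fs)%N -> J fs`_j) ->
  ideal_adjoin I fs h -> J h.
Proof.
move=> JD J0 JI Jf [g Ig [x ->]]; rewrite addrC; elim/big_rec: _ => [|j y _ Jy].
  by rewrite add0r; exact: JI.
by rewrite -addrA; apply: JD => //; apply: Jf.
Qed.
End IdealAdjoin.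

Section DimensionBound.
Variables (k : fieldType) (n m : nat).
Local Notation S := {mpoly k[n]}.
Variable pi : {lrmorphism S -> {mpoly k[m]}}.
Variable I : S -> Prop.
Hypothesis IE : forall f, I f <-> pi f = 0.

Lemma relation_mod s (f : 'I_s -> S) : (m < s)%N ->
  exists N (c : {ffun 'I_s -> 'I_N} -> k), (exists al, c al != 0) /\
    I (\sum_al c al *: \prod_i f i ^+ al i).
Proof.
move=> lt_ms; have [N [c [c0 E]]] := dependence (fun i => pi (f i)) lt_ms.
exists N, c; split=> //; apply/IE; rewrite -[RHS]E linear_sum; apply: eq_bigr => al _.
rewrite linearZ /= rmorph_prod; congr (_ *: _); apply: eq_bigr => i _.
by rewrite rmorphXn.
Qed.

(** Elements of P_(i+1) outside P_i satisfy the assumptions of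
    [no_relation]: a prime ideal has no zerodivisors outside it. *)
Lemma prime_chain_le s P : prime_chain I s P -> (s <= m)%N.
Proof.
case=> Pp Pchain; rewrite leqNgt; apply/negP => lt_ms.
have /fin_all_exists [f fP] : forall i : 'I_s, exists f, f \in P i.+1 /\ f \notin P i.
  by move=> i; have [_ [f f1 f2]] := Pchain i (ltn_ord i); exists f.
have [N [c [[al cal] Ic]]] := relation_mod f lt_ms.
move: cal; rewrite (_ : c al = 0) ?eqxx //; move: al.
have le_s (i : 'I_s) : (i <= s)%N by apply: ltnW.
pose Q t g := (t <= s)%N -> g \in P t.
apply: (@no_relation _ _ s N Q f c) => //.
- move=> t a g h Qg Qh le_ts; have [[_ _ idP] _ _] := Pp t le_ts.
  by apply: idP; [exact: Qg | exact: Qh].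
- by move=> t le_ts; have [[]] := Pp t le_ts.
- move=> i h Qh _; have [_ pr _] := Pp i (le_s i).
  have [_ fN] := fP i; have := pr _ _ (Qh (le_s i)); by rewrite (negPf fN).
- move=> i h Qh _; have [sub _] := Pchain i (ltn_ord i); exact/sub/Qh.
- by move=> i _; have [] := fP i.
- by move/(_ (leqnn s)); have [[_ /negP]] := Pp s (leqnn s).
- by move=> _; have [_ _ sub] := Pp 0%N (leq0n s); apply: sub.
Qed.

Lemma regular_seq_le fs : regular_seq I fs -> (size fs <= m)%N.
Proof.
case=> f0 reg no1; rewrite leqNgt; apply/negP => lt_ms.
have ID a g h : I g -> I h -> I (a * g + h).
  by move=> /IE Eg /IE Eh; apply/IE; rewrite rmorphD rmorphM /= Eg Eh mulr0 addr0.
have I0 : I 0 by apply/IE; rewrite rmorph0.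
have [N [c [[al cal] Ic]]] := relation_mod (fun i : 'I_(size fs) => fs`_i) lt_ms.
move: cal; rewrite (_ : c al = 0) ?eqxx //; move: al.
apply: (@no_relation _ _ _ N (fun t => ideal_adjoin I (take t fs)) _ c).
- by move=> t a g h; apply: ideal_adjoin_lin.
- by move=> t; apply: ideal_adjoin_sub.
- by move=> i h; apply: reg.
- move=> i h; apply: (ideal_adjoin_ideal (J := ideal_adjoin I (take i.+1 fs))).
  + by move=> a f g; apply: ideal_adjoin_lin.
  + exact: ideal_adjoin_sub.
  + by move=> g; apply: ideal_adjoin_sub.
  move=> j; rewrite size_takel ?(ltnW (ltn_ord i)) // => lt_ji.
  have lt_j : (j < size (take i.+1 fs))%N by rewrite size_takel // ltnW.
  have := ideal_adjoin_mem I0 lt_j; rewrite !nth_take //; exact: ltnW.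
- move=> i; have lt_i : (i < size (take i.+1 fs))%N by rewrite size_takel.
  by have := ideal_adjoin_mem I0 lt_i; rewrite nth_take.
- by rewrite take_size.
by rewrite take0; apply: ideal_adjoin_sub.
Qed.

End DimensionBound.

(** * Arithmetic of weighted monomials *)

(** Exponents of monomials in x, u, v. *)
Definition mnm3 (a b g : nat) : 'X_{1..3} := [multinom nth 0%N [:: a; b; g] i | i < 3].

Definition o0 : 'I_3 := Ordinal (isT : 0 < 3)%N.
Definition o1 : 'I_3 := Ordinal (isT : 1 < 3)%N.
Definition o2 : 'I_3 := Ordinal (isT : 2 < 3)%N.

Lemma mnm3E0 a b g : mnm3 a b g o0 = a. Proof. by rewrite mnmE. Qed.
Lemma mnm3E1 a b g : mnm3 a b g o1 = b. Proof. by rewrite mnmE. Qed.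
Lemma mnm3E2 a b g : mnm3 a b g o2 = g. Proof. by rewrite mnmE. Qed.
Definition mnm3E := (mnm3E0, mnm3E1, mnm3E2).

Lemma mnm3P (m m' : 'X_{1..3}) :
  m o0 = m' o0 -> m o1 = m' o1 -> m o2 = m' o2 -> m = m'.
Proof.
move=> e0 e1 e2; apply/mnmP => -[[|[|[|i]]] lt] //.
- by rewrite (_ : Ordinal lt = o0) //; apply: val_inj.
- by rewrite (_ : Ordinal lt = o1) //; apply: val_inj.
- by rewrite (_ : Ordinal lt = o2) //; apply: val_inj.
Qed.

Section ToricArithmetic.
Variable d : nat.
Hypothesis d3 : (3 <= d)%N.

Definition gt_codim := (d + d./2)%N.
Local Notation c := gt_codim.

Definition basis_deg (i : nat) : nat := (if i == 0 then 0 else if i <= c then 1 else 2)%N.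
(** The exponent of x is the least one making the weight of x^a u^b v^g a
    multiple of 2d, for b = i mod d and g = i / d; the degree is the quotient
    of the weight by 2d. *)
Definition basis_exp0 (i : nat) : nat := (2 * d * basis_deg i - (2 * (i %% d) + d * (i %/ d)))%N.
Definition basis_exp (i : nat) : 'X_{1..3} := mnm3 (basis_exp0 i) (i %% d) (i %/ d).
Local Notation be := basis_exp.

Definition toric_wt (m : 'X_{1..3}) : nat := (m o0 + 2 * m o1 + d * m o2)%N.
Local Notation wt := toric_wt.
(** The index of the basis monomial dividing m with a quotient in the
    parameters x^(2d), u^d, v^2. *)
Definition residue (m : 'X_{1..3}) : nat := (m o1 %% d + d * (m o2 %% 2))%N.
Local Notation red := residue.
Definition param_deg (m : 'X_{1..3}) : nat := (m o0 %/ (2 * d) + m o1 %/ d + m o2 %/ 2)%N.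
Definition param_exp (q0 q1 q2 : nat) : 'X_{1..3} := mnm3 (2 * d * q0) (d * q1) (2 * q2).
Local Notation thx := param_exp.

Lemma half_bound : (d./2 * 2 <= d)%N /\ (d < d./2 * 2 + 2)%N.
Proof. by rewrite -{2 3}(odd_double_half d) -muln2; case: odd; split; lia. Qed.

Lemma toric_wtD m m' : wt (m + m') = (wt m + wt m')%N.
Proof. by clear d3; rewrite /toric_wt !mnmDE; lia. Qed.

Lemma divmod_small i : (i < 2 * d)%N ->
  (i %% d = i /\ i %/ d = 0 /\ i < d)%N \/ (i %% d = i - d /\ i %/ d = 1 /\ d <= i)%N.
Proof.
move=> lt_i; case: (ltnP i d) => [lt_id|le_di]; [left|right].
  by rewrite modn_small ?divn_small.
have Ei : i = (1 * d + (i - d))%N by lia.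
have Em : (i %% d = i - d)%N by rewrite {1}Ei modnMDl modn_small //; lia.
have Ed : (i %/ d = 1)%N by rewrite {1}Ei divnMDl ?divn_small //; lia.
by rewrite Em Ed.
Qed.

Lemma basis_exp0P i : (i < 2 * d)%N ->
  (basis_exp0 i < 2 * d)%N /\ (basis_exp0 i + (2 * (i %% d) + d * (i %/ d)) =
    2 * d * basis_deg i)%N.
Proof.
move=> lt_i; have [h1 h2] := half_bound.
rewrite /basis_exp0 /basis_deg /gt_codim.
case: (divmod_small lt_i) => [[-> [-> ?]]|[-> [-> ?]]];
  case: eqP => [?|?]; try case: (leqP i (d + d./2)) => ?; split; lia.
Qed.

Lemma toric_wt_basis i : (i < 2 * d)%N -> wt (be i) = (2 * d * basis_deg i)%N.
Proof. by move=> /basis_exp0P [_ <-]; rewrite /toric_wt !mnm3E addnA. Qed.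

Lemma toric_wt_param q0 q1 q2 : wt (thx q0 q1 q2) = (2 * d * (q0 + q1 + q2))%N.
Proof. by rewrite /toric_wt !mnm3E; lia. Qed.

Lemma residue_lt m : (red m < 2 * d)%N.
Proof.
have := ltn_pmod (m o1) (ltac:(lia) : 0 < d)%N; have := ltn_pmod (m o2) (isT : 0 < 2)%N.
by rewrite /residue; case: (_ %% 2)%N => [|[]] //; lia.
Qed.

Lemma residue_mod m : (red m %% d = m o1 %% d)%N.
Proof. by rewrite /residue addnC mulnC modnMDl modn_mod. Qed.

Lemma residue_div m : (red m %/ d = m o2 %% 2)%N.
Proof.
rewrite /residue addnC mulnC divnMDl; last by lia.
by rewrite divn_small ?addn0 // ltn_pmod //; lia.
Qed.

(** The exponents of u and v are divided by d and 2; the exponent of x must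
    then leave the remainder of the basis monomial, since both are
    determined modulo 2d by the divisibility of the weight. *)
Lemma residue_decomp m : (2 * d %| wt m)%N ->
  m = (thx (m o0 %/ (2 * d)) (m o1 %/ d) (m o2 %/ 2) + be (red m))%MM.
Proof.
move=> dvd; have [lt_a Ea] := basis_exp0P (residue_lt m).
apply: mnm3P; rewrite mnmDE !mnm3E ?residue_mod ?residue_div.
- rewrite mulnC [LHS](divn_eq _ (2 * d)); congr addn.
  rewrite -[RHS](modn_small lt_a); apply/eqP.
  rewrite -(eqn_modDr (2 * (m o1 %% d) + d * (m o2 %% 2))).
  move: Ea; rewrite residue_mod residue_div => ->.
  rewrite modnMr; move: dvd; rewrite /toric_wt {1}(divn_eq (m o1) d) {1}(divn_eq (m o2) 2).
  have -> : (m o0 + 2 * (m o1 %/ d * d + m o1 %% d) + d * (m o2 %/ 2 * 2 + m o2 %% 2)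
    = (m o1 %/ d + m o2 %/ 2) * (2 * d) + (m o0 + (2 * (m o1 %% d) + d * (m o2 %% 2))))%N.
    by lia.
  by rewrite /dvdn modnMDl.
- by rewrite mulnC -divn_eq.
- by rewrite mulnC -divn_eq.
Qed.

(** The degree is additive along the decomposition of [residue_decomp]. *)
Lemma toric_wt_residue m : (2 * d %| wt m)%N ->
    wt m = (2 * d * (param_deg m + basis_deg (red m)))%N.
Proof.
by move=> /residue_decomp {1}->;
  rewrite toric_wtD toric_wt_param toric_wt_basis ?residue_lt // -mulnDr.
Qed.

Lemma residue_param_basis q0 q1 q2 i : (i < 2 * d)%N -> red (thx q0 q1 q2 + be i) = i.
Proof.
move=> lt_i; rewrite /residue !mnmDE !mnm3E !(mulnC _ q1) !(mulnC _ q2) !modnMDl modn_mod.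
have -> : (i %/ d %% 2 = i %/ d)%N.
  by rewrite modn_small // ltn_divLR; lia.
by rewrite addnC mulnC -divn_eq.
Qed.

(** Freeness over the parameters, at the level of monomials. *)
Lemma param_basis_inj q0 q1 q2 i q0' q1' q2' i' : (i < 2 * d)%N -> (i' < 2 * d)%N ->
  (thx q0 q1 q2 + be i)%MM = (thx q0' q1' q2' + be i')%MM ->
  [/\ q0 = q0', q1 = q1', q2 = q2' & i = i'].
Proof.
move=> lt_i lt_i' E; have Ei :
  i = i' by rewrite -(residue_param_basis q0 q1 q2 lt_i) E residue_param_basis.
move: E; rewrite Ei => /addIm E; split=> //.
- by move: (congr1 (fun m : 'X_{1..3} => m o0) E); rewrite !mnm3E; nia.
- by move: (congr1 (fun m : 'X_{1..3} => m o1) E); rewrite !mnm3E; nia.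
- by move: (congr1 (fun m : 'X_{1..3} => m o2) E); rewrite !mnm3E; lia.
Qed.

(** The product of two basis monomials is again one when there is no carry
    in the exponent of u and degrees add up. *)
Lemma basis_expD i j : (i + j < 2 * d)%N -> (basis_deg (i + j) = basis_deg i + basis_deg j)%N ->
  (i %% d + j %% d < d)%N -> (be i + be j)%MM = be (i + j).
Proof.
move=> lt_ij Edeg lt_d.
have Em : ((i + j) %% d = i %% d + j %% d)%N.
  by rewrite -modnDm modn_small.
have Ed : ((i + j) %/ d = i %/ d + j %/ d)%N.
  rewrite divnD; last by lia.
  by rewrite leqNgt lt_d addn0.
have [_ Ei] := basis_exp0P (ltac:(lia) : i < 2 * d)%N.
have [_ Ej] := basis_exp0P (ltac:(lia) : j < 2 * d)%N.
have [_ Eij] := basis_exp0P lt_ij.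
apply: mnm3P; rewrite mnmDE !mnm3E //.
by move: Eij Ei Ej; rewrite Edeg Em Ed; lia.
Qed.

Lemma basis_deg0 : basis_deg 0 = 0%N. Proof. by []. Qed.
Lemma basis_deg1 i : (0 < i <= c)%N -> basis_deg i = 1%N.
Proof. by rewrite /basis_deg; case: i => //= i ->. Qed.
Lemma basis_deg2 i : (c < i)%N -> basis_deg i = 2%N.
Proof. by rewrite /basis_deg; case: i => //= i; rewrite ltnNge => /negPf ->. Qed.

(** A basis monomial of degree 2 is the product of y_c and another basis
    monomial of degree 1, so the y_l generate. *)
Lemma basis_exp_top i : (c < i < 2 * d)%N -> be i = (be c + be (i - c))%MM.
Proof.
have [h1 h2] := half_bound; have Ec : c = (d + d./2)%N by [].
case/andP=> lt_ci lt_i.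
rewrite basis_expD; rewrite ?subnKC // ; try by lia.
  rewrite basis_deg2 // !basis_deg1 //; lia.
have lt_c : (c < 2 * d)%N by lia.
have lt_ic : (i - c < 2 * d)%N by lia.
by case: (divmod_small lt_c) => [[-> [_ ?]]|[-> [_ ?]]];
  case: (divmod_small lt_ic) => [[-> [_ ?]]|[-> [_ ?]]]; lia.
Qed.

(** No basis monomial of degree at most 1 is in the socle: its product with a
    suitable y_j is a basis monomial. *)
Lemma level_partner i : (i <= c)%N -> exists2 j, (0 < j <= c)%N &
  (i + j < 2 * d)%N /\ (be i + be j)%MM = be (i + j).
Proof.
have [h1 h2] := half_bound; have Ec : c = (d + d./2)%N by []; move=> le_ic.
have [i0|i_gt0] := posnP i.
  exists 1%N; rewrite ?i0; first lia.
  split; first lia.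
  by apply: basis_expD; rewrite ?add0n ?basis_deg0 ?mod0n ?(@modn_small 1) ?add0n //; lia.
(* Without a carry in the exponent of u the product is b_(i+j); it has degree 2
   as soon as c < i + j. *)
suff [j [lt_j lt_ij ltm]] : exists j, [/\ (0 < j <= c)%N, (c < i + j < 2 * d)%N &
    (i %% d + j %% d < d)%N].
  exists j => //; split; first by lia.
  apply: basis_expD; rewrite ?(@basis_deg2 (i + j)) ?(@basis_deg1 i) ?(@basis_deg1 j) //; lia.
have lt_i : (i < 2 * d)%N by lia.
case: (divmod_small lt_i) => [[-> [_ lt_id]]|[-> [_ le_di]]].
  exists (d + (if (i < d - d./2)%N then d./2 else d - 1 - i))%N.
  have lt2 : (d + (if (i < d - d./2)%N then d./2 else d - 1 - i) < 2 * d)%N by case: ifP; lia.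
  case: (divmod_small lt2) => [[_ [_ ?]]|[-> _]]; first by lia.
  by case: ifP => ?; split; lia.
exists (2 * d - 1 - i)%N; rewrite modn_small; last by lia.
by split; lia.
Qed.

End ToricArithmetic.

(** * The toric ring as a Koszul cokernel *)

(** Induction over constants, sums and multiplication by a variable: the form
    suited to ring morphisms and to module actions of polynomials. *)
Lemma mpoly_var_ind (k : fieldType) n (P : {mpoly k[n]} -> Prop) :
  (forall c, P c%:MP) -> (forall p q, P p -> P q -> P (p + q)) ->
  (forall i p, P p -> P ('X_i * p)) -> forall p, P p.
Proof.
move=> PC PD PX; elim/mpolyind => [|c m p _ _ Pp].
  by rewrite -[0]/(0%:MP); apply: PC.
apply: PD => //; rewrite mpolyXE_id -mul_mpolyC mulrC.
elim: (index_enum _) => [|i r IH]; first by rewrite big_nil mul1r.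
rewrite big_cons -mulrA; elim: (m i) => [|e IHe]; first by rewrite expr0 mul1r.
by rewrite exprS -mulrA; apply: PX.
Qed.

Section ToricRing.
(* The variables of S come from an arbitrary enumeration of the generators; [lab]
   and [ix] are inverse bijections between it and the labels 0, ..., c + 2. *)
Variables (k : fieldType) (d n : nat) (ix : nat -> 'I_n) (lab : 'I_n -> nat).
Local Notation c := (gt_codim d).
Local Notation S := {mpoly k[n]}.
Local Notation R := {mpoly k[3]}.
Local Notation N := (2 * d)%N.
Hypothesis d3 : (3 <= d)%N.
Hypotheses (lab_lt : forall i, (lab i < c + 3)%N) (ixK : forall i, ix (lab i) = i)
  (labK : forall l, (l < c + 3)%N -> lab (ix l) = l).

Local Notation be := (basis_exp d).
Local Notation thx := (param_exp d).
Local Notation red := (residue d).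

(** The images of the variables: x^(2d), then y_1, ..., y_c, then u^d, and
    finally v^2 - 2 u^d, which is x_1^(2d) + x_2^(2d). *)
Definition var_image (l : nat) : R :=
  if l == 0%N then 'X_[thx 1 0 0] else if (l <= c)%N then 'X_[be l]
  else if l == c.+1 then 'X_[thx 0 1 0] else 'X_[thx 0 0 1] - 2%:R * 'X_[thx 0 1 0].
Local Notation gp := var_image.

Lemma var_image0 : gp 0 = 'X_[thx 1 0 0]. Proof. by []. Qed.
Lemma var_image_basis l : (0 < l <= c)%N -> gp l = 'X_[be l].
Proof. by rewrite /var_image; case: l => //= l ->. Qed.
Lemma var_image_u : gp c.+1 = 'X_[thx 0 1 0].
Proof. by rewrite /var_image ltnn eqxx. Qed.
Lemma var_image_v : gp c.+2 = 'X_[thx 0 0 1] - 2%:R * 'X_[thx 0 1 0].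
Proof.
have e1 : (c.+2 <= c)%N = false by lia.
have e2 : (c.+2 == c.+1)%N = false by lia.
by rewrite /var_image e1 e2.
Qed.

Definition label_var (l : nat) : S := 'X_(ix l).
Local Notation w := label_var.

Definition toric_map (f : S) : R := f \mPo [tuple gp (lab i) | i < n].
Local Notation pi := toric_map.
HB.instance Definition _ := GRing.RMorphism.copy pi pi.
HB.instance Definition _ := GRing.Linear.copy pi pi.

Lemma toric_mapX i : pi 'X_i = gp (lab i).
Proof. by rewrite /toric_map comp_mpolyXU -tnth_nth tnth_mktuple. Qed.

Lemma toric_map_label_var l : (l < c + 3)%N -> pi (w l) = gp l.
Proof. by move=> lt_l; rewrite toric_mapX labK. Qed.

(** A preimage of a monomial in the parameters; the last factor undoes the
    shift of v^2 by 2 u^d. *)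
Definition param_lift (q0 q1 q2 : nat) : S :=
  w 0 ^+ q0 * w c.+1 ^+ q1 * (w c.+2 + 2%:R * w c.+1) ^+ q2.
Local Notation th := param_lift.
Definition param_part (m : 'X_{1..3}) : S := th (m o0 %/ (2 * d)) (m o1 %/ d) (m o2 %/ 2).
Local Notation thm := param_part.

Lemma param_exp_split q0 q1 q2 : 'X_[thx q0 q1 q2] =
  'X_[thx 1 0 0] ^+ q0 * 'X_[thx 0 1 0] ^+ q1 * 'X_[thx 0 0 1] ^+ q2 :> R.
Proof.
rewrite !mpolyXn -!mpolyXD; congr 'X_[_].
by apply: mnm3P; rewrite !(mnmDE, mulmnE, mnm3E); lia.
Qed.

(** Multiplication by y_(l+1) on A in the basis of A over P: the product of
    two basis monomials is a parameter monomial times a basis monomial. *)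
Definition mult_mx (l : nat) : 'M[S]_N :=
  \matrix_(i, j) if j == red (be i + be l.+1)%MM :> nat then thm (be i + be l.+1)%MM else 0.
Local Notation Ymx := mult_mx.

(** The definition is extended by 0 so that all these matrices commute. *)
Definition koszul_mx (l : nat) : 'M[S]_N :=
  if (l < c)%N then (w l.+1)%:M - Ymx l else 0.
Local Notation Tmx := koszul_mx.

Lemma dvd_wt_basis i : (i < N)%N -> (2 * d %| toric_wt d (be i))%N.
Proof. by move=> lt_i; rewrite toric_wt_basis // dvdn_mulr. Qed.

Lemma dvd_wt_basisD i j : (i < N)%N -> (j < N)%N -> (2 * d %| toric_wt d (be i + be j))%N.
Proof. by move=> lt_i lt_j; rewrite toric_wtD // dvdn_add ?dvd_wt_basis. Qed.

Lemma gt_codim_lt : (c < N)%N.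
Proof. by have [h1 h2] := half_bound d3; rewrite /gt_codim; lia. Qed.

Section Evaluation.
Variables (Q : comNzRingType) (tau : {rmorphism S -> Q}) (eta : {rmorphism R -> Q}).
Hypothesis tau_param : forall l, (l == 0%N) || (c < l < c + 3)%N -> tau (w l) = eta (gp l).

Lemma basis_eval_param_lift q0 q1 q2 : tau (th q0 q1 q2) = eta 'X_[thx q0 q1 q2].
Proof.
have e2 : tau (w c.+2 + 2%:R * w c.+1) = eta 'X_[thx 0 0 1].
  rewrite rmorphD rmorphM rmorph_nat !tau_param ?orbT //; try by lia.
  by rewrite var_image_v var_image_u rmorphB rmorphM rmorph_nat subrK.
rewrite param_exp_split !rmorphM !rmorphXn /= e2 !tau_param //; try by lia.
by rewrite var_image0 var_image_u.
Qed.

Lemma basis_eval_param_part m : (2 * d %| toric_wt d m)%N ->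
  tau (thm m) * eta 'X_[be (red m)] = eta 'X_[m].
Proof.
by move=> dvd; rewrite basis_eval_param_lift -rmorphM -mpolyXD -residue_decomp.
Qed.

(** The evaluation of S^(2d) at the basis monomials, along a ring morphism
    [tau] that treats the parameters as [toric_map] does.  In this generality
    it turns [mult_mx] into a multiplication by y_(l+1). *)
Definition basis_eval (v : 'rV[S]_N) : Q := \sum_i tau (v 0 i) * eta 'X_[be i].

Lemma basis_evalD : {morph basis_eval : u v / u + v}.
Proof.
by move=> u v; rewrite /basis_eval -big_split; apply: eq_bigr => i _; rewrite mxE rmorphD mulrDl.
Qed.

Lemma basis_evalZ a v : basis_eval (a *: v) = tau a * basis_eval v.
Proof.
by rewrite /basis_eval mulr_sumr; apply: eq_bigr => i _; rewrite mxE rmorphM mulrA.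
Qed.

Lemma basis_evalB u v : basis_eval (u - v) = basis_eval u - basis_eval v.
Proof. by rewrite -scaleN1r basis_evalD basis_evalZ rmorphN1 mulN1r. Qed.

Lemma basis_eval_delta i : basis_eval (delta_mx 0 i) = eta 'X_[be i].
Proof.
rewrite /basis_eval (bigD1 i) //= mxE !eqxx rmorph1 mul1r big1 ?addr0 // => j /negPf nj.
by rewrite mxE nj andbF rmorph0 mul0r.
Qed.

Lemma basis_eval_mult v l : (l < c)%N ->
    basis_eval (v *m Ymx l) = eta 'X_[be l.+1] * basis_eval v.
Proof.
move=> lt_lc; have lt_c := gt_codim_lt.
rewrite /basis_eval mulr_sumr; under eq_bigr => j _ do rewrite mxE rmorph_sum mulr_suml.
rewrite exchange_big; apply: eq_bigr => i _ /=.
have dvd : (2 * d %| toric_wt d (be i + be l.+1))%N by apply: dvd_wt_basisD => //; lia.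
rewrite (bigD1 (Ordinal (residue_lt d3 (be i + be l.+1)%MM))) //= !mxE eqxx rmorphM.
rewrite -mulrA basis_eval_param_part // mpolyXD rmorphM big1 ?addr0 => [|j nj];
  first by rewrite mulrCA mulrC [in RHS]mulrC; ring.
by rewrite !mxE ifF ?mulr0 ?rmorph0 ?mul0r //; apply/negbTE; apply: contra nj => /eqP E;
  apply/eqP/val_inj.
Qed.

Lemma basis_eval_koszul v l : (l < c)%N ->
  basis_eval (v *m Tmx l) = (tau (w l.+1) - eta (gp l.+1)) * basis_eval v.
Proof.
move=> lt_lc; rewrite /koszul_mx lt_lc mulmxBr mul_mx_scalar basis_evalB basis_evalZ
  basis_eval_mult //.
by rewrite mulrBl var_image_basis.
Qed.
End Evaluation.

Local Notation Q := {mpoly R[n]}.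

(** The substitution keeping the variables y_(j+1), ..., y_c and replacing
    the others by their images in R. *)
Definition sub_var (j : nat) (i : 'I_n) : Q :=
  if (j < lab i <= c)%N then 'X_i else (gp (lab i))%:MP.
Definition partial_subst (j : nat) (f : S) : Q :=
    mmap ((@mpolyC n R) \o (@mpolyC 3 k)) (sub_var j) f.
Local Notation tau := partial_subst.
HB.instance Definition _ j := GRing.RMorphism.copy (tau j)
  (mmap ((@mpolyC n R) \o (@mpolyC 3 k)) (sub_var j)).

Lemma partial_substX j i : tau j 'X_i = sub_var j i.
Proof. by rewrite /partial_subst mmapX mmap1U. Qed.

Lemma partial_substC j a : tau j a%:MP = a%:MP%:MP.
Proof. by rewrite /partial_subst mmapC. Qed.

Lemma partial_subst_param j l : (l == 0%N) || (c < l < c + 3)%N -> tau j (w l) = (gp l)%:MP.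
Proof.
move=> hl; rewrite partial_substX /sub_var labK ?ifF //; try by lia.
Qed.

Lemma partial_subst_y j l : (l < c)%N ->
  tau j (w l.+1) = if (j <= l)%N then 'X_(ix l.+1) else (gp l.+1)%:MP.
Proof. by move=> lt_lc; rewrite partial_substX /sub_var labK ?lt_lc ?andbT //; lia. Qed.

Fact partial_eval_key : unit. Proof. by []. Qed.
(** This map identifies S^(2d) modulo the images of T_0, ..., T_(j-1) with a
    submodule of the polynomial ring over R.  It is locked because conversion
    would otherwise unfold it in nested polynomial rings. *)
Definition partial_eval (j : nat) (v : 'rV[S]_N) : Q :=
  locked_with partial_eval_key (basis_eval (tau j) (@mpolyC n R)) v.
Local Notation rho := partial_eval.

Lemma partial_evalE j v : rho j v = basis_eval (tau j) (@mpolyC n R) v.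
Proof. by rewrite /partial_eval unlock. Qed.

Lemma partial_evalD j u v : rho j (u + v) = rho j u + rho j v.
Proof. by rewrite !partial_evalE basis_evalD. Qed.

Lemma partial_evalZ j a v : rho j (a *: v) = tau j a * rho j v.
Proof. by rewrite !partial_evalE basis_evalZ. Qed.

Lemma partial_evalB j u v : rho j (u - v) = rho j u - rho j v.
Proof. by rewrite !partial_evalE basis_evalB. Qed.

Lemma partial_eval_delta j i : rho j (delta_mx 0 i) = ('X_[be i])%:MP.
Proof. by rewrite partial_evalE basis_eval_delta. Qed.

Lemma partial_eval_row0 j : rho j 0 = 0.
Proof. by rewrite -[0](subrr 0) partial_evalB subrr. Qed.

Definition param_mon (i : 'I_n) : 'X_{1..3} :=
  thx (lab i == 0%N) (lab i == c.+1) (lab i == c.+2).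
Definition y_mon (i : 'I_n) : 'X_{1..n} := if (0 < lab i <= c)%N then U_(i)%MM else 0%MM.
(** A monomial variant of the substitution with j = 0: the last variable is
    sent to v^2 instead of v^2 - 2 u^d. *)
Definition mono_var (i : 'I_n) : Q := ('X_[param_mon i])%:MP * 'X_[y_mon i].
Definition param_sum (m : 'X_{1..n}) : 'X_{1..3} := (\sum_i param_mon i *+ m i)%MM.
Definition y_sum (m : 'X_{1..n}) : 'X_{1..n} := (\sum_i y_mon i *+ m i)%MM.

Lemma mmap1_mono m : mmap1 mono_var m = ('X_[param_sum m])%:MP * 'X_[y_sum m].
Proof.
rewrite /mmap1 /param_sum /y_sum.
elim/big_rec3: _ => [|i y x z _ ->]; first by rewrite !mpolyX0 mpolyC1 mulr1.
rewrite exprMn -rmorphXn /= !mpolyXn !mpolyXD mpolyCM; ring.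
Qed.

Lemma y_sumE m i : y_sum m i = if (0 < lab i <= c)%N then m i else 0%N.
Proof.
rewrite /y_sum mnm_sumE (bigD1 i) //= big1 => [|i' ni].
  by rewrite addn0 mulmnE /y_mon; case: ifP => _; rewrite ?mnm1E ?eqxx ?mul1n // mnm0E.
rewrite mulmnE /y_mon; case: ifP => _; last by rewrite mnm0E.
by rewrite mnm1E (negPf ni).
Qed.

Lemma param_sumE m : param_sum m = thx (m (ix 0)) (m (ix c.+1)) (m (ix c.+2)).
Proof.
have E (l : nat) x : (l < c + 3)%N ->
    (\sum_i x * (lab i == l) * m i = x * m (ix l))%N.
  move=> lt_l; rewrite (bigD1 (ix l)) //= labK // eqxx muln1 big1 ?addn0 // => i ni.
  by rewrite (_ : lab i == l = false) ?muln0 //; apply: contraNF ni => /eqP <-; rewrite ixK.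
apply: mnm3P; rewrite /param_sum mnm_sumE.
- by rewrite mnm3E -E; [apply: eq_bigr => i _; rewrite mulmnE mnm3E | lia].
- by rewrite mnm3E -E; [apply: eq_bigr => i _; rewrite mulmnE mnm3E | lia].
- by rewrite mnm3E -E; [apply: eq_bigr => i _; rewrite mulmnE mnm3E | lia].
Qed.

(** Distinct monomials of S times distinct basis elements have distinct
    images: the y-part is kept, and the remaining exponents are recovered by
    the freeness over the parameters. *)
Lemma mono_exp_inj m m' b b' : (b < N)%N -> (b' < N)%N ->
  y_sum m = y_sum m' -> (param_sum m + be b = param_sum m' + be b')%MM -> m = m' /\ b = b'.
Proof.
move=> lt_b lt_b' Ey; rewrite !param_sumE => /param_basis_inj [] // e0 e1 e2 Eb; split=> //.
apply/mnmP => i; have := congr1 (fun y : 'X_{1..n} => y i) Ey; rewrite !y_sumE.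
case: ifP => // /negbT ni _; have lti := lab_lt i.
have : [\/ lab i = 0%N, lab i = c.+1 | lab i = c.+2].
  by have [?|[?|?]] : lab i = 0%N \/ lab i = c.+1 \/ lab i = c.+2; first lia;
     [constructor 1 | constructor 2 | constructor 3].
by case=> E; rewrite -(ixK i) E.
Qed.

Definition mono_subst (f : S) : Q := mmap ((@mpolyC n R) \o (@mpolyC 3 k)) mono_var f.
HB.instance Definition _ := GRing.RMorphism.copy mono_subst
  (mmap ((@mpolyC n R) \o (@mpolyC 3 k)) mono_var).

Lemma mono_subst_coeff f b Y T : (mono_subst f * ('X_[b])%:MP)@_Y@_T =
  \sum_(m <- msupp f) f@_m * ((y_sum m == Y) && (param_sum m + b == T)%MM)%:R.
Proof.
rewrite /mono_subst /mmap mulr_suml !raddf_sum; apply: eq_bigr => m _ /=.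
rewrite mmap1_mono -mulrA mulrAC -mpolyCM -mpolyXD mulrA -mpolyCM mcoeffCM mcoeffX.
case: eqP => _ /=; last by rewrite !mulr0 mcoeff0.
by rewrite mulr1 mcoeffCM mcoeffX.
Qed.

Lemma mono_subst_free (s : 'I_N -> S) :
  \sum_i mono_subst (s i) * ('X_[be i])%:MP = 0 -> forall i, s i = 0.
Proof.
move=> E i0; apply/mpolyP => m0; rewrite mcoeff0.
have := congr1 (fun q : Q => q@_(y_sum m0)@_(param_sum m0 + be i0)%MM) E.
rewrite !mcoeff0 => <-; rewrite !raddf_sum (bigD1 i0) //= mono_subst_coeff.
rewrite [X in _ = _ + X]big1 ?addr0 => [|i ni]; last first.
  rewrite mono_subst_coeff big1 // => m _; case: andP => [[/eqP e1 /eqP e2]|_];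
    last by rewrite mulr0.
  have [_ /val_inj Ei] := mono_exp_inj (ltn_ord i) (ltn_ord i0) e1 e2.
  by rewrite Ei eqxx in ni.
rewrite {1}[s i0]mpolyE raddf_sum; apply: eq_bigr => m _ /=.
rewrite mcoeffZ mcoeffX; congr (_ * _%:R); congr nat_of_bool.
apply/eqP/andP => [->|[/eqP e1 /eqP e2]]; first by rewrite !eqxx.
by have [] := mono_exp_inj (ltn_ord i0) (ltn_ord i0) e1 e2.
Qed.

(** The linear change of variables between v^2 - 2 u^d and v^2. *)
Definition shear (a : k) (f : S) : S :=
  f \mPo [tuple 'X_i + (if lab i == c.+2 then a *: w c.+1 else 0) | i < n].
HB.instance Definition _ a := GRing.RMorphism.copy (shear a) (shear a).

Lemma shearX a i : shear a 'X_i = 'X_i + (if lab i == c.+2 then a *: w c.+1 else 0).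
Proof. by rewrite /shear comp_mpolyXU -tnth_nth tnth_mktuple. Qed.

Lemma shearZ a b p : shear a (b *: p) = b *: shear a p.
Proof. by rewrite /shear linearZ. Qed.

Lemma shearK a : cancel (shear a) (shear (- a)).
Proof.
have Ew b : shear b (w c.+1) = w c.+1.
  rewrite /label_var shearX labK; last by lia.
  by rewrite ltn_eqF ?addr0.
elim/mpoly_var_ind => [e|p q Ep Eq|i p Ep].
- by rewrite /shear !comp_mpolyC.
- by rewrite !rmorphD /= Ep Eq.
rewrite !rmorphM /= Ep; congr (_ * _).
rewrite shearX; case: ifP => Ei; last by rewrite addr0 shearX Ei addr0.
by rewrite rmorphD /= shearZ Ew shearX Ei scaleNr subrK.
Qed.

Lemma partial_subst0_shear f : tau 0 f = mono_subst (shear (- 2%:R) f).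
Proof.
elim/mpoly_var_ind: f => [e|p q Ep Eq|i p Ep].
- by rewrite /shear comp_mpolyC /partial_subst /mono_subst !mmapC.
- by rewrite !rmorphD /= Ep Eq.
have monoX j : mono_subst 'X_j = mono_var j by rewrite /mono_subst mmapX mmap1U.
have monoE l : (l < c + 3)%N -> mono_var (ix l) =
    ('X_[thx (l == 0%N) (l == c.+1) (l == c.+2)])%:MP * 'X_[y_mon (ix l)].
  by move=> lt_l; rewrite /mono_var /param_mon labK.
rewrite !rmorphM /= Ep.
suff -> : tau 0 'X_i = mono_subst (shear (- 2%:R) 'X_i) by [].
rewrite partial_substX shearX /sub_var rmorphD /= monoX.
have lt_l := lab_lt i; have Ei := ixK i; move: (lab i) Ei lt_l => l <- lt_l.
rewrite (monoE _ lt_l) /y_mon (labK lt_l).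
have wE : mono_subst (- 2%:R *: w c.+1) = - (2%:R * ('X_[thx 0 1 0])%:MP).
  rewrite -mul_mpolyC rmorphM /= monoX monoE; last by lia.
  rewrite /y_mon labK; last by lia.
  rewrite ltnn andbF mpolyX0 mulr1 eqxx (ltn_eqF (ltnSn _)).
  by rewrite /mono_subst mmapC /= !mpolyCN mulNr !rmorph_nat.
have [hl|nl] := boolP (0 < l <= c)%N.
  have -> : (l == c.+2) = false by lia.
  have -> : (l == c.+1) = false by lia.
  have -> : (l == 0%N) = false by lia.
  have -> : thx false false false = 0%MM by apply: mnm3P; rewrite mnm3E mnm0E; lia.
  by rewrite rmorph0 addr0 mpolyX0 mpolyC1 mul1r.
rewrite mpolyX0 mulr1.
have [->|l0] := eqVneq l 0%N.
  by rewrite var_image0 rmorph0 addr0.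
have [->|l1] := eqVneq l c.+1.
  by rewrite var_image_u (ltn_eqF (ltnSn _)) rmorph0 addr0.
have -> : l = c.+2 by lia.
rewrite eqxx wE var_image_v mpolyCB mpolyCM rmorph_nat; congr (_ - _).
Qed.

(** Freeness of A over P, extended to polynomials in the y_l.  It lets
    identities of matrices over S be checked after evaluation. *)
Lemma partial_eval0_inj v : rho 0 v = 0 -> v = 0.
Proof.
rewrite partial_evalE /basis_eval /=; under eq_bigr => i _ do rewrite partial_subst0_shear.
move=> /(mono_subst_free (s := fun i => shear (- 2%:R) (v 0 i))) E.
by apply/rowP => i; rewrite mxE -[LHS](shearK (- 2%:R)) E rmorph0.
Qed.

(** T_l acts as y_(l+1) minus its image: by 0 once the variable has been
    substituted, and as a nonzerodivisor before. *)
Lemma partial_eval_koszul j v l : (l < c)%N -> rho j (v *m Tmx l) =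
  (if (j <= l)%N then 'X_(ix l.+1) - (gp l.+1)%:MP else 0) * rho j v.
Proof.
move=> lt_lc; rewrite !partial_evalE (basis_eval_koszul (partial_subst_param j) _ lt_lc).
rewrite /= (partial_subst_y _ lt_lc); case: (j <= l)%N; first by [].
by rewrite subrr.
Qed.

Lemma partial_eval_mult j v l : (l < c)%N -> rho j (v *m Ymx l) = (gp l.+1)%:MP * rho j v.
Proof.
by move=> lt_lc; rewrite !partial_evalE
  (basis_eval_mult (partial_subst_param j) _ lt_lc) var_image_basis.
Qed.

Lemma partial_eval0_ext (A B : 'M[S]_N) : (forall v, rho 0 (v *m A) = rho 0 (v *m B)) -> A = B.
Proof.
move=> E; apply/row_matrixP => i; rewrite !rowE; apply/eqP; rewrite -subr_eq0; apply/eqP.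
by apply: partial_eval0_inj; rewrite partial_evalB E subrr.
Qed.

(** After the injective evaluation both products are multiplication by the
    same polynomial. *)
Lemma koszul_mx_comm i j : Tmx i *m Tmx j = Tmx j *m Tmx i.
Proof.
have [lt_i|le_i] := ltnP i c; last by rewrite {1 4}/Tmx ltnNge le_i mul0mx mulmx0.
have [lt_j|le_j] := ltnP j c; last by rewrite {2 3}/Tmx ltnNge le_j mul0mx mulmx0.
apply: partial_eval0_ext => v;
  rewrite !mulmxA (partial_eval_koszul _ (v *m Tmx i) lt_j) (partial_eval_koszul _ v lt_i).
rewrite (partial_eval_koszul _ (v *m Tmx j) lt_i) (partial_eval_koszul _ v lt_j); exact: mulrCA.
Qed.

(** Modulo the image of T_j, the variable y_(j+1) acts as its matrix, so it
    can be eliminated from the coefficients of [v]; on vectors without that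
    variable, two consecutive substitutions agree. *)
Lemma reduce_var j (v : 'rV[S]_N) : (j < c)%N ->
  exists u v', v = v' + u *m Tmx j /\ rho j.+1 v' = rho j v'.
Proof.
move=> lt_jc; pose E (v : 'rV[S]_N) :=
  exists u v', v = v' + u *m Tmx j /\ rho j.+1 v' = rho j v'.
have ED v1 v2 : E v1 -> E v2 -> E (v1 + v2).
  move=> [u1 [w1 [-> e1]]] [u2 [w2 [-> e2]]]; exists (u1 + u2), (w1 + w2).
  by split; [rewrite mulmxDl addrACA | rewrite !partial_evalD e1 e2].
have rhoX j' i x : rho j' ('X_i *: x) = sub_var j' i * rho j' x.
  by rewrite partial_evalZ partial_substX.
have EX i x : E x -> E ('X_i *: x).
  move=> [u [x' [-> e]]]; rewrite scalerDr scalemxAl.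
  have [Ei|ni] := eqVneq (lab i) j.+1.
    exists ('X_i *: u + x'), (x' *m Ymx j); split.
      rewrite mulmxDl [RHS]addrCA [LHS]addrC; congr (_ + _).
      have -> : x' *m Tmx j = 'X_i *: x' - x' *m Ymx j.
        by rewrite /koszul_mx lt_jc mulmxBr mul_mx_scalar /label_var -Ei ixK.
      by rewrite addrC subrK.
    by rewrite (partial_eval_mult _ _ lt_jc) (partial_eval_mult _ _ lt_jc) e.
  exists ('X_i *: u), ('X_i *: x'); split; first by [].
  rewrite !rhoX e; suff -> : sub_var j.+1 i = sub_var j i by [].
  rewrite /sub_var; suff -> : (j.+1 < lab i)%N = (j < lab i)%N by []; move: ni; lia.
have Ebasis i p : E (p *: delta_mx 0 i).
  elim/mpoly_var_ind: p => [a|p q Ep Eq|i' p Ep].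
  - exists 0, (a%:MP *: delta_mx 0 i); rewrite mul0mx addr0; split; first by [].
    by rewrite !partial_evalZ !partial_substC !partial_eval_delta.
  - by rewrite scalerDl; apply: ED.
  - by rewrite -scalerA; apply: EX.
rewrite [v]row_sum_delta -/(E _); elim/big_rec: _ => [|i x _ Ex].
  by exists 0, 0; rewrite mul0mx addr0 !partial_eval_row0.
exact: ED.
Qed.

Lemma partial_eval_image j j' v : (j <= j')%N -> (j' <= c)%N -> koszul_image Tmx j v ->
    rho j' v = 0.
Proof.
move=> le_jj' le_j'c; elim: j v le_jj' => [|j IH] v le_jj'.
  by move=> [x ->]; rewrite mulmx0 partial_eval_row0.
case/koszul_imageS=> u /(IH _ (ltnW le_jj')); rewrite partial_evalB partial_eval_koszul;
  last by lia.
have -> : (j' <= j)%N = false by lia.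
by rewrite mul0r subr0.
Qed.

(** By induction on j: a vector killed by the (j+1)-st evaluation is modified
    by the image of T_j into one killed by the j-th evaluation. *)
Lemma partial_eval_kernel j v : (j <= c)%N -> rho j v = 0 -> koszul_image Tmx j v.
Proof.
elim: j v => [|j IH] v lt_jc E.
  by rewrite (partial_eval0_inj E); exists 0; rewrite mul0mx.
apply/koszul_imageS; have [u [v' [Ev Ev']]] := reduce_var v lt_jc.
exists u; rewrite Ev addrK; apply: IH; first exact: ltnW.
by move: E; rewrite Ev partial_evalD (partial_eval_koszul _ _ lt_jc) ltnn mul0r addr0 Ev'.
Qed.

(** S^(2d) modulo the previous images embeds in a domain, where T_j acts by
    the nonzero polynomial y - g with g free of y. *)
Lemma koszul_mx_regular j v : (j < c)%N -> koszul_image Tmx j (v *m Tmx j) ->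
    koszul_image Tmx j v.
Proof.
move=> lt_jc /(partial_eval_image (leqnn j) (ltnW lt_jc));
  rewrite (partial_eval_koszul _ _ lt_jc) leqnn.
have X0 : 'X_(ix j.+1) - (gp j.+1)%:MP != 0 :> Q.
  apply/eqP => /(congr1 (mcoeff U_(ix j.+1))).
  rewrite mcoeffB mcoeffX eqxx mcoeffC mcoeff0.
  case: eqP => [E|_]; last by rewrite mulr0 subr0 => /eqP; rewrite oner_eq0.
  by have := mdeg1 (ix j.+1); rewrite E mdeg0.
move=> /eqP; rewrite mulf_eq0 (negPf X0) => /eqP; exact/partial_eval_kernel/ltnW.
Qed.

Definition toric_eval (v : 'rV[S]_N) : R := \sum_i pi (v 0 i) * 'X_[be i].
Local Notation evp := toric_eval.

Lemma partial_subst_last f : tau c f = (pi f)%:MP.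
Proof.
elim/mpoly_var_ind: f => [e|p q Ep Eq|i p Ep].
- by rewrite partial_substC /toric_map comp_mpolyC.
- by rewrite !rmorphD /= Ep Eq.
- by rewrite !rmorphM /= Ep partial_substX /sub_var ltnNge andNb toric_mapX.
Qed.

(** For j = c all variables are substituted: the Koszul complex resolves the
    span of the basis monomials over the image of S, that is A. *)
Lemma koszul_imageP v : koszul_image Tmx c v <-> evp v = 0.
Proof.
have E : rho c v = (evp v)%:MP.
  by rewrite partial_evalE /basis_eval /toric_eval rmorph_sum; apply: eq_bigr => i _;
    rewrite /= partial_subst_last rmorphM.
split=> [/(partial_eval_image (leqnn c) (leqnn c))|Ev].
  by rewrite E => /eqP; rewrite mpolyC_eq0 => /eqP.
by apply: partial_eval_kernel => //; rewrite E Ev mpolyC0.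
Qed.

(** Preimages of the basis monomials; those of degree 2 are products by
    [basis_exp_top]. *)
Definition basis_lift (i : nat) : S :=
  if i == 0%N then 1 else if (i <= c)%N then w i else w c * w (i - c).
Local Notation sb := basis_lift.

Lemma toric_map_basis_lift i : (i < N)%N -> pi (sb i) = 'X_[be i].
Proof.
have [h1 h2] := half_bound d3; have Ec : c = (d + d./2)%N by [].
rewrite /basis_lift; case: eqP => [->|i0] lt_i.
  rewrite rmorph1 (_ : be 0 = 0%MM) ?mpolyX0 //.
  by apply: mnm3P; rewrite mnm3E mnm0E /basis_exp0 ?div0n ?mod0n ?muln0.
case: leqP => [le_ic|lt_ci]; first by rewrite toric_map_label_var ?var_image_basis //; lia.
rewrite rmorphM /= !toric_map_label_var; try lia.
by rewrite !var_image_basis; try lia; rewrite -mpolyXD -basis_exp_top //; lia.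
Qed.

Lemma label_var_homog l : w l \is 1.-homog.
Proof. by rewrite /label_var dhomogX /= mdeg1. Qed.

Lemma basis_lift_homog i : sb i \is (basis_deg d i).-homog.
Proof.
rewrite /basis_lift /basis_deg; case: eqP => _; first exact: dhomog1.
case: leqP => _; first exact: label_var_homog.
exact: (dhomogM (label_var_homog _) (label_var_homog _)).
Qed.

Lemma param_lift_homog q0 q1 q2 : th q0 q1 q2 \is (q0 + q1 + q2).-homog.
Proof.
have X e (f : S) : f \is 1.-homog -> f ^+ e \is e.-homog.
  by move=> /(dhomogMn e); rewrite mul1n.
apply: dhomogM; first by apply: dhomogM; apply/X/label_var_homog.
apply: X; apply: dhomogD; first exact: label_var_homog.
by rewrite mulr_natl rpredMn ?label_var_homog.
Qed.

Lemma param_deg_red i j : (i < N)%N -> (j < N)%N ->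
  (param_deg d (be i + be j) + basis_deg d (red (be i + be j)) = basis_deg d i +
    basis_deg d j)%N.
Proof.
move=> lt_i lt_j; have := toric_wt_residue d3 (dvd_wt_basisD lt_i lt_j).
by rewrite toric_wtD // !toric_wt_basis // -mulnDr => /eqP; rewrite eqn_pmul2l => [/eqP|]; lia.
Qed.

Lemma basis_deg_y l : (l < c)%N -> basis_deg d l.+1 = 1%N.
Proof. by move=> lt_lc; apply: basis_deg1. Qed.

Lemma koszul_mx_homog l : homog_mx (fun i : 'I_N => (basis_deg d i).+1)
    (fun i : 'I_N => basis_deg d i) (Tmx l).
Proof.
rewrite /koszul_mx; case: ifP => lt_lc; last exact: homog_mx0.
have lt_c := gt_codim_lt; apply: homog_mxD.
  move=> i j; rewrite mxE; case: eqP => [->|_]; last by left.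
  by right; exists 1%N => //; exact: label_var_homog.
apply: homog_mxN => i j; rewrite mxE; case: eqP => [->|_]; last by left.
right; exists (param_deg d (be i + be l.+1)); last exact: param_lift_homog.
by rewrite param_deg_red ?basis_deg_y ?addn1 //; lia.
Qed.

End ToricRing.

(** * Annihilator and socle of the toric ring *)

Section ToricModule.
Variables (k : fieldType) (d n : nat) (ix : nat -> 'I_n) (lab : 'I_n -> nat).
Local Notation c := (gt_codim d).
Local Notation S := {mpoly k[n]}.
Local Notation R := {mpoly k[3]}.
Local Notation N := (2 * d)%N.
Hypothesis d3 : (3 <= d)%N.
Hypotheses (lab_lt : forall i, (lab i < c + 3)%N) (ixK : forall i, ix (lab i) = i)
  (labK : forall l, (l < c + 3)%N -> lab (ix l) = l).

Local Notation be := (basis_exp d).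
Local Notation thx := (param_exp d).
Local Notation red := (residue d).
Local Notation gp := (var_image k d).
Local Notation w := (label_var k ix).
Local Notation th := (param_lift k d ix).
Local Notation thm := (param_part k d ix).
Local Notation Tmx := (koszul_mx k d ix).
Local Notation Ymx := (mult_mx k d ix).
Local Notation pi := (@toric_map k d n lab).
Local Notation sb := (basis_lift k d ix).
Local Notation evp := (@toric_eval k d n lab).

Lemma toric_map_param_lift q0 q1 q2 : pi (th q0 q1 q2) = 'X_[thx q0 q1 q2].
Proof.
rewrite -[RHS]/(idfun _); apply: (@basis_eval_param_lift k d n ix d3 _ pi idfun) => l hl /=.
by rewrite toric_map_label_var //; lia.
Qed.

(** The complement of a basis exponent with respect to (2d - 1, d - 1, 1).
    Since the parameters are the powers with exponents (2d, d, 2), the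
    complementary monomials behave like the dual basis of A over P. *)
Definition dual_exp (b : nat) : 'X_{1..3} :=
  mnm3 (2 * d - 1 - basis_exp0 d b) (d - 1 - b %% d) (1 - b %/ d).

Lemma basis_exp_lt b : (b < N)%N -> [/\ basis_exp0 d b < 2 * d, b %% d < d & b %/ d < 2]%N.
Proof.
move=> lt_b; have [? _] := basis_exp0P d3 lt_b; split=> //.
  by rewrite ltn_mod; lia.
by rewrite ltn_divLR //; lia.
Qed.

Lemma dual_exp_shift b j m q0 q1 q2 : (b < N)%N -> (j < N)%N ->
  (be b + m = thx q0 q1 q2 + be j)%MM -> (dual_exp b + thx q0 q1 q2 = dual_exp j + m)%MM.
Proof.
move=> /basis_exp_lt[h1 h2 h3] /basis_exp_lt[g1 g2 g3] E; apply: mnm3P.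
- by move: (congr1 (fun x : 'X_{1..3} => x o0) E); rewrite !(mnmDE, mnm3E); lia.
- by move: (congr1 (fun x : 'X_{1..3} => x o1) E); rewrite !(mnmDE, mnm3E); lia.
- by move: (congr1 (fun x : 'X_{1..3} => x o2) E); rewrite !(mnmDE, mnm3E); lia.
Qed.

Lemma residue_add_inj m b b' : (b < N)%N -> (b' < N)%N ->
  red (be b + m) = red (be b' + m) -> b = b'.
Proof.
move=> lt_b lt_b' E; have [_ _ hb] := basis_exp_lt lt_b; have [_ _ hb'] := basis_exp_lt lt_b'.
have e1 : (b %% d = b' %% d)%N.
  have := congr1 (fun x => x %% d)%N E; rewrite !residue_mod // !mnmDE !mnm3E => /eqP.
  by rewrite eqn_modDr !modn_mod => /eqP.
have e2 : (b %/ d = b' %/ d)%N.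
  have := congr1 (fun x => x %/ d)%N E; rewrite !residue_div // !mnmDE !mnm3E => /eqP.
  by rewrite eqn_modDr !modn_small // => /eqP.
by rewrite (divn_eq b d) (divn_eq b' d) e1 e2.
Qed.

(** Multiplication by y_(l+1) permutes the basis up to parameters. *)
Definition residue_shift (l : nat) (b : 'I_N) : 'I_N :=
    Ordinal (residue_lt d3 (be b + be l.+1)%MM).

Lemma residue_shift_inj l : injective (residue_shift l).
Proof. by move=> b b' [/residue_add_inj E]; apply/val_inj/E. Qed.

Lemma mult_mxE l i j : Ymx l i j = if j == residue_shift l i then thm (be i + be l.+1)%MM else 0.
Proof. by rewrite mxE. Qed.

(** The dual basis is an eigenvector of the transposed multiplications, so
    this row is killed by every T_l once the variables are replaced by their
    images. *)
Lemma dual_covector_koszul l : (l < c)%N ->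
    (\row_(b < N) 'X_[dual_exp b]) *m map_mx pi (Tmx l) = 0.
Proof.
move=> lt_lc; have lt_c := gt_codim_lt d3; rewrite /koszul_mx lt_lc map_mxB mulmxBr.
apply/eqP; rewrite subr_eq0; apply/eqP/rowP => j.
rewrite map_scalar_mx mul_mx_scalar !mxE /=.
have [b Eb] : exists b, residue_shift l b = j.
  by have [g gK Kg] := injF_bij (@residue_shift_inj l); exists (g j).
rewrite (bigD1 b) //= big1 => [|b' nb].
  rewrite addr0 [X in _ = _ * X]mxE mult_mxE Eb eqxx [X in _ = X * _]mxE toric_map_param_lift
    toric_map_label_var ?var_image_basis //; try by lia.
  rewrite -!mpolyXD; congr 'X_[_]; rewrite addmC; apply/esym/dual_exp_shift; try exact: ltn_ord.
  rewrite {1}(residue_decomp d3 (m := (be b + be l.+1)%MM)); last by apply: dvd_wt_basisD =>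
    //; lia.
  by rewrite -Eb.
rewrite [X in _ * X]mxE mult_mxE ifF ?rmorph0 ?mulr0 //.
by apply: contra_neqF nb => /eqP E; apply: (@residue_shift_inj l); rewrite -E Eb.
Qed.

(** If s is a combination of the T_l, applying it to the nonzero row of
    [dual_covector_koszul] shows that its image vanishes.  Conversely,
    replacing each y_l in s by its matrix changes the scalar matrix s by such
    a combination, and the result acts as multiplication by the image of s. *)
Lemma annihilatorP s : pi s = 0 <->
  exists W : nat -> 'M[S]_N, s%:M = \sum_(l < c) Tmx l *m W l.
Proof.
split=> [s0|[W EW]]; last first.
  have N0 : (0 < N)%N by lia.
  have : (\row_(b < N) 'X_[dual_exp b]) *m map_mx pi (s%:M : 'M_N) = 0.
    rewrite EW map_mx_sum mulmx_sumr big1 // => l _.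
    by rewrite map_mxM mulmxA dual_covector_koszul // mul0mx.
  rewrite map_scalar_mx mul_mx_scalar => /rowP/(_ (Ordinal N0)); rewrite !mxE => /eqP.
  rewrite mulf_eq0 => /orP[/eqP //|/eqP/(congr1 (mcoeff (dual_exp 0)))].
  by rewrite mcoeffX eqxx mcoeff0 => /eqP; rewrite oner_eq0.
(* M is s with each y_l replaced by its multiplication matrix. *)
have [M [W [EW EM]]] : exists (M : 'M_N) (W : nat -> 'M_N),
    s%:M - M = \sum_(l < c) Tmx l *m W l /\
    forall v, partial_eval lab 0 (v *m M) = (pi s)%:MP * partial_eval lab 0 v.
  elim/mpoly_var_ind: s {s0} => [a|p q [Mp [Wp [EWp EMp]]] [Mq [Wq [EWq EMq]]]|i p
    [M [W [EW EM]]]].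
  - exists (a%:MP)%:M, (fun _ => 0); rewrite subrr big1 => [|l _]; last by rewrite mulmx0.
    split; first by [].
    by move=> v; rewrite mul_mx_scalar partial_evalZ partial_substC /toric_map comp_mpolyC.
  - exists (Mp + Mq), (fun l => Wp l + Wq l); split.
      rewrite rmorphD /= opprD addrACA EWp EWq -big_split.
      by apply: eq_bigr => l _; rewrite mulmxDr.
    by move=> v; rewrite mulmxDr partial_evalD EMp EMq rmorphD /= mpolyCD mulrDl.
  have [hl|nl] := boolP (0 < lab i <= c)%N.
    pose l0 := (lab i).-1; have El0 : l0.+1 = lab i by rewrite prednK //; case/andP: hl.
    have lt_l0 : (l0 < c)%N by rewrite El0; case/andP: hl.
    exists (Ymx l0 *m M), (fun l => 'X_i *: W l + (if l == l0 then M else 0)); split.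
      rewrite scalar_mxM -[_ *m p%:M](subrK ('X_i *: M)).
      rewrite mul_scalar_mx -scalerBr EW -addrA; under [RHS]eq_bigr => l _ do
        rewrite mulmxDr -scalemxAr.
      rewrite big_split -scaler_sumr /=; congr (_ + _).
      rewrite (bigD1 (Ordinal lt_l0)) //= eqxx big1 ?addr0 => [|l /negPf nl].
        by rewrite /koszul_mx lt_l0 mulmxBl mul_scalar_mx /label_var El0 ixK.
      by rewrite (_ : l == l0 :> nat = false) ?mulmx0.
    move=> v; rewrite mulmxA EM (partial_eval_mult d3 labK _ _ lt_l0) rmorphM /= toric_mapX
      mpolyCM El0.
    by rewrite mulrCA mulrA.
  exists ('X_i *: M), (fun l => 'X_i *: W l); split.
    rewrite scalar_mxM mul_scalar_mx -scalerBr EW scaler_sumr.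
    by apply: eq_bigr => l _; rewrite scalemxAr.
  move=> v; rewrite -scalemxAr partial_evalZ EM partial_substX /sub_var (negPf nl) mulrA.
  by rewrite rmorphM /= toric_mapX mpolyCM.
exists W; rewrite -EW; suff -> : M = 0 by rewrite subr0.
apply: (partial_eval0_ext d3 lab_lt ixK labK) => v.
by rewrite EM s0 mpolyC0 mul0r mulmx0 partial_eval_row0.
Qed.

Lemma param_part_basis b : (b < N)%N -> thm (be b) = 1.
Proof.
move=> /basis_exp_lt[h1 h2 h3].
by rewrite /param_part /param_lift !mnm3E (divn_small h1) (divn_small h2)
  (divn_small h3) !expr0 !mul1r.
Qed.

Lemma residue_basis b : (b < N)%N -> red (be b) = b.
Proof.
move=> lt_b; rewrite -[RHS](residue_param_basis d3 0 0 0 lt_b); congr (residue d _).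
by apply: mnm3P; rewrite mnmDE !mnm3E ?muln0 ?add0n.
Qed.

Lemma const_coef_koszul_mx l : (l < c)%N -> (Tmx l)^0 = - (Ymx l)^0.
Proof.
move=> lt_lc; rewrite /koszul_mx lt_lc map_mxB map_scalar_mx /=.
by rewrite (const_coef_homog (label_var_homog k ix l.+1)) // raddf0 sub0r.
Qed.

(** Modulo the irrelevant ideal the product of a basis monomial with y_(l+1)
    survives only when it is again a basis monomial.  For degree 2 this is
    impossible by degree, and below degree 2 [level_partner] provides a
    surviving product. *)
Lemma socleP (v : 'rV[k]_N) : (forall l, (l < c)%N -> v *m (Tmx l)^0 = 0) <->
  (forall b : 'I_N, (basis_deg d b < 2)%N -> v 0 b = 0).
Proof.
have lt_c := gt_codim_lt d3; split=> [vT b db|v0 l lt_lc].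
  have le_bc : (b <= c)%N by rewrite leqNgt; apply/negP => /basis_deg2; lia.
  have [j lt_j [lt_bj Ebj]] := level_partner d3 le_bc.
  have lt_lc : (j.-1 < c)%N by lia.
  have Ej : j.-1.+1 = j by rewrite prednK //; case/andP: lt_j.
  have := vT _ lt_lc; rewrite const_coef_koszul_mx // mulmxN => /eqP; rewrite oppr_eq0 => /eqP.
  move=> /rowP/(_ (Ordinal lt_bj)); rewrite !mxE (bigD1 b) //=.
  have Eb : residue_shift j.-1 b = Ordinal lt_bj.
    by apply: val_inj; rewrite /= Ej Ebj residue_basis.
  rewrite [X in _ * X]mxE mult_mxE Eb eqxx Ej Ebj param_part_basis // rmorph1 mulr1.
  rewrite big1 ?addr0 // => i /negPf ni; rewrite [X in _ * X]mxE mult_mxE -Eb.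
  by rewrite (inj_eq (@residue_shift_inj _)) eq_sym ni rmorph0 mulr0.
rewrite const_coef_koszul_mx // mulmxN; apply/eqP; rewrite oppr_eq0; apply/eqP/rowP => j.
rewrite !mxE big1 // => i _; have [di|di] := ltnP (basis_deg d i) 2; first by rewrite v0 ?mul0r.
rewrite [X in _ * X]mxE mult_mxE; case: eqP => _; last by rewrite rmorph0 mulr0.
have lt_l : (l.+1 < N)%N by lia.
have := param_deg_red d3 (ltn_ord i) lt_l; rewrite basis_deg_y //.
have : (basis_deg d (red (be i + be l.+1)) <= 2)%N by rewrite /basis_deg; do 2?case: ifP.
move=> h1 h2; rewrite (const_coef_homog (param_lift_homog k d ix _ _ _)) ?mulr0 //.
by rewrite -/(param_deg d (be i + be l.+1)%MM); lia.
Qed.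

(** S/I and the cokernel of the Koszul complex are the same ring A: the maps
    are 1 |-> the basis element 1, and each basis element |-> its preimage in
    S. *)
Lemma koszul_level0 : mutual_comparison (fun _ : 'I_1 => 0%N) (fun b : 'I_N => basis_deg d b)
  (@ideal_row _ _ (fun f => pi f = 0) 1) (koszul_image Tmx c).
Proof.
have N0 : (0 < N)%N by lia.
pose b0 : 'I_N := Ordinal N0.
pose phi : 'rV[S]_N := delta_mx 0 b0; pose psi : 'cV[S]_N := \col_i sb i.
have phipsi : phi *m psi = 1%:M.
  by apply/matrixP => i j; rewrite !ord1 -rowE !mxE.
have sb_hom (i : 'I_N) : sb i \is (basis_deg d i).-homog by apply: basis_lift_homog.
have hphi : homog_mx (fun _ : 'I_1 => 0%N) (fun b : 'I_N => basis_deg d b) phi.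
  move=> i j; rewrite mxE; case: andP => [[_ /eqP ->]|_]; last by left.
  by right; exists 0%N => //; rewrite dhomog1.
have hpsi : homog_mx (fun b : 'I_N => basis_deg d b) (fun _ : 'I_1 => 0%N) psi.
  by move=> i j; right; exists (basis_deg d i); rewrite ?addn0 // mxE.
have evpD u v : evp (u - v) = evp u - evp v.
  rewrite /toric_eval -sumrB; apply: eq_bigr => i _.
  by rewrite !mxE rmorphB mulrBl.
have evpZ a u : evp (a *: u) = pi a * evp u.
  rewrite /toric_eval mulr_sumr; apply: eq_bigr => i _.
  by rewrite !mxE rmorphM mulrA.
have evp_phi : evp phi = 1.
  rewrite /toric_eval (bigD1 b0) //= mxE !eqxx rmorph1 mul1r big1 ?addr0 => [|i /negPf ni].
    rewrite (_ : be 0 = 0%MM) ?mpolyX0 //.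
    by apply: mnm3P; rewrite mnm3E mnm0E /basis_exp0 ?div0n ?mod0n ?muln0.
  by rewrite mxE ni andbF rmorph0 mul0r.
have scal (u : 'M[S]_1) : u *m phi = u 0 0 *: phi.
  by rewrite {1}[u]mx11_scalar mul_scalar_mx.
have evp_psi v : pi ((v *m psi) 0 0) = evp v.
  rewrite mxE rmorph_sum; apply: eq_bigr => i _.
  by rewrite rmorphM [in X in _ * X]mxE /= toric_map_basis_lift.
have K v : koszul_image Tmx c v <-> evp v = 0 := koszul_imageP d3 lab_lt ixK labK v.
exists phi, psi, 0, (1%:M - psi *m phi); split; last first.
- by rewrite phipsi addr0 map_mx1.
- split=> //.
  + by apply: homog_mxD; [exact: homog_mx1 | apply/homog_mxN/(homog_mx_mul hpsi hphi)].
  + by move=> v /K Ev l; rewrite ord1 evp_psi.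
  + move=> v; apply/K; rewrite mulmxBr mulmx1 evpD mulmxA scal evpZ evp_phi.
    by rewrite evp_psi mulr1 subrr.
  + by move=> v _; rewrite mulmxBr mulmx1 mulmxA addrC subrK.
- split=> //.
  + exact: homog_mx0.
  + by move=> v Iv; apply/K; rewrite scal evpZ Iv mul0r.
  + by move=> v l; rewrite mulmx0 mxE rmorph0.
  + by move=> v _; rewrite -mulmxA phipsi mulmx1 mulmx0 addr0.
Qed.

End ToricModule.

(** * The Hilbert function *)

Section ToricGeometry.
Variables (k : fieldType) (d n : nat) (ix : nat -> 'I_n) (lab : 'I_n -> nat).
Local Notation c := (gt_codim d).
Local Notation S := {mpoly k[n]}.
Local Notation R := {mpoly k[3]}.
Local Notation N := (2 * d)%N.
Hypothesis d3 : (3 <= d)%N.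
Hypotheses (lab_lt : forall i, (lab i < c + 3)%N) (ixK : forall i, ix (lab i) = i)
  (labK : forall l, (l < c + 3)%N -> lab (ix l) = l).

Local Notation be := (basis_exp d).
Local Notation thx := (param_exp d).
Local Notation red := (residue d).
Local Notation gp := (var_image k d).
Local Notation w := (label_var k ix).
Local Notation th := (param_lift k d ix).
Local Notation thm := (param_part k d ix).
Local Notation pi := (@toric_map k d n lab).
Local Notation sb := (basis_lift k d ix).
Local Notation wt := (toric_wt d).
Local Notation I := (fun f : S => pi f = 0).

Lemma toric_wt0 : wt 0%MM = 0%N.
Proof. by clear d3; rewrite /toric_wt !mnm0E !muln0. Qed.
HB.instance Definition _ := isMeasure.Build 3 wt toric_wt0 (@toric_wtD d).

Lemma var_image_homog l : (l < c + 3)%N -> gp l \is N.-homog for wt.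
Proof.
have X (m : 'X_{1..3}) : wt m = N -> ('X_[m] : R) \is N.-homog for wt.
  by move=> E; rewrite dhomogX /= E.
move=> lt_l; have lt_c := gt_codim_lt d3; have [->|l0] := posnP l.
  by rewrite var_image0; apply: X; rewrite toric_wt_param //; lia.
have [le_l|lt_cl] := leqP l c.
  rewrite var_image_basis ?l0 //; apply: X; rewrite toric_wt_basis //; last by lia.
  by rewrite basis_deg1 ?l0 // muln1.
have [->|l1] := eqVneq l c.+1; first by rewrite var_image_u; apply: X;
  rewrite toric_wt_param //; lia.
have -> : l = c.+2 by lia.
rewrite var_image_v // mulr_natl rpredB ?rpredMn //; apply: X; rewrite toric_wt_param //; lia.
Qed.

Lemma toric_map_homog t f : f \is t.-homog -> pi f \is (N * t).-homog for wt.
Proof.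
move=> /dhomogP hf; rewrite [f]mpolyE rmorph_sum /= big_seq rpred_sum // => m mf.
rewrite linearZ rpredZ //= mpolyXE_id rmorph_prod.
have -> : (N * t = \sum_i N * m i)%N by rewrite -big_distrr /= -mdegE -(hf m mf).
elim: (index_enum _) => [|i r IH]; first by rewrite !big_nil dhomog1.
rewrite !big_cons; apply: dhomogM => //.
by rewrite rmorphXn /= toric_mapX; apply/dhomogMn/var_image_homog.
Qed.

(** A preimage in S of a monomial of A, by its decomposition into a parameter
    part and a basis monomial. *)
Definition monomial_lift (m : 'X_{1..3}) : S := thm m * sb (red m).

Lemma toric_map_monomial_lift m : (N %| wt m)%N -> pi (monomial_lift m) = 'X_[m].
Proof.
move=> dvd; rewrite /monomial_lift rmorphM /= toric_map_param_lift // toric_map_basis_lift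
  ?residue_lt // -mpolyXD.
by rewrite -residue_decomp.
Qed.

Lemma monomial_lift_homog m t : wt m = (N * t)%N -> monomial_lift m \is t.-homog.
Proof.
move=> E; have dvd : (N %| wt m)%N by rewrite E dvdn_mulr.
have := toric_wt_residue d3 dvd; rewrite E => /eqP; rewrite eqn_pmul2l => [/eqP ->|];
  last by lia.
exact: dhomogM (param_lift_homog _ _ _ _ _ _) (basis_lift_homog _ _ _ _).
Qed.

Lemma toric_map_supp f m : (pi f)@_m != 0 -> (N %| wt m)%N.
Proof.
rewrite -mcoeff_msupp; rewrite [f](pihomog_partitionE (leqnn (msize f))) rmorph_sum /=.
move=> /msupp_sum_le/flatten_mapP[/= i _].
move=> /(dhomog_mf (toric_map_homog (pihomogP _ _ _))) ->.
by rewrite dvdn_mulr.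
Qed.

Definition lattice_monomial (t : nat) (p : nat * nat) : 'X_{1..3} :=
  mnm3 (N * t - (2 * p.1 + d * p.2)) p.1 p.2.

(** The exponents of u and v in the monomials of degree t; the exponent of x
    is then determined. *)
Definition lattice (t : nat) : {set 'I_(d * t).+1 * 'I_(2 * t).+1} :=
  [set p : 'I_(d * t).+1 * 'I_(2 * t).+1 | (2 * p.1 + d * p.2 <= N * t)%N].

(** The monomials of weight 2d t are a basis of the component of degree t of
    the image of [toric_map]. *)
Lemma hilbert_lattice t : hilbert_function I t #|lattice t|.
Proof.
pose pt (i : 'I_#|lattice t|) : nat * nat :=
  let p := enum_val i in (nat_of_ord p.1, nat_of_ord p.2).
have pt_le i : (2 * (pt i).1 + d * (pt i).2 <= N * t)%N.
  by have := enum_valP i; rewrite inE.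
have wt_pt i : wt (lattice_monomial t (pt i)) = (N * t)%N.
  by rewrite /toric_wt !mnm3E -addnA subnK.
have pi_pt i : pi (monomial_lift (lattice_monomial t (pt i))) = 'X_[lattice_monomial t (pt i)].
  by rewrite toric_map_monomial_lift // wt_pt dvdn_mulr.
have pt_inj i j : lattice_monomial t (pt i) = lattice_monomial t (pt j) -> i = j.
  move=> E; apply: enum_val_inj.
  have e1 := congr1 (fun m : 'X_{1..3} => m o1) E; rewrite !mnm3E in e1.
  have e2 := congr1 (fun m : 'X_{1..3} => m o2) E; rewrite !mnm3E in e2.
  move: e1 e2; rewrite /pt; case: (enum_val i) (enum_val j) => [b g] [b' g'] /= e1 e2.
  by congr pair; apply: val_inj.
exists (fun i => monomial_lift (lattice_monomial t (pt i))); split.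
- by move=> i; apply: monomial_lift_homog.
- move=> a; rewrite linear_sum => E i.
  have := congr1 (mcoeff (lattice_monomial t (pt i))) E; rewrite raddf_sum mcoeff0 (bigD1 i) //=.
  rewrite linearZ /= pi_pt mcoeffZ mcoeffX eqxx mulr1 big1 ?addr0 // => j nj.
  rewrite linearZ /= pi_pt mcoeffZ mcoeffX.
  by case: eqP => [/pt_inj Eij|_]; [rewrite Eij eqxx in nj | rewrite mulr0].
move=> f /toric_map_homog hf; exists (fun i => (pi f)@_(lattice_monomial t (pt i))).
apply/mpolyP => m; rewrite rmorphB rmorph_sum /= mcoeffB mcoeff0 [X in _ - X]raddf_sum.
have [mf|mf] := eqVneq (pi f)@_m 0.
  rewrite mf sub0r big1 ?oppr0 // => i _; rewrite /= linearZ /= pi_pt mcoeffZ mcoeffX.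
  by case: eqP => [->|_]; rewrite ?mulr0 // mf mul0r.
have Em : wt m = (N * t)%N by apply: (dhomog_mf hf); rewrite mcoeff_msupp.
have [i Ei] : exists i, lattice_monomial t (pt i) = m.
  move: Em; rewrite /toric_wt => Em.
  have lt1 : (m o1 < (d * t).+1)%N by rewrite ltnS; nia.
  have lt2 : (m o2 < (2 * t).+1)%N by rewrite ltnS; nia.
  have inl : (Ordinal lt1, Ordinal lt2) \in lattice t by rewrite inE /=; lia.
  exists (enum_rank_in inl (Ordinal lt1, Ordinal lt2)).
  rewrite /pt enum_rankK_in // /lattice_monomial; apply: mnm3P; rewrite mnm3E //=; lia.
rewrite (bigD1 i) //= linearZ /= pi_pt mcoeffZ mcoeffX Ei eqxx mulr1 big1.
  by rewrite addr0 subrr.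
move=> j nj; rewrite linearZ /= pi_pt mcoeffZ mcoeffX -Ei.
by case: eqP => [/pt_inj Eij|_]; [rewrite Eij eqxx in nj | rewrite mulr0].
Qed.

(** For fixed exponent g of v there are floor((2d t - d g) / 2) + 1 choices;
    reversing the sum over g gives the closed form by induction on t. *)
Lemma card_lattice t : #|lattice t| = (d * t ^ 2 + (d./2 + 2) * t + 1)%N.
Proof.
have row (g : 'I_(2 * t).+1) :
   (\sum_(b < (d * t).+1 | 2 * b + d * g <= N * t) 1 = (d * (2 * t - g))./2 + 1)%N.
  set K := ((d * (2 * t - g))./2 + 1)%N.
  have leK : (K <= (d * t).+1)%N.
    have : (d * (2 * t - g) <= 2 * (d * t))%N by rewrite mulnCA leq_mul2l; lia.
    by rewrite /K; move: (d * (2 * t - g))%N => x; lia.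
  rewrite -[RHS]muln1 -[K in RHS]card_ord -sum_nat_const (big_ord_widen _ (fun=> 1%N) leK).
  apply: eq_bigl => b; rewrite /K addn1 ltnS -(leq_double) -!muln2.
  have := ltn_ord g; have := odd_double_half (d * (2 * t - g)); rewrite -muln2 mulnBr.
  have : (d * g <= d * (2 * t))%N by rewrite leq_mul2l -ltnS ltn_ord orbT.
  case: odd; lia.
have -> : #|lattice t| = (\sum_(g < (2 * t).+1) ((d * g)./2 + 1))%N.
  rewrite -sum1_card (eq_bigl (fun p : 'I_(d * t).+1 * 'I_(2 * t).+1 =>
     (2 * p.1 + d * p.2 <= N * t)%N)); last by move=> p; rewrite inE.
  rewrite -(pair_big_dep xpredT (fun (b : 'I_(d * t).+1) (g : 'I_(2 * t).+1) =>
     (2 * b + d * g <= N * t)%N) (fun _ _ => 1%N)) /=.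
  rewrite (exchange_big_dep xpredT) //= [RHS](reindex_inj rev_ord_inj) /=.
  by apply: eq_bigr => g _; rewrite row subSS.
have half2 x : ((d * (2 * x))./2 = d * x)%N by rewrite mulnCA mul2n doubleK.
have half1 x : ((d * (2 * x).+1)./2 = d * x + d./2)%N.
  by rewrite mulnS mulnCA mul2n addnC halfD /= odd_double doubleK.
rewrite -(big_mkord xpredT (fun g => (d * g)./2 + 1)%N).
elim: t {row} => [|t IH]; first by rewrite big_nat1 !muln0.
have -> : ((2 * t.+1).+1 = (2 * t).+3)%N by rewrite mulnS.
rewrite big_nat_recr // big_nat_recr // IH half1.
have -> : ((2 * t).+2 = 2 * t.+1)%N by rewrite mulnS.
by rewrite half2 /= -!mulnn; nia.
Qed.
End ToricGeometry.

(** * Dimension and depth of the toric ring *)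

Section ToricDimension.
Variables (k : fieldType) (d n : nat) (ix : nat -> 'I_n) (lab : 'I_n -> nat).
Local Notation c := (gt_codim d).
Local Notation S := {mpoly k[n]}.
Local Notation R := {mpoly k[3]}.
Local Notation N := (2 * d)%N.
Hypothesis d3 : (3 <= d)%N.
Hypotheses (lab_lt : forall i, (lab i < c + 3)%N) (ixK : forall i, ix (lab i) = i)
  (labK : forall l, (l < c + 3)%N -> lab (ix l) = l).
Local Notation pi := (@toric_map k d n lab).
Local Notation I := (fun f : S => pi f = 0).
Local Notation wt := (toric_wt d).

Definition hilbert_poly : {poly rat} :=
  d%:R *: 'X^2 + ((d./2 + 2)%:R *: 'X + 1).

Lemma hilbert_polyE t : hilbert_poly.[t%:R] = (d * t ^ 2 + (d./2 + 2) * t + 1)%:R.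
Proof.
rewrite /hilbert_poly; move: (d./2 + 2)%N => h.
by rewrite -mulnn !hornerE !natrD !natrM /= ?mulrA ?addrA.
Qed.

Lemma size_hilbert_poly : size hilbert_poly = 3%N /\ lead_coef hilbert_poly = d%:R.
Proof.
have d0 : d%:R != 0 :> rat by rewrite Num.Theory.pnatr_eq0; lia.
have sz : size (d%:R *: 'X^2 : {poly rat}) = 3%N by rewrite size_scale // size_polyXn.
have lt : (size ((d./2 + 2)%:R *: 'X + 1 : {poly rat})%R < size (d%:R *: 'X^2 : {poly rat})%R)%N.
  rewrite sz ltnS; apply: leq_trans (size_polyD _ _) _.
  rewrite geq_max size_poly1 andbT; apply: leq_trans (size_scale_leq _ _) _.
  by rewrite size_polyX.
rewrite /hilbert_poly size_polyDl // lead_coefDl //; split=> //.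
by rewrite lead_coefZ lead_coefXn mulr1.
Qed.

Lemma toric_hilbert_polynomial : hilbert_polynomial I hilbert_poly.
Proof.
exists 0%N => t _; exists #|lattice d t|; first exact: hilbert_lattice d3 lab_lt labK t.
by rewrite hilbert_polyE card_lattice.
Qed.

Definition param_power (j : nat) : nat := nth 0%N [:: N; d; 2] j.
Definition param (j : nat) : S := param_lift k d ix (j == 0) (j == 1) (j == 2).
Definition param_monomial (j : 'I_3) : 'X_{1..3} := (U_(j) *+ param_power j)%MM.

Lemma toric_map_param (j : 'I_3) : pi (param j) = 'X_[param_monomial j].
Proof.
rewrite /param toric_map_param_lift //; congr 'X_[_]; apply/mnmP => i.
rewrite mnmE mulmnE mnm1E.
by case: i j => [[|[|[|i]]] lti] [[|[|[|j]]] ltj] //=; rewrite ?(muln0, muln1, mul1n).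
Qed.

Lemma param_homog j : (j < 3)%N -> param j \is 1.-homog.
Proof.
by case: j => [|[|[|j]]] // _; apply: (param_lift_homog k d ix).
Qed.

(** The composite with [toric_map] has a prime kernel, as its values lie in
    a domain; these kernels are the chain of primes. *)
Definition kill_vars (j : nat) (p : R) : R :=
  p \mPo [tuple if (i < j)%N then 0 else 'X_i | i < 3].
HB.instance Definition _ j := GRing.RMorphism.copy (kill_vars j) (kill_vars j).

Lemma kill_varsX j (i : 'I_3) : kill_vars j 'X_i = if (i < j)%N then 0 else 'X_i.
Proof. by rewrite /kill_vars comp_mpolyXU -tnth_nth tnth_mktuple. Qed.

Lemma kill_vars_param j (i : 'I_3) : (kill_vars j 'X_[param_monomial i] == 0) = (i < j)%N.
Proof.
have i0 : (0 < param_power i)%N by case: i => [[|[|[|i]]] lti] //=; rewrite /param_power /=; lia.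
rewrite /param_monomial -mpolyXn rmorphXn /= kill_varsX; case: ifP => _.
  by rewrite expr0n gtn_eqF ?eqxx.
by rewrite expf_eq0 i0 /= -msize_poly_eq0 msizeX.
Qed.

Lemma kill_vars_mono j j' p : (j <= j')%N -> kill_vars j p = 0 -> kill_vars j' p = 0.
Proof.
move=> le_jj' E; have -> : kill_vars j' p = kill_vars j' (kill_vars j p);
  last by rewrite E rmorph0.
elim/mpoly_var_ind: p {E} => [a|p q Ep Eq|i p Ep].
- by rewrite /kill_vars !comp_mpolyC.
- by rewrite !rmorphD /= Ep Eq.
rewrite !rmorphM /= Ep !kill_varsX; congr (_ * _).
case: (ltnP i j) => [lt_ij|le_ji]; last by rewrite kill_varsX.
by rewrite (leq_trans lt_ij le_jj') rmorph0.
Qed.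

Lemma toric_prime_chain : exists P, prime_chain I 3 P.
Proof.
exists (fun j : nat => [pred s | kill_vars j (pi s) == 0] : {pred S}); split=> [j _|j lt_j3].
  split; first split.
  - by rewrite inE !rmorph0.
  - by rewrite inE !rmorph1 oner_eq0.
  - move=> a u v; rewrite !inE => /eqP Eu /eqP Ev.
    by rewrite !rmorphD !rmorphM /= Eu Ev mulr0 addr0.
  - by move=> u v; rewrite !inE !rmorphM /= mulf_eq0.
  - by move=> f If; rewrite inE If rmorph0.
split.
  by move=> s; rewrite !inE => /eqP/(kill_vars_mono (leqnSn j)) ->.
pose j0 := Ordinal lt_j3; exists (param j0).
  by rewrite inE toric_map_param kill_vars_param.
by rewrite inE toric_map_param kill_vars_param ltnn.
Qed.

Lemma toric_krull_dim : krull_dim I 3.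
Proof.
by split; [exact: toric_prime_chain | move=> s P; apply: (prime_chain_le (pi := pi))].
Qed.

Definition params : seq S := [:: param 0; param 1; param 2].

Let I0 : I 0. Proof. exact: rmorph0. Qed.
Let ID a f g : I f -> I g -> I (a * f + g).
Proof. by move=> If Ig; rewrite /= in If Ig *; rewrite rmorphD rmorphM /= If Ig mulr0 addr0. Qed.

Lemma nth_params j : (j < 3)%N -> params`_j = param j.
Proof. by case: j => [|[|[|j]]]. Qed.

(** The images of the parameters are pure powers, so that membership in the
    ideal generated by the first i of them can be tested on monomials. *)
Lemma adjoin_params i h : (i <= 3)%N -> ideal_adjoin I (take i params) h <->
  forall m, (pi h)@_m != 0 -> exists2 j : 'I_3, (j < i)%N & (param_power j <= m j)%N.
Proof.
move=> le_i3; have sz : size (take i params) = i by rewrite size_takel.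
have pmon_le (j : 'I_3) m : (param_monomial j <= m)%MM = (param_power j <= m j)%N.
  apply/mnm_lepP/idP => [/(_ j)|le_j l]; first by rewrite mulmnE mnm1E eqxx mul1n.
  by rewrite mulmnE mnm1E; case: eqP => [<-|_]; rewrite ?mul1n.
split=> [Ah m|H].
  pose J f := forall m, (pi f)@_m != 0 -> exists2 j : 'I_3, (j < i)%N & (param_power j <= m j)%N.
  move: m; apply: (ideal_adjoin_ideal (J := J) _ _ _ _ Ah).
  - move=> a f g Jf Jg m; rewrite rmorphD rmorphM /= mcoeffD.
    have [Eg|/Jg //] := eqVneq (pi g)@_m 0; rewrite Eg addr0 -mcoeff_msupp.
    move=> /msuppM_le/allpairsP[[m1 m2] /= [_ m2f ->]].
    rewrite mcoeff_msupp in m2f; have [j lt_j le_j] := Jf _ m2f; exists j => //.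
    by rewrite mnmDE (leq_trans le_j) // leq_addl.
  - by move=> m; rewrite rmorph0 mcoeff0 eqxx.
  - by move=> g Ig m; rewrite Ig mcoeff0 eqxx.
  - move=> j; rewrite sz => lt_ji m; rewrite nth_take // nth_params ?(leq_trans lt_ji) //.
    pose j0 : 'I_3 := Ordinal (leq_trans lt_ji le_i3); rewrite (toric_map_param j0) mcoeffX.
    case: (param_monomial j0 =P m) => [<- _|_]; last by rewrite eqxx.
    by exists j0; rewrite // mulmnE mnm1E eqxx mul1n.
have [s Es As] : exists2 s, pi s = pi h & ideal_adjoin I (take i params) s.
  rewrite [pi h]mpolyE big_seq; elim/big_rec: _ => [|m p mh [s <- As]].
    by exists 0; [exact: rmorph0 | apply: ideal_adjoin_sub].
  rewrite mcoeff_msupp in mh; have [j lt_j le_j] := H m mh.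
  rewrite -pmon_le in le_j.
  exists (((pi h)@_m *: monomial_lift k d ix (m - param_monomial j)%MM) * param j + s).
    rewrite rmorphD rmorphM /= linearZ /= toric_map_monomial_lift // ?toric_map_param
      -?scalerAl -?mpolyXD ?submK //.
    have : (N %| wt (m - param_monomial j + param_monomial j))%N by rewrite submK //
      (toric_map_supp d3 lab_lt mh).
    rewrite toric_wtD // dvdn_addl //.
    case: j {lt_j le_j} => [[|[|[|j]]] ltj] //; rewrite /toric_wt !mulmnE !mnm1E /param_power /=;
      apply/dvdnP; [exists 1%N | exists 1%N | exists 1%N]; lia.
  apply: ideal_adjoin_lin => //.
  have lt' : (j < size (take i params))%N by rewrite sz.
  by have := ideal_adjoin_mem I0 lt'; rewrite nth_take // nth_params.
have -> : h = 1 * s + (h - s) by rewrite mul1r addrC subrK.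
apply: ideal_adjoin_lin => //; apply: ideal_adjoin_sub => //.
by rewrite rmorphB /= Es subrr.
Qed.

(** By the monomial criterion, multiplying by the i-th parameter does not
    change the exponents of the previous variables. *)
Lemma toric_regular_seq : regular_seq I params.
Proof.
split.
- move=> f; rewrite !inE => /or3P[] /eqP ->; exact: const_coef_homog (param_homog _) _.
- move=> i h lt_i3; rewrite !(adjoin_params _ (ltnW lt_i3)) nth_params // => H m hm.
  pose i0 : 'I_3 := Ordinal lt_i3.
  have [|j lt_ji] := H (param_monomial i0 + m)%MM.
    by rewrite rmorphM /= (toric_map_param i0) mulrC mcoeffMX.
  rewrite mnmDE mulmnE mnm1E (_ : i0 == j = false) ?mul0n ?add0n => [le_j|]; first by exists j.
  by apply/negbTE; apply: contraTneq lt_ji => <-; rewrite ltnn.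
- rewrite -[params]/(take 3 params) adjoin_params // rmorph1.
  move=> /(_ 0%MM); rewrite mcoeff1 eqxx oner_eq0 => /(_ isT) [j _].
  by rewrite mnm0E leqNgt; case: j => [[|[|[|j]]] ltj] //; rewrite /param_power /=; lia.
Qed.

Lemma toric_depth : has_depth I 3.
Proof.
split; first by exists params; [exact: toric_regular_seq|].
by move=> fs; apply: (regular_seq_le (pi := pi)).
Qed.

End ToricDimension.

(** * Polynomials over an algebraically closed field *)

Section Vanishing.
Variable k : closedFieldType.

(** If p vanishes everywhere, p + 1 has no root, so it is constant. *)
Lemma poly_vanish (p : {poly k}) : (forall z, p.[z] = 0) -> p = 0.
Proof.
move=> p0; have [/closed_rootP[z]|sz] := boolP (size (p + 1) != 1%N).
  by rewrite /root !hornerE p0 add0r oner_eq0.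
have /size_poly1P[a a0 E] : size (p + 1) == 1%N by rewrite -[_ == _]negbK.
have Ep : p = (a - 1)%:P by rewrite polyCB -E addrK.
by have := p0 0; rewrite Ep hornerC => ->.
Qed.

(** Kronecker substitution: with M above the degree, the powers z, z^M,
    z^(M^2) separate the monomials and reduce the claim to one variable. *)
Lemma mpoly3_vanish (g : {mpoly k[3]}) : (forall v, g.@[v] = 0) -> g = 0.
Proof.
move=> g0; pose M := msize g.
pose kr (m : 'X_{1..3}) : nat := (m o0 + M * (m o1 + M * m o2))%N.
have kr_inj m m' : m \in msupp g -> m' \in msupp g -> kr m = kr m' -> m = m'.
  have lt_M m1 i : m1 \in msupp g -> (m1 i < M)%N.
    move=> /msize_mdeg_lt; apply: leq_ltn_trans; rewrite mdegE (bigD1 i) //=; exact: leq_addr.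
  move=> mg mg' E; have M0 : (0 < M)%N by apply: leq_ltn_trans (lt_M _ o0 mg).
  have E0 := congr1 (fun x => x %% M)%N E; have E1 := congr1 (fun x => x %/ M)%N E.
  move: E0 E1; rewrite /kr !(addnC (_ o0)) !(mulnC M (_ + _)%N) !modnMDl !divnMDl //.
  rewrite !modn_small ?lt_M // !divn_small ?lt_M // !addn0 => E0 E1.
  have F0 := congr1 (fun x => x %% M)%N E1; have F1 := congr1 (fun x => x %/ M)%N E1.
  move: F0 F1; rewrite !(addnC (_ o1)) !(mulnC M) !modnMDl !divnMDl //.
  rewrite !modn_small ?lt_M // !divn_small ?lt_M // !addn0 => F0 F1.
  exact: mnm3P.
pose P : {poly k} := \sum_(m <- msupp g) g@_m *: 'X^(kr m).
have P0 : P = 0.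
  apply: poly_vanish => z; rewrite -[RHS](g0 (fun i => z ^+ (M ^ i))) mevalE horner_sum.
  apply: eq_bigr => m _; rewrite hornerZ hornerXn; congr (_ * _).
  rewrite !big_ord_recl big_ord0 mulr1 -!exprM -!exprD; congr (_ ^+ _).
  have e2 : lift ord0 (lift ord0 ord0) = o2 by apply: val_inj.
  have e1 : lift ord0 ord0 = o1 by apply: val_inj.
  have e0 : ord0 = o0 by apply: val_inj.
  by rewrite /kr e2 e1 e0 (expn0 M : M ^ o0 = 1)%N (expn1 M : M ^ o1 = M)%N
    -(mulnn M : _ = M ^ o2)%N mul1n mulnDr mulnA.
apply/mpolyP => m0; rewrite mcoeff0; apply/eqP; apply: contraT; rewrite -mcoeff_msupp => m0g.
have := congr1 (fun p : {poly k} => p`_(kr m0)) P0.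
rewrite coef0 coef_sum (big_rem m0) //= big_seq big1 => [|m].
  rewrite addr0 coefZ coefXn eqxx mulr1 => /eqP; by rewrite -[_ == 0]negbK -mcoeff_msupp m0g.
move=> mrem; rewrite coefZ coefXn.
case: eqP => [E|_]; last by rewrite mulr0.
have mg := mem_rem mrem; have Em := kr_inj _ _ m0g mg E.
by move: mrem; rewrite mem_rem_uniq ?msupp_uniq // inE Em eqxx.
Qed.

(** The numbers p1^d and p2^d must be the roots of t^2 - v t + u^d; a d-th
    root of the first determines p2 = u / p1, unless it is zero. *)
Lemma sum_prod_power (d : nat) (u v : k) : (0 < d)%N ->
  exists p1 p2, p1 * p2 = u /\ p1 ^+ d + p2 ^+ d = v.
Proof.
move=> d0; have root1 e (x : k) : (0 < e)%N -> exists y, y ^+ e = x.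
  move=> e0; have [y Ey] := @GRing.solve_monicpoly k e (fun i => if i == 0%N then x else 0) e0.
  exists y; rewrite Ey (bigD1 (Ordinal e0)) //= expr0 mulr1 big1 ?addr0 // => i ni.
  rewrite ifF ?mul0r //; apply: contraNF ni => /eqP E; exact/eqP/val_inj.
have [t Et] := @GRing.solve_monicpoly k 2 (fun i => if i == 0%N then - u ^+ d else v) isT.
rewrite !big_ord_recl big_ord0 /= expr0 mulr1 expr1 addr0 in Et.
have tt : t * (v - t) = u ^+ d by rewrite mulrBr
  -expr2 Et mulrC opprD opprK addrA addrAC subrr add0r.
have [p1 Ep1] := root1 d t d0.
have [t0|t0] := eqVneq t 0.
  have u0 : u = 0.
    by apply/eqP; move/eqP: tt; rewrite t0 mul0r eq_sym expf_eq0 d0.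
  have [p2 Ep2] := root1 d v d0; exists 0, p2; rewrite mul0r u0; split=> //.
  by rewrite expr0n gtn_eqF // add0r.
have p10 : p1 != 0 by apply: contra_neq t0 => p10; rewrite -Ep1 p10 expr0n gtn_eqF.
exists p1, (u / p1); split; first by rewrite mulrCA mulfV ?mulr1.
by rewrite expr_div_n Ep1 -tt mulrAC mulfV // mul1r addrC subrK.
Qed.

End Vanishing.

(** * Invariants defining the surface *)

Section GammaAction.
Variables (k : fieldType) (d : nat) (e : k).
Hypotheses (d3 : (3 <= d)%N) (prim_e : d.-primitive_root e).
Local Notation c := (gt_codim d).
Local Notation R := {mpoly k[3]}.

Lemma monom3E a b g : monom3 k a b g = 'X_[mnm3 a b g].
Proof.
rewrite /monom3 !mpolyXn -!mpolyXD; congr 'X_[_].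
have i0 : inord 0 = o0 :> 'I_3 by apply: val_inj; rewrite /= inordK.
have i1 : inord 1 = o1 :> 'I_3 by apply: val_inj; rewrite /= inordK.
have i2 : inord 2 = o2 :> 'I_3 by apply: val_inj; rewrite /= inordK.
by clear -i0 i1 i2; rewrite i0 i1 i2; apply: mnm3P; rewrite !(mnmDE, mulmnE, mnm1E, mnm3E) /=;
  lia.
Qed.

Lemma diag_mx_exp (r : 'rV[k]_3) m : diag_mx r ^+ m = diag_mx (\row_j (r 0 j ^+ m)).
Proof.
elim: m => [|m IH].
  by rewrite expr0; apply/matrixP => i j; rewrite !mxE expr0.
rewrite exprS IH [LHS]mulmx_diag; congr diag_mx; apply/rowP => j.
by rewrite !mxE exprS.
Qed.

Lemma lin_act_diag (r : 'rV[k]_3) m :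
  lin_act (diag_mx r) 'X_[m] = (\prod_i r 0 i ^+ m i) *: 'X_[m] :> R.
Proof.
rewrite /lin_act comp_mpolyX (eq_bigr (fun i => (r 0 i ^+ m i) *: 'X_i ^+ m i)).
  rewrite [in RHS]mpolyXE_id; elim/big_rec3: _ => [|i x y z _ ->]; first by rewrite scale1r.
  by rewrite -scalerAl -scalerAr scalerA.
move=> i _; rewrite tnth_mktuple (bigD1 i) //= mxE eqxx big1 ?addr0 => [|j nj].
  by rewrite exprZn.
by rewrite mxE eq_sym (negPf nj) scale0r.
Qed.

Lemma gamma_factor m c0 c1 c2 :
  \prod_i (\row_(i < 3) ([:: 1; e; e ^+ d.-1]`_i ^+ m)) 0 i ^+ (mnm3 c0 c1 c2) i =
  (e ^+ (c1 + d.-1 * c2)) ^+ m.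
Proof.
rewrite !big_ord_recl big_ord0 !mxE !mnmE /= expr1n expr1n mul1r mulr1.
by clear d3 prim_e; rewrite -!exprM -exprD; congr (_ ^+ _); lia.
Qed.

(** The generator of the group acts on the monomial by e^(c1 - c2). *)
Lemma gamma_invariantP c0 c1 c2 :
  Gamma_invariant d e (monom3 k c0 c1 c2) <-> (c1 = c2 %[mod d])%N.
Proof.
have dvdE : (e ^+ (c1 + d.-1 * c2) == 1) = (c1 == c2 %[mod d])%N.
  rewrite -(prim_order_dvd prim_e) -(eqn_modDr (d.-1 * c2)).
  have -> : (c2 + d.-1 * c2 = d * c2)%N by rewrite -mulSn prednK //; lia.
  by rewrite modnMr.
have actE m : lin_act (diag_mx (\row_(i < 3) [:: 1; e; e ^+ d.-1]`_i) ^+ m)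
    (monom3 k c0 c1 c2) = ((e ^+ (c1 + d.-1 * c2)) ^+ m) *: monom3 k c0 c1 c2.
  rewrite diag_mx_exp monom3E lin_act_diag -(gamma_factor m c0); congr (_ *: _).
  by apply: eq_bigr => i _; rewrite !mxE.
split=> [inv|/eqP E g [m ->]]; last first.
  by move: E; rewrite -dvdE actE => /eqP ->; rewrite expr1n scale1r.
have := inv (diag_mx (\row_(i < 3) [:: 1; e; e ^+ d.-1]`_i)).
have := actE 1%N; rewrite !expr1 => -> /(_ (ex_intro _ 1%N _)).
rewrite expr1 => /(_ erefl)/(congr1 (mcoeff (mnm3 c0 c1 c2))).
by rewrite monom3E mcoeffZ mcoeffX eqxx mulr1 => /eqP; rewrite dvdE => /eqP.
Qed.

End GammaAction.

Section Generators.
Variables (k : fieldType) (d : nat).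
Hypothesis d3 : (3 <= d)%N.
Local Notation c := (gt_codim d).
Local Notation R := {mpoly k[3]}.

(** The larger exponent of the l-th generator.  Label 0 is x_0^(2d); for
    positive l at most c it is l itself, as for the basis element y_l, and two
    labels remain for u^d and for x_1^(2d) + x_2^(2d). *)
Definition gen_exp1 (l : nat) : nat :=
  (if l <= c then l else if l == c.+1 then d else 2 * d)%N.
Definition gen_exp2 (l : nat) : nat :=
  (if l <= c then l %% d else if l == c.+1 then d else 0)%N.
Definition gen_poly (l : nat) : R :=
  let c0 := (2 * d - (gen_exp1 l + gen_exp2 l))%N in
  if gen_exp1 l == gen_exp2 l then 'X_[mnm3 c0 (gen_exp1 l) (gen_exp2 l)]
  else 'X_[mnm3 c0 (gen_exp1 l) (gen_exp2 l)] + 'X_[mnm3 c0 (gen_exp2 l) (gen_exp1 l)].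

Lemma gen_expP l : (l < c + 3)%N ->
    [/\ (gen_exp2 l <= gen_exp1 l)%N, (gen_exp1 l + gen_exp2 l <= 2 * d)%N
  & (gen_exp1 l = gen_exp2 l %[mod d])%N].
Proof.
have [h1 h2] := half_bound d3; have Ec : c = (d + d./2)%N by [].
rewrite /gen_exp1 /gen_exp2 => lt_l; case: (leqP l c) => le_lc.
  have lt_l2 : (l < 2 * d)%N by lia.
  rewrite modn_mod; split=> //; first exact: leq_mod.
  by case: (divmod_small d3 lt_l2) => [[-> [_ ?]]|[-> [_ ?]]]; lia.
case: eqP => _; first by split=> //; lia.
by split; rewrite ?mod0n ?modnMl //; lia.
Qed.

Lemma gen_exp_inj l l' : (l < c + 3)%N -> (l' < c + 3)%N ->
  gen_exp1 l = gen_exp1 l' -> gen_exp2 l = gen_exp2 l' -> l = l'.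
Proof.
have [h1 h2] := half_bound d3; have Ec : c = (d + d./2)%N by [].
have Ed : (d %% d = 0)%N by rewrite modnn.
move=> lt_l lt_l'; rewrite /gen_exp1 /gen_exp2.
case: (leqP l c) => ?; case: (leqP l' c) => ?; try case: eqP => ?; try case: eqP => ?;
  move=> E1 E2; try lia.
Qed.

Lemma gen_poly_inj l l' : (l < c + 3)%N -> (l' < c + 3)%N ->
  gen_poly l = gen_poly l' -> l = l'.
Proof.
move=> lt_l lt_l' E; have [le1 le2 _] := gen_expP lt_l; have [le1' le2' _] := gen_expP lt_l'.
have mnm3I a b g a' b' g' : mnm3 a b g = mnm3 a' b' g' -> b = b' /\ g = g'.
  move=> E3; have e1 := congr1 (fun m : 'X_{1..3} => m o1) E3.
  by have e2 := congr1 (fun m : 'X_{1..3} => m o2) E3; move: e1 e2; rewrite !mnm3E.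
pose m := mnm3 (2 * d - (gen_exp1 l + gen_exp2 l)) (gen_exp1 l) (gen_exp2 l).
have : (gen_poly l')@_m != 0.
  rewrite -E /gen_poly; case: (gen_exp1 l =P gen_exp2 l) => [_|ne];
    first by rewrite mcoeffX eqxx oner_eq0.
  rewrite mcoeffD !mcoeffX eqxx; case: (mnm3 _ _ _ =P m) => [/mnm3I [E1 _]|_]; first by case: ne.
  by rewrite addr0 oner_eq0.
rewrite /gen_poly; case: (gen_exp1 l' =P gen_exp2 l') => [_|ne].
  rewrite mcoeffX; case: (mnm3 _ _ _ =P m) => [/mnm3I [e1 e2]|_]; last by rewrite eqxx.
  by move=> _; apply: gen_exp_inj.
rewrite mcoeffD !mcoeffX; case: (mnm3 _ _ _ =P m) => [/mnm3I [e1 e2] _|_];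
  first exact: gen_exp_inj.
rewrite add0r; case: (mnm3 _ _ _ =P m) => [/mnm3I [e1 e2] _|_]; last by rewrite eqxx.
by case: ne; lia.
Qed.

(** c1 and c2 are congruent with sum at most 2d.  So they differ by 0, d or 2d,
    and apart from (d, d) and (2d, 0) the larger one is at most d + d/2 and
    determines the other. *)
Lemma gen_of_pair c1 c2 : (c2 <= c1)%N -> (c1 + c2 <= 2 * d)%N -> (c1 = c2 %[mod d])%N ->
  exists2 l, (l < c + 3)%N & gen_exp1 l = c1 /\ gen_exp2 l = c2.
Proof.
have [h1 h2] := half_bound d3; have Ec : c = (d + d./2)%N by [].
move=> le21 le_d /eqP; rewrite eqn_mod_dvd // => /dvdnP[q Eq].
have [/eqP E1|ne1] := boolP ((c1 == d) && (c2 == d)).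
  exists c.+1; first lia; rewrite /gen_exp1 /gen_exp2 ltnn eqxx; lia.
have [/eqP E2|ne2] := boolP (c1 == 2 * d)%N.
  exists c.+2; first lia; rewrite /gen_exp1 /gen_exp2.
  have -> : (c.+2 <= c)%N = false by lia.
  have -> : (c.+2 == c.+1)%N = false by lia.
  lia.
have le_c : (c1 <= c)%N by case: q Eq => [|[|[|q]]] Eq; nia.
exists c1; first lia; rewrite /gen_exp1 /gen_exp2 le_c; split=> //.
have lt_c1 : (c1 < 2 * d)%N by lia.
case: (divmod_small d3 lt_c1) => [[-> [_ ?]]|[-> [_ ?]]]; case: q Eq => [|[|[|q]]] Eq; nia.
Qed.

Lemma GT_generatorP (e : k) (prim_e : d.-primitive_root e) f :
  GT_generator d e f <-> exists2 l, (l < c + 3)%N & f = gen_poly l.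
Proof.
split=> [[[i le_id ->]|[c0 [c1 [c2 [Es ne inv ->]]]]]|[l lt_l ->]].
- have [|l lt_l [E1 E2]] := @gen_of_pair i i (leqnn i) _ erefl; first by lia.
  exists l => //; rewrite monom3E /gen_poly E1 E2 eqxx.
  by congr 'X_[mnm3 _ _ _]; lia.
- move/(gamma_invariantP d3 prim_e): inv => inv; rewrite !monom3E.
  have [lt12|lt21|E12] := ltngtP c1 c2; last by rewrite E12 eqxx in ne.
    have [|l lt_l [E1 E2]] := @gen_of_pair c2 c1 (ltnW lt12) _ (esym inv); first by lia.
    exists l => //; rewrite /gen_poly E1 E2 eq_sym (negPf ne) addrC.
    by congr ('X_[mnm3 _ _ _] + 'X_[mnm3 _ _ _]); lia.
  have [|l lt_l [E1 E2]] := @gen_of_pair c1 c2 (ltnW lt21) _ inv; first by lia.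
  exists l => //; rewrite /gen_poly E1 E2 (negPf ne).
  by congr ('X_[mnm3 _ _ _] + 'X_[mnm3 _ _ _]); lia.
have [le1 le2 Em] := gen_expP lt_l; rewrite /gen_poly.
case: (gen_exp1 l =P gen_exp2 l) => [E|/eqP ne]; [left|right].
  exists (gen_exp1 l); first by lia.
  by rewrite monom3E -E; congr 'X_[mnm3 _ _ _]; lia.
exists (2 * d - (gen_exp1 l + gen_exp2 l))%N, (gen_exp1 l), (gen_exp2 l); rewrite !monom3E;
  split=> //.
  by rewrite -addnA subnK.
by rewrite -monom3E; apply/(gamma_invariantP d3 prim_e).
Qed.

(** The point (x, u, v) of the quotient under a point of k^3. *)
Definition invariant_point (p : 'I_3 -> k) (i : 'I_3) : k :=
  [:: p o0; p o1 * p o2; p o1 ^+ d + p o2 ^+ d]`_i.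

Lemma meval_mnm3 (v : 'I_3 -> k) a b g :
  'X_[mnm3 a b g].@[v] = v o0 ^+ a * v o1 ^+ b * v o2 ^+ g.
Proof.
rewrite mevalX !big_ord_recl big_ord0 !mnmE /= mulr1 mulrA.
have e2 : lift ord0 (lift ord0 ord0) = o2 by apply: val_inj.
have e1 : lift ord0 ord0 = o1 by apply: val_inj.
have e0 : ord0 = o0 by apply: val_inj.
by rewrite e2 e1 e0.
Qed.

(** The generators are written in the invariants: for l at least d, up to the
    codimension, x_1^l x_2^(l-d) + x_1^(l-d) x_2^l = u^(l-d) v, up to the
    power of x. *)
Lemma gen_poly_eval l p : (l < c + 3)%N ->
    (gen_poly l).@[p] = (var_image k d l).@[invariant_point p].
Proof.
have [h1 h2] := half_bound d3; have Ec : c = (d + d./2)%N by [].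
move=> lt_l; rewrite /gen_poly.
have [->|l0] := posnP l.
  by rewrite /gen_exp1 /gen_exp2 /= mod0n eqxx var_image0 /param_exp !meval_mnm3
    /invariant_point /=
     !muln0 subn0 muln1 !expr0.
have [le_lc|lt_cl] := leqP l c.
  have lt_l2 : (l < 2 * d)%N by lia.
  rewrite var_image_basis ?l0 // /basis_exp !meval_mnm3 /invariant_point /= /gen_exp1 /gen_exp2
    le_lc.
  have [_ Ea] := basis_exp0P d3 lt_l2; rewrite basis_deg1 ?l0 // in Ea.
  case: (divmod_small d3 lt_l2) Ea => [[-> [-> ?]]|[-> [-> ?]]] Ea.
    rewrite eqxx meval_mnm3 expr0 mulr1 exprMn mulrA; congr (p o0 ^+ _ * _ * _); lia.
  have -> : (l == l - d)%N = false by lia.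
  rewrite mevalD !meval_mnm3 expr1 exprMn mulrDr.
  have -> : (2 * d - (l + (l - d)) = basis_exp0 d l)%N by lia.
  have -> : p o1 ^+ l = p o1 ^+ (l - d) * p o1 ^+ d by rewrite -exprD; congr (_ ^+ _); lia.
  have -> : p o2 ^+ l = p o2 ^+ (l - d) * p o2 ^+ d by rewrite -exprD; congr (_ ^+ _); lia.
  by congr (_ + _); ring.
have [->|l1] := eqVneq l c.+1.
  rewrite /gen_exp1 /gen_exp2 ltnn eqxx eqxx var_image_u /param_exp !meval_mnm3
    /invariant_point /=.
  have -> : (2 * d - (d + d) = 0)%N by lia.
  by rewrite !muln0 muln1 !expr0 exprMn mulr1 mulrA.
have -> : l = c.+2 by lia.
rewrite /gen_exp1 /gen_exp2 var_image_v //.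
have -> : (c.+2 <= c)%N = false by lia.
have -> : (c.+2 == c.+1)%N = false by lia.
have -> : (2 * d == 0)%N = false by lia.
rewrite addn0 subnn mevalD mulr_natl mevalB mevalMn !meval_mnm3 /invariant_point /=.
rewrite !muln0 !muln1 !expr0 !mul1r !mulr1 (mulnC 2 d) !exprM exprMn.
by ring.
Qed.

End Generators.

(** * The ideal of the surface *)

Section GTIdeal.
Variables (k : closedFieldType) (d : nat).
Hypothesis d3 : (3 <= d)%N.
Local Notation c := (gt_codim d).
Variables (mu : nat) (B : mu.-tuple {mpoly k[3]}).

(** The given enumeration of the generators is in bijection with the labels
    below c + 3. *)
Lemma generator_labels (e : k) (prim_e : d.-primitive_root e) : uniq B ->
    (forall f, f \in B <-> GT_generator d e f) ->
  exists (ix : nat -> 'I_mu) (lab : 'I_mu -> nat),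
    [/\ forall i, (lab i < c + 3)%N, forall i, ix (lab i) = i,
        forall l, (l < c + 3)%N -> lab (ix l) = l,
        forall i, tnth B i = gen_poly k d (lab i) & mu = (c + 3)%N].
Proof.
move=> Buniq Benum.
have /fin_all_exists [lab labP] : forall i, exists l, (l < c + 3)%N /\ tnth B i = gen_poly k d l.
  move=> i; have /Benum/(GT_generatorP d3 prim_e)[l lt_l E] := mem_tnth i B.
  by exists l.
have /fin_all_exists [ix ixP] : forall l : 'I_(c.+2).+1, exists i, tnth B i = gen_poly k d l.
  move=> l; have /Benum/tnthP[i E] : GT_generator d e (gen_poly k d l).
    by apply/(GT_generatorP d3 prim_e); exists l => //; rewrite addnC; apply: ltn_ord.
  by exists i.
have Bi : injective (tnth B) by apply/tuple_uniqP.
have ixE l : (l < c + 3)%N -> tnth B (ix (inord l)) = gen_poly k d l.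
  by move=> lt_l; rewrite ixP inordK // -addn3.
have ixK i : ix (inord (lab i)) = i.
  by have [lt_l E] := labP i; apply: Bi; rewrite ixE.
have labK l : (l < c + 3)%N -> lab (ix (inord l)) = l.
  move=> lt_l; have [lt_l' E] := labP (ix (inord l)).
  exact: (gen_poly_inj d3 lt_l' lt_l (etrans (esym E) (ixE _ lt_l))).
exists (fun l => ix (inord l)), lab; split=> //; try by move=> i; have [] := labP i.
apply/eqP; rewrite eqn_leq; apply/andP; split.
  have inj : injective (fun i => Ordinal (proj1 (labP i))).
    by move=> i j [E]; rewrite -(ixK i) -(ixK j) E.
  by have := leq_card _ inj; rewrite !card_ord.
have inj : injective (fun l : 'I_(c + 3) => ix (inord l)).
  by move=> l l' E; apply: val_inj; rewrite /= -(labK _ (ltn_ord l)) E labK.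
by have := leq_card _ inj; rewrite !card_ord.
Qed.

Variables (ix : nat -> 'I_mu) (lab : 'I_mu -> nat).
Hypotheses (lab_lt : forall i, (lab i < c + 3)%N) (ixK : forall i, ix (lab i) = i)
  (labK : forall l, (l < c + 3)%N -> lab (ix l) = l)
  (labE : forall i, tnth B i = gen_poly k d (lab i)).
Local Notation S := {mpoly k[mu]}.
Local Notation pi := (@toric_map k d mu lab).
Local Notation wt := (toric_wt d).

Lemma toric_map_pihomog t f : pi (pihomog mdeg t f) = pihomog wt (2 * d * t) (pi f).
Proof.
have E : pi f = \sum_(s < msize f) pi (pihomog mdeg s f).
  by rewrite {1}[f](pihomog_partitionE (leqnn (msize f))); exact: rmorph_sum.
have {}E : pihomog wt (2 * d * t) (pi f) =
    \sum_(s < msize f) pihomog wt (2 * d * t) (pi (pihomog mdeg s f)).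
  by rewrite E; exact: linear_sum.
rewrite {}E.
have hom s : pi (pihomog mdeg s f) \is (2 * d * s).-homog for wt.
  exact: (toric_map_homog d3 lab_lt (pihomogP _ _ _)).
have [lt_t|le_t] := ltnP t (msize f).
  rewrite (bigD1 (Ordinal lt_t)) //= (pihomog_dE (hom t)) ?big1 ?addr0 // => s ns.
  rewrite (pihomog_ne0 _ (hom s)) // eqn_pmul2l; last by lia.
  by apply: contra ns => /eqP E; apply/eqP/val_inj.
rewrite big1 => [|s _]; last first.
  rewrite (pihomog_ne0 _ (hom s)) // eqn_pmul2l; last by lia.
  by rewrite ltn_eqF // (leq_trans (ltn_ord s)).
rewrite (_ : pihomog mdeg t f = 0) ?rmorph0 //; apply/mpolyP => m; rewrite mcoeff0.
have [Em|/(dhomog_nemf_coeff (pihomogP mdeg t f)) //] := eqVneq (mdeg m) t.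
rewrite pihomogE raddf_sum /= big_seq_cond big1 // => m' /andP[m'f /eqP Em'].
by move: (msize_mdeg_lt m'f); rewrite ltnNge Em' le_t.
Qed.

Lemma meval_scale t (g : S) a v : g \is t.-homog ->
  g.@[fun i => a * v i] = a ^+ t * g.@[v].
Proof.
move=> hg; rewrite !mevalE mulr_sumr big_seq [RHS]big_seq; apply: eq_bigr => m mg.
rewrite mulrCA; congr (_ * _); rewrite -(dhomog_mf hg mg) /= mdegE -prodrXr.
by rewrite -big_split; apply: eq_bigr => i _; rewrite exprMn.
Qed.

Lemma toric_map_eval f p : f.@[fun i => (tnth B i).@[p]] = (pi f).@[invariant_point d p].
Proof.
rewrite /toric_map comp_mpoly_meval; apply: meval_eq => i.
by rewrite tnth_mktuple labE gen_poly_eval.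
Qed.

(** A form vanishes on the surface when its image vanishes at all points
    (x, u, v) coming from k^3 minus the origin.  By [sum_prod_power] these
    include all points with x nonzero, hence x times the image vanishes
    everywhere and is zero. *)
Lemma GT_idealP f : homog_ideal (proj_image B) f <-> pi f = 0.
Proof.
split=> [If|If t y [p [a [_ a0 yE]]]]; last first.
  rewrite (meval_eq _ yE) (meval_scale _ _ (pihomogP _ _ _)) toric_map_eval.
  by rewrite toric_map_pihomog If raddf0 meval0 mulr0.
rewrite [f](pihomog_partitionE (leqnn (msize f))) rmorph_sum big1 // => t _ /=.
(* The factor x confines the check to points with x nonzero, away from the origin. *)
set g := pi _; suff /eqP : 'X_o0 * g = 0.
  by rewrite mulf_eq0 -msize_poly_eq0 msizeX /= => /eqP.
apply: mpoly3_vanish => q; rewrite mevalM mevalXU.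
have [->|q0] := eqVneq (q o0) 0; first by rewrite mul0r.
have [p1 [p2 [E1 E2]]] := @sum_prod_power k d (q o1) (q o2) ltac:(lia).
pose p (i : 'I_3) := [:: q o0; p1; p2]`_i.
have -> : g.@[q] = g.@[invariant_point d p].
  apply: meval_eq => i; rewrite /invariant_point /p /= E1 E2.
  by case: i => [[|[|[|i]]] lti] //=; congr q; apply: val_inj.
rewrite -toric_map_eval If ?mulr0 //.
exists p, 1; split; rewrite ?oner_eq0 //; first by exists o0.
by move=> i; rewrite mul1r.
Qed.

End GTIdeal.

(** * The minimal resolution of the toric ideal *)

Section ToricResolution.
Variables (k : fieldType) (d n : nat) (ix : nat -> 'I_n) (lab : 'I_n -> nat).
Local Notation c := (gt_codim d).
Local Notation S := {mpoly k[n]}.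
Local Notation N := (2 * d)%N.
Hypothesis d3 : (3 <= d)%N.
Hypotheses (lab_lt : forall i, (lab i < c + 3)%N) (ixK : forall i, ix (lab i) = i)
  (labK : forall l, (l < c + 3)%N -> lab (ix l) = l).
Local Notation pi := (@toric_map k d n lab).
Local Notation I := (fun f : S => pi f = 0).
Local Notation T := (koszul_mx k d ix).
Local Notation deg := (fun b : 'I_N => basis_deg d b).

Variable c' : nat.
Hypothesis Ec : c = c'.+1.

Let Tcomm := koszul_mx_comm k d3 lab_lt ixK labK.
Let Treg j v : (j < c'.+1)%N -> koszul_image T j (v *m T j) -> koszul_image T j v.
Proof. by rewrite -Ec; exact: koszul_mx_regular d3 lab_lt ixK labK _ _. Qed.
Let hT := koszul_mx_homog k ix d3.
Let deg2 (b : 'I_N) : (deg b <= 2)%N.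
Proof. by rewrite /basis_deg; do 2?case: ifP. Qed.
Let socle (v : 'rV[k]_N) : (forall l, (l < c'.+1)%N -> v *m (T l)^0 = 0) <->
  (forall b, (deg b < 2)%N -> v 0 b = 0).
Proof. by rewrite -Ec; exact: socleP. Qed.
Let annih s : I s <-> exists W : nat -> 'M_N, s%:M = \sum_(l < c'.+1) T l *m W l.
Proof. by rewrite -Ec; exact: (annihilatorP d3 lab_lt ixK labK). Qed.
Let level0 : mutual_comparison (fun _ : 'I_1 => 0%N) deg (@ideal_row _ _ I 1)
  (koszul_image T c'.+1).
Proof. by rewrite -Ec; exact: (koszul_level0 k d3 lab_lt ixK labK). Qed.

(** The images of the variables have positive weight, so the ideal contains
    no polynomial with a constant term. *)
Lemma const_coef_toric_map f : const_coef (pi f) = const_coef f.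
Proof.
elim/mpoly_var_ind: f => [a|p q Ep Eq|i p Ep].
- by rewrite /toric_map comp_mpolyC /const_coef !mcoeffC !eqxx.
- by rewrite !rmorphD /= Ep Eq.
rewrite !rmorphM /= Ep toric_mapX; congr (_ * _); rewrite [RHS](const_coef_homog (e := 1)) //;
  last first.
  by rewrite dhomogX /= mdeg1.
rewrite /const_coef (dhomog_nemf_coeff (var_image_homog k d3 (lab_lt i))) //= toric_wt0.
by rewrite eq_sym -lt0n; lia.
Qed.

Lemma toric_resolution_exists : exists F, minimal_resolution I F.
Proof.
have res := koszul_resolves Tcomm Treg hT.
apply: (minimal_resolution_exists _ _ _ res level0).
- exact: rmorph0.
- by move=> a f g /= If Ig; rewrite rmorphD rmorphM /= If Ig mulr0 addr0.
by move=> f /= If; rewrite -const_coef_toric_map If raddf0.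
Qed.

Lemma card_deg2 : #|[set b | deg b == 2%N]| = ((d - gcdn d 2) %/ 2)%N.
Proof.
have [h1 h2] := half_bound d3; have Ecc : c = (d + d./2)%N by [].
have -> : ((d - gcdn d 2) %/ 2 = N - c.+1)%N.
  rewrite gcdnC; have [dvd|ndvd] := boolP (2 %| d)%N.
    by rewrite (gcdn_idPl dvd); lia.
  have /eqP -> : coprime 2 d by rewrite prime_coprime.
  by lia.
rewrite -sum1_card (eq_bigl (fun b : 'I_N => (c.+1 <= b)%N)) => [|b]; last first.
  rewrite inE /basis_deg; case: b => -[|b] ltb //=; case: ifP => //; lia.
rewrite -(big_mkord (fun b => c.+1 <= b)%N (fun _ => 1%N)).
rewrite (big_cat_nat (n := c.+1)) //=; last by lia.
rewrite big_nat_cond big1 => [|b]; last by lia.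
rewrite add0n big_nat_cond (eq_bigl (fun b => (c.+1 <= b < N)%N && true)) => [|b].
  by rewrite -big_nat_cond sum_nat_const_nat muln1.
by lia.
Qed.

Variable F : graded_free_seq k n.
Hypothesis minF : minimal_resolution I F.

Lemma toric_betti :
  [/\ frank F c'.+1 = ((d - gcdn d 2) %/ 2)%N,
      forall i, (c'.+1 < i)%N -> frank F i = 0%N,
      forall i (j : 'I_(frank F i)), (fshift j <= 2 + i)%N
    & forall j : 'I_(frank F c'.+1), fshift j = (2 + c'.+1)%N].
Proof.
have [r sh] := top_rank_shift Tcomm Treg hT deg2 socle level0 minF.
rewrite -card_deg2; split=> //.
  exact: (resolution_rank_gt Tcomm Treg hT level0 minF).
exact: (resolution_shift_le Tcomm Treg hT deg2 level0 minF).
Qed.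

Lemma toric_gorenstein_rank (z : 'cV_(frank F c'.+1)) :
  (forall v : 'cV_(frank F c'.+1), dual_cocycle v ->
     exists s : S, dual_coboundary (v - s *: z)) -> (frank F c'.+1 <= 1)%N.
Proof. exact: (gorenstein_rank_le1 Tcomm Treg hT level0 minF). Qed.

Lemma toric_gorenstein_class : frank F c'.+1 = 1%N ->
  exists (z : 'cV_(frank F c'.+1)) (m : int),
    [/\ dual_cocycle z,
        forall j, z j 0 = 0 \/
          exists2 t : nat, t%:Z = m + (fshift j)%:Z & z j 0 \is t.-homog,
        forall v : 'cV_(frank F c'.+1), dual_cocycle v ->
          exists s : S, dual_coboundary (v - s *: z)
      & forall s : S, dual_coboundary (s *: z) <-> I s].
Proof. exact: (gorenstein_class Tcomm Treg hT deg2 socle annih level0 minF). Qed.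

End ToricResolution.

Unset Implicit Arguments.

Theorem proposition4p3 (k : closedFieldType) (char0 : [pchar k] =i pred0)
    (d a : nat) (d_ge3 : (3 <= d)%N) (a_gt0 : (0 < a)%N)
    (a_lt : (2 * a < d)%N) (a_d_coprime : gcdn a d = 1%N)
    (eps : k) (eps_prim : (2 * d).-primitive_root eps)
    (mu : nat) (B : mu.-tuple {mpoly k[3]}) (B_uniq : uniq B)
    (B_enum : forall f, f \in B <-> GT_generator d (eps ^+ 2) f) :
  [/\ arithmetically_CM (proj_image B) /\ proj_dim (proj_image B) 2,
      proj_degree (proj_image B) (2 * d)%N,
      regularity (proj_image B) 3,
      proj_codim (proj_image B) ((3 * d + gcdn d 2 - 2) %/ 2)%N
    & CM_type (proj_image B) ((d - gcdn d 2) %/ 2)%N]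
  /\ (arithmetically_Gorenstein (proj_image B) <-> d = 3%N \/ d = 4%N).
Proof.
have prim_e : d.-primitive_root (eps ^+ 2).
  have := exp_prim_root eps_prim 2; rewrite (gcdn_idPl (dvdn_mulr d (dvdnn 2))).
  by rewrite mulKn.
have [ix [lab [lab_lt ixK labK labE mu_eq]]] := generator_labels d_ge3 prim_e B_uniq B_enum.
have IE : homog_ideal (proj_image B) = (fun f => toric_map d lab f = 0).
  apply: functional_extensionality => f; apply: propositional_extensionality.
  exact: (GT_idealP d_ge3 lab_lt labE).
pose X := proj_image B; pose c := gt_codim d.
have [h1 h2] := half_bound d_ge3; have Ecd : c = (d + d./2)%N by [].
have [c' Ec] : exists c', c = c'.+1 by exists c.-1; lia.
have krull : krull_dim (homog_ideal X) 3 by rewrite /X IE; exact: toric_krull_dim d_ge3 labK.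
have CM : arithmetically_CM X.
  exists 3%N; first exact: krull. by rewrite /X IE; exact: (toric_depth k d_ge3 lab_lt labK).
have gcd2 : gcdn d 2 = (if odd d then 1 else 2)%N.
  rewrite gcdnC; case: ifP => od; last by apply/gcdn_idPl; rewrite dvdn2 od.
  by apply/eqP; rewrite -[_ == _]/(coprime 2 d) prime_coprime // dvdn2 od.
have Ecod : ((3 * d + gcdn d 2 - 2) %/ 2)%N = c by rewrite gcd2; case: ifP; lia.
have type_gt0 : (0 < (d - gcdn d 2) %/ 2)%N by rewrite gcd2; case: ifP; lia.
have codim : proj_codim X c by exists 2%N; [exact: krull | rewrite mu_eq; lia].
have [F minF] := toric_resolution_exists k d_ge3 lab_lt ixK labK Ec.
have [rF rF0 sF sFtop] := toric_betti d_ge3 lab_lt ixK labK Ec minF.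
have minFX : minimal_resolution (homog_ideal X) F by rewrite /X IE.
split; first split.
- by split.
- have [sz lc] := size_hilbert_poly d_ge3.
  exists 2%N, (hilbert_poly d); split=> //.
    by rewrite /X IE; exact: (toric_hilbert_polynomial k d_ge3 lab_lt labK).
  by rewrite lc -natrM.
- exists F => //; split=> [i j|]; first by have := sF i.+1 j; lia.
  have j : 'I_(frank F c'.+1) by rewrite rF; exact: Ordinal type_gt0.
  by exists c', j; rewrite sFtop; lia.
- by rewrite Ecod.
- by split=> //; exists F => //; exists c'.+1.
have typeE : ((d - gcdn d 2) %/ 2 <= 1)%N <-> d = 3%N \/ d = 4%N.
  by rewrite gcd2; case: ifP => od; split; lia.
split=> [[_ [G [c0 [minG [r krullG codimG] [z [m [_ _ gen _]]]]]]]|d34].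
  apply/typeE.
  (* The dimension is well defined, so [c0] is the last step of [G]. *)
  have Er : r = 2%N.
    have [[P chP] leP] := krullG; have [[P' chP'] leP'] := krull.
    by have := leP _ _ chP'; have := leP' _ _ chP; lia.
  have Ec0 : c0 = c'.+1 by rewrite -Ec; lia.
  subst c0; rewrite /X IE in minG.
  have [rG _ _ _] := toric_betti d_ge3 lab_lt ixK labK Ec minG.
  by rewrite -rG; exact: (toric_gorenstein_rank d_ge3 lab_lt ixK labK Ec minG gen).
split; first exact: CM.
exists F, c'.+1; split; [exact: minFX | by rewrite -Ec |].
have r1 : frank F c'.+1 = 1%N by rewrite rF; apply/eqP; rewrite eqn_leq type_gt0 andbT;
  apply/typeE.
rewrite /X IE.
exact: (toric_gorenstein_class d_ge3 lab_lt ixK labK Ec minF r1).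
Qed.
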